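(* Let $A,B,b,(u_n),(\gamma_n),(x_n)$, the mean operators $\mathcal A,\mathcal B$ and the set $\mathcal Z=Z(\mathcal A+\mathcal B)$ be as introduced in the context. Assume the following. 1. The monotone operator $\mathcal A$ is maximal. 2. There exist an integer $p\ge 1$ and a point $x_\star\in\mathcal Z$ such that $\mathcal R_{2p}(x_\star)\neq\emptyset$. 3. For any compact set $K\subset\mathbb R^N$, there exists $\varepsilon\in\,]0,1]$ such that $$\sup_{x\in K\cap\mathcal D}\int\|A_0(\xi,x)\|^{1+\varepsilon}\,\mu(d\xi)<\infty ,$$ and moreover there exists $y_0\in\mathcal D$ such that $\int\|A_0(\xi,y_0)\|^{1+1/\varepsilon}\,\mu(d\xi)<\infty$. 4. There exists $C>0$ such that for all $x\in\mathbb R^N$, $\int d(\xi,x)^2\,\mu(d\xi)\ge C\,\boldsymbol d(x)^2$; furthermore $\gamma_{n+1}/\gamma_n\to 1$. 5. There exists $C>0$ such that for any $x\in\mathbb R^N$ and any $\gamma>0$, $$\frac1{\gamma^4}\int\|J_\gamma(\xi,x)-\Pi(\xi,x)\|^4\,\mu(d\xi)\le C(1+\|x\|^{2p}),$$ where $p$ is the integer of item 2. 6. There exists $M:\Xi\to\mathbb R_+$ such that $M^{2p}$ is $\mu$-integrable and $\|b(\xi,x)\|\le M(\xi)(1+\|x\|)$ for all $x\in\mathbb R^N$. Moreover, there exists $C>0$ such that $\int\|b(\xi,x)\|^4\,\mu(d\xi)\le C(1+\|x\|^{2p})$ for all $x\in\mathbb R^N$. 7. The operator $\mathcal A+\mathcal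 B$ is demipositive. 8. For any $x_\star\in\mathcal Z$, the set $\mathcal R_2(x_\star)$ is not empty. Then, for any initial value $x_0$, there exists a random variable $U$, supported by $\mathcal Z$, such that $x_n\to U$ almost surely as $n\to\infty$.
   Context: Operators. A set-valued operator $\mathsf A:\mathbb R^N\rightrightarrows\mathbb R^N$ is monotone if $\langle y-y',x-x'\rangle\ge0$ for all $(x,y),(x',y')$ in its graph $\mathrm{gr}(\mathsf A)$; a non-empty monotone operator is maximal if its graph is maximal for inclusion among graphs of monotone operators. $\mathcal M$ is the set of maximal monotone operators on $\mathbb R^N$; $\mathrm{dom}(\mathsf A)=\{x:\mathsf A(x)\ne\emptyset\}$; $Z(\mathsf A)=\{x:0\in\mathsf A(x)\}$; $\mathrm{cl}$ is closure. A maximal monotone operator $\mathsf A$ is demipositive if there exists $w\in Z(\mathsf A)$ such that for every sequence $((u_n,v_n))$ in $\mathrm{gr}(\mathsf A)$ such that $(u_n)$ converges to some $u$ and $(v_n)$ is bounded, $\langle u_n-w,v_n\rangle\to0$ implies $u\in Z(\mathsf A)$. (Items 1--6 imply that $\mathcal A+\mathcal B$ is maximal.) Set-valued integrals. $(\Xi,\mathcal T,\mu)$ is a probability space with $\mathcal T$ $\mu$-complete. A closed-set-valued function $F$ on $\Xi$ is measurable if $\{\xi:F(\xi)\cap H\ne\emptyset\}\in\mathcal T$ for every Borel set $H$. For $1\le q<\infty$, $\mathcal S^q_F$ is the set of $\varphi\in\mathcal L^q(\Xi,\mathcal T,\mu;\mathbb R^N)$ with $\varphi(\xi)\in F(\xi)$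 $\mu$-a.e.; $F$ is integrable if $\mathcal S^1_F\ne\emptyset$; its Aumann integral is $\int F\,d\mu=\{\int\varphi\,d\mu:\varphi\in\mathcal S^1_F\}$. Random operator $A$. $A:\Xi\to\mathcal M$ is such that $\xi\mapsto\mathrm{gr}(A(\xi,\cdot))$ is measurable; $A(\xi,x)$ is the image of $x$ under $A(\xi,\cdot)$. $D(\xi)=\mathrm{dom}(A(\xi,\cdot))$; for $x\in D(\xi)$, $A_0(\xi,x)$ is the element of least norm of $A(\xi,x)$; $J_\gamma(\xi,x)=(I+\gamma A(\xi,\cdot))^{-1}(x)$ for $\gamma>0$. $\Pi(\xi,\cdot)$ is the projection onto $\mathrm{cl}(D(\xi))$, and $d(\xi,\cdot)$ the distance function to $D(\xi)$. $\mathcal D=\{x\in\mathbb R^N:\mu(\{\xi:x\in D(\xi)\})=1\}$ is assumed non-empty, $\boldsymbol d(\cdot)$ is the distance function to $\mathcal D$, and $A(\cdot,x)$ is assumed integrable for each $x\in\mathcal D$. The monotone operator $\mathcal A$ has domain $\mathcal D$ and $\mathcal A(x)=\int A(\xi,x)\,\mu(d\xi)$ (Aumann integral) for $x\in\mathcal D$. Random operator $B$. $B:\Xi\to\mathcal M$ is such that $\xi\mapsto\mathrm{gr}(B(\xi,\cdot))$ is measurable, $\mathrm{dom}(B(\xi,\cdot))=\mathbb R^N$ for almost every $\xi$, and $B(\cdot,x)$ is integrable for every $x\in\mathbb R^N$; $\mathcal B(x)=\int B(\xi,x)\,\mu(d\xi)$ (Aumann integral). The map $b:\Xi\times\mathbb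 R^N\to\mathbb R^N$ is $\mathcal T\otimes\mathcal B(\mathbb R^N)$-measurable (product of $\mathcal T$ with the Borel field) with $b(\cdot,x)\in\mathcal S^1_{B(\cdot,x)}$ for every $x$. $\mathcal Z=Z(\mathcal A+\mathcal B)$, and for $x_\star\in\mathcal Z$ and $q\geq 1$, $$\mathcal R_{q}(x_\star)=\Big\{(\varphi,\psi)\in\mathcal S^{q}_{A(\cdot,x_\star)}\times\mathcal S^{q}_{B(\cdot,x_\star)}:\int\varphi\,d\mu+\int\psi\,d\mu=0\Big\}.$$ Algorithm. $(u_n)_{n\ge1}$ is an iid sequence of random variables on a probability space $(\Omega,\mathcal F,\mathbb P)$ with values in $(\Xi,\mathcal T)$ and distribution $\mu$. $(\gamma_n)_{n\ge1}$ is a positive sequence in $\ell^2\setminus\ell^1$. Given an arbitrary $x_0\in\mathbb R^N$, $$x_{n+1}=J_{\gamma_{n+1}}\big(u_{n+1},\,x_n-\gamma_{n+1}b(u_{n+1},x_n)\big),\qquad n\ge0.$$ *)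

(* Defs.v *)
From mathcomp Require Import all_boot all_order all_algebra.
From mathcomp Require Import all_classical all_reals all_analysis.

Set Implicit Arguments.
Unset Strict Implicit.
Unset Printing Implicit Defensive.

Import Order.TTheory GRing.Theory Num.Theory.
Import numFieldNormedType.Exports.

Local Open Scope classical_set_scope.
Local Open Scope ring_scope.

Section euclidean.
Context {R : realType} {N : nat}.
Local Notation V := 'rV[R]_N.
Implicit Types (x y : V) (C : set V).

Definition dot x y : R := \sum_(i < N) x ord0 i * y ord0 i.

(* The library norm `|x| on row vectors is the sup norm; it induces the same
   topology, but the statement needs the Euclidean one. *)
Definition enorm x : R := Num.sqrt (dot x x).

Definition dist C x : R := inf [set enorm (x - y) | y in C].

(* Unique when C is nonempty, closed and convex; 0 is a junk value. *)
Definition proj_on C x : V :=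
  xget 0 [set y | C y /\ forall z, C z -> enorm (x - y) <= enorm (x - z)].

Definition least_norm C : V :=
  xget 0 [set y | C y /\ forall z, C z -> enorm y <= enorm z].

End euclidean.

(* R^N equipped with its Borel sigma-algebra. *)
Definition borelRV (R : realType) (N : nat) :=
  g_sigma_algebraType (@open 'rV[R]_N).

Section operators.
Context {R : realType} {N : nat}.
Local Notation V := 'rV[R]_N.

Definition operator := V -> set V.

Implicit Types (A B : operator) (x : V) (g : R).

Definition gr A : set (V * V) := [set z | A z.1 z.2].

Definition dom A : set V := [set x | A x !=set0].

Definition zeros A : set V := [set x | A x 0].

Definition addop A B : operator :=
  fun x => [set y + z | y in A x & z in B x].

Definition monotone_op A : Prop :=
  forall x y x' y', A x y -> A x' y' -> 0 <= dot (y - y') (x - x').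

Definition maximal_monotone A : Prop :=
  [/\ gr A !=set0, monotone_op A &
      forall A', monotone_op A' -> gr A `<=` gr A' -> gr A' = gr A].

(* (I + g A)^-1 x, which is a singleton when A is maximal monotone and g > 0. *)
Definition resolvent g A x : V :=
  xget 0 [set y | exists2 v, A y v & x = y + g *: v].

(* Maximality of A is not repeated here: the notion is only used for operators
   that are maximal monotone. *)
Definition demipositive A : Prop :=
  exists2 w, zeros A w &
    forall (u v : nat -> V) (u_lim : V),
      (forall n, A (u n) (v n)) ->
      u @ \oo --> u_lim ->
      (exists M : R, forall n, enorm (v n) <= M) ->
      (fun n => dot (u n - w) (v n)) @ \oo --> (0 : R) ->
      zeros A u_lim.

End operators.

Arguments operator : clear implicits.

Section set_valued.
Context {R : realType} {N : nat}.
Local Notation V := 'rV[R]_N.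
Context d (Xi : measurableType d) (mu : probability Xi R).

Definition set_measurable (T : topologicalType) (F : Xi -> set T) : Prop :=
  forall H : set T, <<s open >> H -> measurable [set xi | F xi `&` H !=set0].

Definition random_operator (A : Xi -> operator R N) : Prop :=
  (forall xi, maximal_monotone (A xi)) /\ set_measurable (fun xi => gr (A xi)).

Definition vintegral (phi : Xi -> V) : V :=
  \row_(i < N) \int[mu]_xi (phi xi ord0 i).

Definition selections (q : R) (F : Xi -> set V) : set (Xi -> V) :=
  [set phi | [/\ measurable_fun setT (phi : Xi -> borelRV R N),
                 (\int[mu]_xi (enorm (phi xi) `^ q)%:E < +oo)%E &
                 {ae mu, forall xi, F xi (phi xi)}]].

Definition set_integrable (F : Xi -> set V) : Prop := selections 1 F !=set0.

Definition aumann (F : Xi -> set V) : set V :=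
  [set vintegral phi | phi in selections 1 F].

Definition mean_domain (A : Xi -> operator R N) : set V :=
  [set x | mu [set xi | dom (A xi) x] = 1%:E].

Definition mean_operator (A : Xi -> operator R N) : operator R N :=
  fun x => [set y | mean_domain A x /\ aumann (fun xi => A xi x) y].

(* The set R_q(x) of pairs of q-integrable selections with opposite means. *)
Definition zero_selections (A B : Xi -> operator R N) (q : R) (x : V) :
    set ((Xi -> V) * (Xi -> V)) :=
  [set z | [/\ selections q (fun xi => A xi x) z.1,
               selections q (fun xi => B xi x) z.2 &
               vintegral z.1 + vintegral z.2 = 0]].

End set_valued.

Section algorithm.
Context {R : realType} {N : nat}.
Local Notation V := 'rV[R]_N.
Context d (Xi : measurableType d) (mu : probability Xi R).
Context d' (Omega : measurableType d') (P : probability Omega R).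

Definition iid (u : nat -> {RV P >-> Xi}) : Prop :=
  (forall n (E : set Xi), measurable E -> distribution P (u n) E = mu E) /\
  (forall (J : seq nat) (E : nat -> set Xi), uniq J ->
     (forall n, measurable (E n)) ->
     P (\bigcap_(n in [set` J]) (u n @^-1` E n)) =
     (\prod_(n <- J) P (u n @^-1` E n))%E).

(* Only the values gamma n and u n with n >= 1 are used. *)
Fixpoint iterates (A : Xi -> operator R N) (b : Xi -> V -> V) (gamma : nat -> R)
    (u : nat -> {RV P >-> Xi}) (x0 : V) (n : nat) (omega : Omega) : V :=
  if n is m.+1 then
    let x := iterates A b gamma u x0 m omega in
    resolvent (gamma m.+1) (A (u m.+1 omega))
      (x - gamma m.+1 *: b (u m.+1 omega) x)
  else x0.

End algorithm.

(* Main.v *)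
(** For a zero [w] of the mean operator, the squared distances |x_n - w|^2 are
    nonincreasing up to summable errors and a convergent martingale, hence converge
    almost surely.  By Opial's argument it then suffices to exhibit, for
    almost every trajectory, one cluster point that is a zero.

    For [(y, a)] in the graph of the mean operator of A, monotonicity gives, up to
    errors that vanish along suitable time windows,
    |x_t - y|^2 - |x_s - y|^2 <= - 2 sum gamma_k <bbar(x_k) + a, x_k - y>, where
    [bbar] is the mean of [b].  The selection representing [a] is only integrable: it
    is truncated, and its tail is small on infinitely many windows with
    probability one.  On short windows the trajectory moves by at most a multiple
    of the elapsed time, so a limit of the mean velocities [-(a_ + b_)] at a cluster
    point [x_] exists; maximality puts [a_] in the first mean operator, and Mazur's
    lemma puts [b_], a limit of averages of [bbar(x_k)], in the Aumann integral of B.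
    Since |x_n - w|^2 converges, [<a_ + b_, x_ - w> = 0], and demipositivity, applied
    to a constant sequence, makes [x_] a zero. *)

From HB Require Import structures.
Require Import Defs.
From mathcomp Require Import all_boot all_order all_algebra.
From mathcomp Require Import all_classical all_reals all_analysis.
From mathcomp Require Import measurable_realfun lra ring.
Import Order.TTheory GRing.Theory Num.Theory.
Import numFieldNormedType.Exports.
Local Open Scope classical_set_scope.
Local Open Scope ring_scope.

Set Implicit Arguments.
Unset Strict Implicit.
Unset Printing Implicit Defensive.

(** * Euclidean norm *)

(** The main obstacle is that nothing bounds the backward velocity, the element of [A xi] selected
    by the resolvent, so trajectories have no a priori modulus of continuity. The available control
    is one-sided: squared distances to domain points grow at most linearly with elapsed time. Summed
    over finitely many points that affinely span the domain they stay bounded, so on one of many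
    consecutive pieces the sum drops by at most its share. There each distance varies little in both
    directions, and differences of squared distances recover the displacement. The truncation tail
    has a small mean but no variance bound, so Markov's inequality yields good windows for
    infinitely many starting times, not for all, and with a truncation level that depends on the
    trajectory. Each window serves finitely many test points with one tolerance; the limit over such
    windows gives one cluster point, which is the input that Opial's argument needs. Almost sure
    statements are collected over countable families: test pairs dense in the graph of the mean
    operator, a dense sequence of zeros, integer truncation levels and radii. *)

Lemma cvg_sumr {R : realType} (T I : Type) (F : set_system T) {FF : Filter F}
    (s : seq I) (f : I -> T -> R) (l : I -> R) :
  (forall i, f i @ F --> l i) ->
  (fun t => \sum_(i <- s) f i t) @ F --> \sum_(i <- s) l i.
Proof.
move=> fl; elim: s => [|i s IH].
  by under eq_fun do rewrite big_nil; rewrite big_nil; exact: cvg_cst.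
under eq_fun do rewrite big_cons.
by rewrite big_cons; exact: cvgD.
Qed.

Lemma ler_cvg2 {R : realType} (T : Type) (F : set_system T) {FF : ProperFilter F}
    (f g : T -> R) (l m : R) :
  f @ F --> l -> g @ F --> m -> (\forall t \near F, f t <= g t) -> l <= m.
Proof.
move=> fl gm fg; rewrite -subr_le0.
apply: (@cvgr_to_le _ F _ _ (fun t => f t - g t)); first exact: cvgB.
by apply: filterS fg => t; rewrite subr_le0.
Qed.

Section euclidean_space.
Context {R : realType} {N : nat}.
Local Notation V := 'rV[R]_N.
Implicit Types (x y z : V) (a r : R).

Lemma dotC x y : dot x y = dot y x.
Proof. by apply: eq_bigr => i _; rewrite mulrC. Qed.

Lemma dotDl x y z : dot (x + y) z = dot x z + dot y z.
Proof. by rewrite /dot -big_split; apply: eq_bigr => i _; rewrite mxE mulrDl. Qed.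

Lemma dotZl a x y : dot (a *: x) y = a * dot x y.
Proof. by rewrite /dot mulr_sumr; apply: eq_bigr => i _; rewrite mxE mulrA. Qed.

Lemma dotNl x y : dot (- x) y = - dot x y.
Proof. by rewrite -scaleN1r dotZl mulN1r. Qed.

Lemma dotDr x y z : dot x (y + z) = dot x y + dot x z.
Proof. by rewrite dotC dotDl !(dotC x). Qed.

Lemma dotZr a x y : dot x (a *: y) = a * dot x y.
Proof. by rewrite dotC dotZl dotC. Qed.

Lemma dotNr x y : dot x (- y) = - dot x y.
Proof. by rewrite dotC dotNl dotC. Qed.

Lemma dot0l x : dot 0 x = 0.
Proof. by rewrite -(scale0r 0) dotZl mul0r. Qed.

Lemma dot0r x : dot x 0 = 0.
Proof. by rewrite dotC dot0l. Qed.

Definition dotE := (dotDl, dotDr, dotNl, dotNr, dotZl, dotZr, dot0l, dot0r).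

Lemma dot_suml (I : Type) (s : seq I) (P : pred I) (F : I -> V) y :
  dot (\sum_(i <- s | P i) F i) y = \sum_(i <- s | P i) dot (F i) y.
Proof.
by elim/big_rec2 : _ => [|i u v _ <-]; rewrite ?dot0l// dotDl.
Qed.

Lemma dot_ge0 x : 0 <= dot x x.
Proof. by apply: sumr_ge0 => i _; rewrite -expr2 sqr_ge0. Qed.

Lemma dot_eq0 x : dot x x = 0 -> x = 0.
Proof.
move=> /eqP; rewrite psumr_eq0; last by move=> i _; rewrite -expr2 sqr_ge0.
move=> /allP x0; apply/rowP => i; rewrite mxE; apply/eqP.
by have := x0 i; rewrite mem_index_enum mulf_eq0 orbb => /(_ isT).
Qed.

Lemma enorm_ge0 x : 0 <= enorm x. Proof. exact: sqrtr_ge0. Qed.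

Lemma enorm_sqr x : enorm x ^+ 2 = dot x x.
Proof. by rewrite sqr_sqrtr// dot_ge0. Qed.

Lemma enorm0 : enorm (0 : V) = 0.
Proof. by rewrite /enorm dot0l sqrtr0. Qed.

Lemma enorm_eq0 x : enorm x = 0 -> x = 0.
Proof. by move=> x0; apply: dot_eq0; rewrite -enorm_sqr x0 expr0n. Qed.

Lemma enormN x : enorm (- x) = enorm x.
Proof. by rewrite /enorm !dotE opprK. Qed.

Lemma enormBC x y : enorm (x - y) = enorm (y - x).
Proof. by rewrite -enormN opprB. Qed.

Lemma enormZ a x : enorm (a *: x) = `|a| * enorm x.
Proof. by rewrite /enorm !dotE mulrA -expr2 sqrtrM ?sqr_ge0// sqrtr_sqr. Qed.

Lemma dot_young r x y : 0 < r -> 2 * dot x y <= r * dot x x + r^-1 * dot y y.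
Proof.
move=> r0; have := dot_ge0 (r *: x - y); rewrite !dotE (dotC y x) => h.
rewrite -(ler_pM2l r0) mulrDr [r * (r^-1 * _)]mulrA mulfV ?gt_eqF// mul1r.
by nra.
Qed.

Lemma dot_le x y : dot x y <= enorm x * enorm y.
Proof.
have [->|x0] := eqVneq x 0; first by rewrite dot0l enorm0 mul0r.
have [->|y0] := eqVneq y 0; first by rewrite dot0r enorm0 mulr0.
have ex : 0 < enorm x.
  by rewrite lt_def enorm_ge0 andbT; apply: contra_neq x0 => /enorm_eq0.
have ey : 0 < enorm y.
  by rewrite lt_def enorm_ge0 andbT; apply: contra_neq y0 => /enorm_eq0.
(* This weight makes both terms of Young's inequality equal to [enorm x * enorm y]. *)
have := @dot_young (enorm y / enorm x) x y (divr_gt0 ey ex).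
rewrite -!enorm_sqr invf_div => h.
have : 2 * dot x y <= 2 * (enorm x * enorm y).
  apply: (le_trans h); rewrite le_eqVlt; apply/orP; left; apply/eqP.
  by field; rewrite !gt_eqF.
by rewrite ler_pM2l.
Qed.

Lemma normr_dot_le x y : `|dot x y| <= enorm x * enorm y.
Proof.
rewrite ler_norml dot_le andbT lerNl -dotNl.
by rewrite (le_trans (dot_le _ _))// enormN.
Qed.

Lemma enormD x y : enorm (x + y) <= enorm x + enorm y.
Proof.
rewrite -(@ler_pXn2r _ 2)// ?nnegrE ?addr_ge0 ?enorm_ge0//.
rewrite enorm_sqr !dotE (dotC y x) sqrrD !enorm_sqr.
by have := dot_le x y; lra.
Qed.

Lemma enormB x y : enorm (x - y) <= enorm x + enorm y.
Proof. by rewrite (le_trans (enormD _ _))// enormN. Qed.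

Lemma enorm_triangle z x y : enorm (x - y) <= enorm (x - z) + enorm (z - y).
Proof. by rewrite -[x - y](subrKA z) enormD. Qed.

Lemma enorm_sum (I : Type) (s : seq I) (P : pred I) (F : I -> V) :
  enorm (\sum_(i <- s | P i) F i) <= \sum_(i <- s | P i) enorm (F i).
Proof.
elim/big_rec2 : _ => [|i u v _ le]; first by rewrite enorm0.
by rewrite (le_trans (enormD _ _))// lerD2l.
Qed.

Lemma enormD_sqr x y : enorm (x + y) ^+ 2 <= 2 * enorm x ^+ 2 + 2 * enorm y ^+ 2.
Proof.
rewrite !enorm_sqr !dotE (dotC y x).
by have := dot_ge0 (x - y); rewrite !dotE (dotC y x); lra.
Qed.

Lemma coord_le_enorm x i : `|x ord0 i| <= enorm x.
Proof.
rewrite -sqrtr_sqr ler_sqrt ?dot_ge0// /dot (bigD1 i)//= -expr2 lerDl.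
by apply: sumr_ge0 => j _; rewrite -expr2 sqr_ge0.
Qed.

Lemma enorm_le_sum x : enorm x <= \sum_(i < N) `|x ord0 i|.
Proof.
rewrite {1}(row_sum_delta x) (le_trans (enorm_sum _ _ _))//.
apply: ler_sum => i _; rewrite enormZ ler_piMr//.
rewrite /enorm /dot (bigD1 i)//= big1 ?addr0; last first.
  by move=> j ji; rewrite !mxE eqxx (negbTE ji) mul0r.
by rewrite !mxE !eqxx mulr1 sqrtr1.
Qed.

(** The Euclidean norm lies between each coordinate and the sum of their absolute values, hence
    generates the library topology. Dividing by [N.+1] instead of [N] keeps the estimate strict and
    covers [N = 0]. *)
Lemma nbhs_enorm x (A : set V) :
  nbhs x A <-> exists2 e : R, 0 < e & forall y, enorm (x - y) < e -> A y.
Proof.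
split => [/nbhs_ballP|] [e /= e0 eA]; last first.
  apply/nbhs_ballP; exists (e / N.+1%:R) => /=; first by rewrite divr_gt0.
  move=> y [_ xy]; apply: eA; rewrite (le_lt_trans (enorm_le_sum _))//.
  apply: (@le_lt_trans _ _ (\sum_(i < N) e / N.+1%:R)).
    apply: ler_sum => i _; rewrite !mxE.
    by have := xy ord0 i; rewrite /ball /= => /ltW.
  rewrite sumr_const card_ord -[ltLHS]mulr_natr -mulrA -[ltRHS]mulr1 ltr_pM2l//.
  by rewrite mulrC ltr_pdivrMr// mul1r ltr_nat.
exists e => // y xy; apply: eA; split => // i j; rewrite /ball /=.
rewrite ord1; apply: le_lt_trans xy.
by have := coord_le_enorm (x - y) j; rewrite !mxE.
Qed.

Lemma cvg_enormP (T : Type) (F : set_system T) {FF : Filter F} (f : T -> V) x :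
  f @ F --> x <-> (fun t => enorm (f t - x)) @ F --> (0 : R).
Proof.
split=> [fx|].
  apply/cvgrPdist_lt => e e0; apply: (fx [set y | `|0 - enorm (y - x)| < e]).
  apply/nbhs_enorm; exists e => // y /=.
  by rewrite sub0r normrN ger0_norm ?enorm_ge0// enormBC.
move=> /cvgrPdist_lt fx A /nbhs_enorm [e e0 eA]; rewrite /nbhs /=.
have := fx _ e0; apply: filterS => t /=.
by rewrite sub0r normrN ger0_norm ?enorm_ge0// enormBC; exact: eA.
Qed.

Lemma cvg_enorm_ltP (f : nat -> V) x :
  f @ \oo --> x <->
  forall e : R, 0 < e -> exists n, forall m, (n <= m)%N -> enorm (f m - x) < e.
Proof.
rewrite cvg_enormP cvgrPdist_lt; split=> h e e0.
  have [n _ hn] := h _ e0; exists n => m /hn /=.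
  by rewrite sub0r normrN ger0_norm// enorm_ge0.
have [n hn] := h _ e0; exists n => // m /hn /=.
by rewrite sub0r normrN ger0_norm// enorm_ge0.
Qed.

Lemma cvg_coord (T : Type) (F : set_system T) {FF : Filter F} (f : T -> V) x :
  f @ F --> x <-> forall i, (fun t => f t ord0 i) @ F --> x ord0 i.
Proof.
split=> [/cvg_enormP/cvgrPdist_lt h i|h].
  apply/cvgrPdist_lt => e /h; apply: filterS => t /=.
  rewrite sub0r normrN ger0_norm ?enorm_ge0// enormBC; apply: le_lt_trans.
  by have := coord_le_enorm (x - f t) i; rewrite !mxE.
apply/cvg_enormP; apply: (@squeeze_cvgr _ _ _ _ (fun=> 0)
  (fun t => \sum_(i < N) `|(f t - x) ord0 i|)).
- by apply: nearW => t; rewrite enorm_ge0 enorm_le_sum.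
- exact: cvg_cst.
- rewrite -[X in _ --> X](_ : \sum_(i < N) 0 = 0); last by rewrite big1.
  apply: cvg_sumr => i; rewrite -[X in _ --> X](normr0 R); apply: cvg_norm.
  rewrite -[X in _ --> X](subrr (x ord0 i)).
  under eq_fun do rewrite !mxE.
  by apply: cvgB => //; apply: cvg_cst.
Qed.

Lemma dist_le (C : set V) x y : C y -> dist C x <= enorm (x - y).
Proof.
move=> Cy; apply: ge_inf; last by exists y.
by exists 0 => _ [z _ <-]; exact: enorm_ge0.
Qed.

Lemma dist_ge0 (C : set V) x : 0 <= dist C x.
Proof.
rewrite /dist; have [->|C0] := eqVneq C set0; first by rewrite image_set0 inf0.
apply: lb_le_inf; last by move=> _ [z _ <-]; exact: enorm_ge0.
by have /set0P[y Cy] := C0; exists (enorm (x - y)), y.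
Qed.

Lemma dist_lt (C : set V) x e : C !=set0 -> dist C x < e ->
  exists2 y, C y & enorm (x - y) < e.
Proof.
move=> [c Cc] /inf_lt[|_ [y Cy <-] xy]; last by exists y.
by exists (enorm (x - c)), c.
Qed.

End euclidean_space.

(** * Resolvents of maximal monotone operators *)

Lemma fmap_ultra (T T' : Type) (f : T -> T') (U : set_system T) :
  UltraFilter U -> UltraFilter (f @ U).
Proof.
move=> UU; have PU : ProperFilter U by exact: ultra_proper.
split; first exact: fmap_proper_filter.
move=> G PG UG; apply/seteqP; split => // B GB.
have [//|UnB] := in_ultra_setVsetC (f @^-1` B) UU.
by have /filter_ex[x []] : G (B `&` ~` B) by apply: filterI => //; apply: UG.
Qed.

(** Ultrafilter limits replace the extraction of subsequences: all bounded sequences converge along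
    the same ultrafilter, so no nested choices are made. *)
Lemma bounded_ultra_cvg {R : realType} {N : nat} (T : Type) (U : set_system T)
    (f : T -> 'rV[R]_N) (S : R) :
  UltraFilter U -> (forall t, enorm (f t) <= S) -> exists l : 'rV[R]_N, f @ U --> l.
Proof.
move=> UU fS.
have := @rV_compact R N (fun=> [set` `[- S, S]]) (fun=> @segment_compact _ _ _).
have PU : ProperFilter U by exact: ultra_proper.
rewrite compact_ultra => /(_ (f @ U)) [].
- exact: fmap_ultra.
- apply: (@filterE _ U) => t i /=.
  rewrite in_itv /= -ler_norml (le_trans _ (fS t))//; exact: coord_le_enorm.
- by move=> l [_ fl]; exists l.
Qed.

Lemma cvg_dot {R : realType} {N : nat} (T : Type) (F : set_system T)
    {FF : Filter F} (f g : T -> 'rV[R]_N) x y :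
  f @ F --> x -> g @ F --> y -> (fun t => dot (f t) (g t)) @ F --> dot x y.
Proof.
move=> /cvg_coord fx /cvg_coord gy.
by apply: cvg_sumr => i; apply: cvgM; [exact: fx|exact: gy].
Qed.

Lemma cvg_dotl {R : realType} {N : nat} (T : Type) (F : set_system T)
    {FF : Filter F} (f : T -> 'rV[R]_N) x y :
  f @ F --> x -> (fun t => dot (f t) y) @ F --> dot x y.
Proof. by move=> fx; apply: cvg_dot => //; exact: cvg_cst. Qed.

Section minty.
Context {R : realType} {N : nat}.
Local Notation V := 'rV[R]_N.
Implicit Types (A : operator R N) (x y v w : V).

(** Adding [(x, v)] to the graph keeps it monotone, so by maximality the pair was already there. *)
Lemma maximal_monotone_mem A x v : maximal_monotone A ->
  (forall y w, A y w -> 0 <= dot (v - w) (x - y)) -> A x v.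
Proof.
move=> [_ mA maxA] xv.
pose A' : operator R N := fun y => [set w | A y w \/ (y = x /\ w = v)].
have mA' : monotone_op A'.
  move=> y w y' w' [Ayw|[-> ->]] [Ayw'|[-> ->]].
  - exact: mA.
  - by rewrite -(opprB v) -(opprB x) dotNl dotNr opprK; exact: xv.
  - exact: xv.
  - by rewrite !subrr dot0l.
have : gr A' (x, v) by right.
by rewrite (maxA _ mA')// => -[y w]; left.
Qed.

(* The minimum of the Fitzpatrick function plus [(|x|^2 + |v|^2) / 2] is
   attained, and at a minimizer [(x, v)] the first-order condition says that
   [(- v, - x)] is monotonically related to the graph. *)
Lemma minty A : gr A !=set0 -> monotone_op A ->
  (forall x v, (forall y w, A y w -> 0 <= dot (v - w) (x - y)) -> A x v) ->
  exists x, A x (- x).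
Proof.
move=> [[a0 b0] /= A0] mA maxA.
(* [E x v t] puts [(x, v, t)] in the epigraph of the Fitzpatrick function plus the quadratic term;
   the supremum, possibly infinite, is never formed. *)
pose E x v (t : R) := forall a b, A a b ->
  dot x b + dot a v - dot a b + (dot x x + dot v v) / 2 <= t.
have F_ge x v t : E x v t -> dot x v + (dot x x + dot v v) / 2 <= t.
  move=> Et; have [Axv|] := pselect (A x v).
    by apply: le_trans (Et _ _ Axv); rewrite addrK.
  (* Off the graph, a Fitzpatrick value below [dot x v] would make [(x, v)] monotonically related to
     every point of the graph. *)
  move=> nAxv; apply: contrapT => /negP; rewrite -ltNge => tlt.
  apply: nAxv; apply: maxA => y w /Et yw.
  by rewrite !dotE (dotC v y) (dotC v x) (dotC w x) (dotC w y); lra.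
have E_ge0 x v t : E x v t -> 0 <= t.
  move=> /F_ge; apply: le_trans.
  by have := dot_ge0 (x + v); rewrite !dotE (dotC v x); lra.
pose T := [set t | exists x, exists v, E x v t].
have T_lb : has_lbound T by exists 0 => t [x [v /E_ge0]].
have T0 : T !=set0.
  exists (dot a0 b0 + (dot a0 a0 + dot b0 b0) / 2), a0, b0 => a b Aab.
  rewrite lerD2r; have := mA _ _ _ _ A0 Aab.
  by rewrite !dotE (dotC b0 a0) (dotC b0 a) (dotC b a0) (dotC b a); lra.
have m_le x v t : E x v t -> inf T <= t.
  by move=> h; apply: ge_inf => //; exists x, v.
(* A supremum of affine functions is midpoint convex, and the parallelogram law makes the quadratic
   term gain an eighth of the squared distance. Near-minimizers therefore stay at bounded distance
   from one another. *)
have E_mid x v t x' v' t' : E x v t -> E x' v' t' ->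
    dot (x - x') (x - x') + dot (v - v') (v - v') <= 8 * ((t + t') / 2 - inf T).
  move=> h h'; set q := dot _ _ + dot _ _.
  suff /m_le : E (2^-1 *: (x + x')) (2^-1 *: (v + v')) ((t + t') / 2 - q / 8).
    by lra.
  move=> a b Aab; have := h a b Aab; have := h' a b Aab.
  rewrite /q !dotE (dotC x' x) (dotC v' v); lra.
have /choice[z zE] : forall n : nat, exists z, E z.1 z.2 (inf T + n.+1%:R^-1).
  move=> n; have [|t [x [v h]] tlt] := @inf_adherent _ T n.+1%:R^-1 _ (conj T0 T_lb).
    by rewrite invr_gt0.
  by exists (x, v) => a b /h /le_trans; apply; exact: ltW.
have z_bnd n : dot ((z n).1 - (z 0).1) ((z n).1 - (z 0).1) +
    dot ((z n).2 - (z 0).2) ((z n).2 - (z 0).2) <= 8.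
  have /le_trans := E_mid _ _ _ _ _ _ (zE n) (zE 0); apply.
  have : (n.+1%:R^-1 : R) <= 1 by rewrite invf_le1// ler1n.
  rewrite invr1; set e := _^-1; set i := inf T.
  by move=> e1; rewrite -[leRHS]mulr1 ler_pM2l// lerBlDr ler_pdivrMr//; lra.
have [U [UU Uoo]] := @ultraFilterLemma _ \oo _.
have PU : ProperFilter U by exact: ultra_proper.
have bnd (f : nat -> V) : (forall n, dot (f n - f 0) (f n - f 0) <= 8) ->
    exists l : 'rV[R]_N, f @ U --> l.
  move=> f8; apply: (@bounded_ultra_cvg _ _ _ _ _ (Num.sqrt 8 + enorm (f 0))) => n.
  rewrite -{1}(subrK (f 0) (f n)) (le_trans (enormD _ _))// lerD2r.
  by rewrite /enorm ler_sqrt.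
have [|x zx] := bnd (fun n => (z n).1).
  by move=> n; apply: le_trans (z_bnd n); rewrite lerDl dot_ge0.
have [|v zv] := bnd (fun n => (z n).2).
  by move=> n; apply: le_trans (z_bnd n); rewrite lerDr dot_ge0.
have Exv : E x v (inf T).
  move=> a b Aab.
  apply: (@ler_cvg2 _ _ U _ (fun n => dot (z n).1 b + dot a (z n).2 - dot a b +
      (dot (z n).1 (z n).1 + dot (z n).2 (z n).2) / 2)
      (fun n => inf T + n.+1%:R^-1)).
  - apply: cvgD; [apply: cvgD; [apply: cvgD|]|apply: cvgM].
    + exact: cvg_dotl.
    + by apply: cvg_dot => //; exact: cvg_cst.
    + exact: cvg_cst.
    + by apply: cvgD; apply: cvg_dot.
    + exact: cvg_cst.
  - rewrite -[X in _ --> X]addr0; apply: cvgD; first exact: cvg_cst.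
    by move=> B /cvg_harmonic /Uoo.
  - by apply: nearW => n; exact: zE.
have opt a b : A a b -> dot (x + v) (x + v) <= dot (a + v) (b + x).
  move=> Aab; set m := inf T in Exv m_le.
  set c := dot a b; set d1 := a - x; set d2 := b - v.
  set q := (dot x x + dot v v) / 2.
  set k := m - q; set l := dot x d1 + dot v d2; set D := dot d1 d1 + dot d2 d2.
  (* Minimality is tested on the segment from [(x, v)] to [(a, b)], where monotonicity bounds the
     Fitzpatrick function at [(a, b)] by [dot a b]. Division by [t] leaves a quadratic remainder
     that vanishes as [t] tends to 0. *)
  have step t : 0 < t <= 1 -> k <= c + l + t * (D / 2).
    move=> /andP[t0 t1].
    have /m_le : E (x + t *: d1) (v + t *: d2)
      ((1 - t) * k + t * c + (q + t * l + t ^+ 2 * (D / 2))).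
      move=> a' b' A'; have h1 := Exv _ _ A'; have h2 := mA _ _ _ _ Aab A'.
      have h3 : dot a b' + dot a' b - dot a' b' <= c.
        by move: h2; rewrite !dotE (dotC b a) (dotC b' a) (dotC b' a') (dotC b a') /c; lra.
      have h4 : dot x b' + dot a' v - dot a' b' <= k by move: h1; rewrite /k /q; lra.
      have -> : q + t * l + t ^+ 2 * (D / 2) =
        (dot (x + t *: d1) (x + t *: d1) + dot (v + t *: d2) (v + t *: d2)) / 2.
        have sq (y e : V) : dot (y + t *: e) (y + t *: e) =
            dot y y + 2 * (t * dot y e) + t ^+ 2 * dot e e.
          by rewrite !dotE (dotC e y); ring.
        by rewrite /q /l /D !sq; field.
      rewrite lerD2r /d1 /d2 !dotE.
      have := ler_wpM2l (ltW t0) h3.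
      have t1' : 0 <= 1 - t by rewrite subr_ge0.
      have := ler_wpM2l t1' h4.
      lra.
    move=> h; rewrite -(ler_pM2l t0); move: h; rewrite /k; nra.
  have kcl : k <= c + l.
    apply: (@ler_cvg2 _ _ (0 : R)^'+ _ (fun=> k) (fun t => c + l + t * (D / 2))).
    - exact: cvg_cst.
    - rewrite -[X in _ --> X]addr0; apply: cvgD; first exact: cvg_cst.
      rewrite -[X in _ --> X](mul0r (D / 2)); apply: cvgM; last exact: cvg_cst.
      exact: cvg_at_right_filter cvg_id.
    - near=> t; apply: step; apply/andP; split; near: t.
        exact: nbhs_right_gt.
      exact: nbhs_right_le.
  have := F_ge _ _ _ Exv; move: kcl.
  rewrite /k /q /c /l /d1 /d2 !dotE (dotC v x) (dotC x a) (dotC v b) (dotC b v).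
  rewrite -/m; lra.
have Avx : A (- v) (- x).
  apply: maxA => a b /opt h; rewrite -opprD -[- v - a]opprD dotNl dotNr opprK.
  rewrite dotC (addrC v) (addrC x b); apply: le_trans h; exact: dot_ge0.
(* At the pair [(- v, - x)] itself the right-hand side of [opt] is zero. *)
have vx : - v = x.
  have := opt _ _ Avx; rewrite !addNr dot0l => h.
  have /dot_eq0/eqP : dot (x + v) (x + v) = 0 by apply/eqP; rewrite eq_le h dot_ge0.
  by rewrite addr_eq0 => /eqP ->.
by exists x; rewrite vx in Avx.
Unshelve. all: by end_near. Qed.

(** Minty's lemma is applied to [y |-> g A(y) - x]: a point of that graph with second component
    [- y] solves the resolvent equation, so [xget] returns a solution and not its default value. *)
Lemma resolventP g A x : 0 < g -> maximal_monotone A ->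
  exists2 v, A (resolvent g A x) v & x = resolvent g A x + g *: v.
Proof.
move=> g0 maxA; have [[[a0 b0] A0] mA _] := maxA.
have gK (w : V) : g *: (g^-1 *: w) = w by rewrite scalerA mulfV ?scale1r// gt_eqF.
have [|||y Ay] := @minty (fun y w => A y (g^-1 *: (w + x))).
- exists (a0, g *: b0 - x); rewrite /gr /= subrK.
  by rewrite scalerA mulVf ?scale1r// gt_eqF.
- move=> y w y' w' /mA /[apply].
  rewrite -scalerBr dotZl pmulr_rge0 ?invr_gt0//.
  by rewrite opprD addrACA subrr addr0.
- move=> y w h; apply: maximal_monotone_mem => // a b Aab.
  have : A a (g^-1 *: (g *: b - x + x)).
    by rewrite subrK scalerA mulVf ?scale1r// gt_eqF.
  move=> /h; rewrite opprB addrA -{1}(gK (w + x)) -scalerBr dotZl.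
  by rewrite pmulr_rge0.
have : exists y, exists2 v, A y v & x = y + g *: v.
  by exists y; exists (g^-1 *: (- y + x)) => //; rewrite gK addrA subrr add0r.
by move=> /(xgetPex 0).
Qed.

Lemma resolvent_nonexpansive g A x y : 0 < g -> maximal_monotone A ->
  enorm (resolvent g A x - resolvent g A y) <= enorm (x - y).
Proof.
move=> g0 maxA; have [v Av xE] := resolventP x g0 maxA.
have [w Aw yE] := resolventP y g0 maxA; have [_ mA _] := maxA.
move: (mA _ _ _ _ Av Aw); set p := resolvent g A x; set q := resolvent g A y.
move=> h; rewrite {1}xE {1}yE -/p -/q opprD addrACA -scalerBr.
rewrite /enorm ler_sqrt ?dot_ge0//.
move: (p - q) (v - w) h => D E h; rewrite !dotE (dotC D E).
have := mulr_ge0 (ltW g0) h; have := mulr_ge0 (mulr_ge0 (ltW g0) (ltW g0)) (dot_ge0 E).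
by lra.
Qed.

Lemma resolvent_dom g A x : 0 < g -> maximal_monotone A -> dom A (resolvent g A x).
Proof. by move=> g0 maxA; have [v Av _] := resolventP x g0 maxA; exists v. Qed.

(** The element [v] of [A x'] is eliminated through [x' - x = - g (b + v)], so only [phi] and [b]
    remain. The vector [psi] is free: a value of the second operator at [w] gives the Lyapunov
    estimate, while [psi = b] meets the hypothesis trivially and gives the test inequalities. *)
Lemma forward_backward_step g A x x' b w phi psi :
  0 < g -> maximal_monotone A -> A w phi -> 0 <= dot (b - psi) (x - w) ->
  x' = resolvent g A (x - g *: b) ->
  enorm (x' - w) ^+ 2 + enorm (x' - x) ^+ 2 <=
  enorm (x - w) ^+ 2 - 2 * g * dot (phi + psi) (x - w)
    - 2 * g * dot (phi + b) (x' - x).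
Proof.
move=> g0 maxA Aw hb x'E; have [v Av] := resolventP (x - g *: b) g0 maxA.
have [_ mA _] := maxA; rewrite -x'E in Av * => xE.
have DE : x' - x = - (g *: (b + v)).
  apply/eqP; rewrite subr_eq addrC -subr_eq opprK scalerDr addrCA -xE.
  by rewrite addrC subrK.
have h := mulr_ge0 (ltW g0) (mA _ _ _ _ Av Aw).
have hb' := mulr_ge0 (ltW g0) hb.
have xw : x' - w = (x - w) + (x' - x) by rewrite [RHS]addrC subrKA.
move: h; rewrite !xw !enorm_sqr; move: (x' - x) (x - w) DE hb' => D y DE hb'.
have -> : v = - (g^-1 *: D) - b.
  by rewrite DE scalerN opprK scalerA mulVf ?gt_eqF// scale1r addrC addKr.
rewrite !dotE (dotC D y); move: hb'; rewrite !dotE => hb' h.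
have gV : g * g^-1 = 1 by rewrite mulfV ?gt_eqF.
move: h; rewrite !mulrDr !mulrN !mulrA gV !mul1r; lra.
Qed.

End minty.

(** * Borel measurability *)

Lemma measurable_sumr {R : realType} d (T : measurableType d) (D : set T)
    (I : Type) (s : seq I) (f : I -> T -> R) :
  (forall i, measurable_fun D (f i)) ->
  measurable_fun D (fun t => \sum_(i <- s) f i t).
Proof.
move=> mf; elim: s => [|i s IH].
  by under eq_fun do rewrite big_nil; exact: measurable_cst.
by under eq_fun do rewrite big_cons; exact: measurable_funD.
Qed.

Section borel.
Context {R : realType} {N : nat}.
Local Notation V := 'rV[R]_N.

Lemma rat_approx (x : V) (e : R) : 0 < e ->
  exists q : 'rV[rat]_N, enorm (x - map_mx ratr q) < e.
Proof.
move=> e0; have e1 : 0 < e / N.+1%:R by rewrite divr_gt0.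
set e' := e / _ in e1 *.
have /choice[q qP] i : exists r : rat, `|x ord0 i - ratr r| < e'.
  have [|r] := @rat_in_itvoo R (x ord0 i - e') (x ord0 i + e').
    by rewrite ltrD2l gtrN.
  rewrite in_itv /= => /andP[r1 r2]; exists r; rewrite ltr_norml.
  by apply/andP; split; lra.
exists (\row_i q i); apply: (le_lt_trans (enorm_le_sum _)).
apply: (@le_lt_trans _ _ (\sum_(i < N) e')).
  by apply: ler_sum => i _; rewrite !mxE; exact: ltW (qP i).
rewrite sumr_const card_ord -[ltLHS]mulr_natr -mulrA -[ltRHS]mulr1 ltr_pM2l//.
by rewrite mulrC ltr_pdivrMr// mul1r ltr_nat.
Qed.

(** A subset need not contain rational points: for each rational ball that meets [C] a point of [C]
    in it is chosen, and the other balls receive the default [c]. *)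
Lemma countable_dense (C : set V) : C !=set0 ->
  exists2 f : nat -> V, forall n, C (f n) &
    forall x e, C x -> 0 < e -> exists n, enorm (x - f n) < e.
Proof.
move=> [c Cc].
pose K := ('rV[rat]_N * nat)%type.
have /choice[f fP] (k : K) : exists y, C y /\
    forall x, C x -> enorm (x - map_mx ratr k.1) < k.2.+1%:R^-1 ->
      enorm (y - map_mx ratr k.1) < k.2.+1%:R^-1.
  have [[x [Cx h]]|no] :=
      pselect (exists x, C x /\ enorm (x - map_mx ratr k.1) < k.2.+1%:R^-1).
    by exists x.
  by exists c; split => // x Cx h; exfalso; apply: no; exists x.
exists (fun n => if unpickle n is Some k then f k else c).
  by move=> n; case: unpickle => // k; case: (fP k).
move=> x e Cx e0.
have [n nP] : exists n : nat, n.+1%:R^-1 < e / 2.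
  have e2 : 0 < e / 2 by rewrite divr_gt0.
  have [n] := ltr_add_invr (e2); rewrite add0r => h; by exists n.
have [q qP] := @rat_approx x n.+1%:R^-1 (ltac:(by rewrite invr_gt0)).
exists (pickle ((q, n) : K)); rewrite pickleK.
have [_ /(_ _ Cx qP)] := fP (q, n); rewrite /= => h.
rewrite (le_lt_trans (enorm_triangle (map_mx ratr q) _ _))//.
rewrite (splitr e) ltrD//; first exact: lt_trans qP nP.
by rewrite enormBC; exact: lt_trans h nP.
Qed.

Context d (T : measurableType d).
Implicit Types f g : T -> V.

(** Every open set is the union of the countably many rational balls that it contains, so balls
    suffice to test measurability. *)
Lemma measurable_borelRV f :
  (forall c r, measurable [set t | enorm (f t - c) < r]) ->
  measurable_fun setT (f : T -> borelRV R N).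
Proof.
move=> mf; apply: (@measurability _ _ T (borelRV R N) setT f (@open V)) => // _ [U oU <-].
rewrite setTI.
pose I := [set k : 'rV[rat]_N * nat |
  forall y, enorm (map_mx ratr k.1 - y) < k.2.+1%:R^-1 -> U y].
rewrite (_ : _ @^-1` _ = \bigcup_(k in I)
  [set t | enorm (f t - map_mx ratr k.1) < k.2.+1%:R^-1]).
  rewrite bigcup_mkcond; apply: countable_bigcupT_measurable.
    exact: countableP.
  by move=> k; case: ifP.
apply/seteqP; split=> [t Ut|t [k Ik]] /=; last by rewrite enormBC; exact: Ik.
have /nbhs_enorm[e e0 eU] : nbhs (f t) U by exact: open_nbhs_nbhs.
have [n nP] : exists n : nat, n.+1%:R^-1 < e / 2.
  have e2 : 0 < e / 2 by rewrite divr_gt0.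
  have [n] := ltr_add_invr (e2); rewrite add0r => h; by exists n.
have [q qP] := @rat_approx (f t) n.+1%:R^-1 (ltac:(by rewrite invr_gt0)).
exists (q, n) => //= y yq; apply: eU.
rewrite (le_lt_trans (enorm_triangle (map_mx ratr q) _ _))//.
rewrite (splitr e) ltrD//; first exact: lt_trans qP nP.
exact: lt_trans yq nP.
Qed.

Lemma measurable_enorm_ball f (c : V) r :
  measurable_fun setT (f : T -> borelRV R N) ->
  measurable [set t | enorm (f t - c) < r].
Proof.
move=> mf; rewrite -[X in measurable X]setTI.
apply: (mf _ [set y : V | enorm (y - c) < r]) => //.
apply: sub_sigma_algebra; rewrite openE => y /= yr; apply/nbhs_enorm.
exists (r - enorm (y - c)); first by rewrite subr_gt0.
move=> z zy; rewrite /= (le_lt_trans (enorm_triangle y _ _))//.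
by rewrite enormBC -ltrBrDr.
Qed.

Lemma measurable_coord f :
  (measurable_fun setT (f : T -> borelRV R N)) <->
  (forall i, measurable_fun setT (fun t => f t ord0 i)).
Proof.
split=> [mf i|mf].
  apply: (measurability _ (RGenOpens.measurableE R)) => _ [U [a [b ->]] <-].
  apply: (mf _ [set y : V | `]a, b[%classic (y ord0 i)]) => //.
  apply: sub_sigma_algebra; apply: (@open_comp _ _ (fun y : V => y ord0 i)).
    by move=> y _; exact: coord_continuous.
  exact: (@interval_open R (BRight a) (BLeft b)).
apply: measurable_borelRV => c r; rewrite -[X in measurable X]setTI.
have -> : [set t | enorm (f t - c) < r] =
    (fun t => Num.sqrt (\sum_(i < N) (f t ord0 i - c ord0 i) ^+ 2)) @^-1`
    `]-oo, r[%classic.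
  have E t : enorm (f t - c) =
      Num.sqrt (\sum_(i < N) (f t ord0 i - c ord0 i) ^+ 2).
    by congr Num.sqrt; apply: eq_bigr => i _; rewrite !mxE -expr2.
  by apply/seteqP; split=> t; rewrite /= in_itv /= E.
suff : measurable_fun setT
  (fun t => Num.sqrt (\sum_(i < N) (f t ord0 i - c ord0 i) ^+ 2)) by exact.
apply: measurableT_comp; first exact: continuous_measurable_fun (@sqrt_continuous R).
apply: measurable_sumr => i; apply: measurable_funX.
exact: measurable_funB.
Qed.

Lemma measurable_dot f g : measurable_fun setT (f : T -> borelRV R N) ->
  measurable_fun setT (g : T -> borelRV R N) ->
  measurable_fun setT (fun t => dot (f t) (g t)).
Proof.
move=> /measurable_coord mf /measurable_coord mg.
by apply: measurable_sumr => i; exact: measurable_funM.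
Qed.

Lemma measurable_enorm f : measurable_fun setT (f : T -> borelRV R N) ->
  measurable_fun setT (fun t => enorm (f t)).
Proof.
move=> mf; apply: measurableT_comp; last exact: measurable_dot.
exact: continuous_measurable_fun (@sqrt_continuous R).
Qed.

Lemma measurable_funDV f g : measurable_fun setT (f : T -> borelRV R N) ->
  measurable_fun setT (g : T -> borelRV R N) ->
  measurable_fun setT (fun t => f t + g t : borelRV R N).
Proof.
move=> /measurable_coord mf /measurable_coord mg; apply/measurable_coord => i.
rewrite [X in measurable_fun _ X](_ : _ = fun t => f t ord0 i + g t ord0 i).
  exact: measurable_funD.
by apply/funext => t; rewrite !mxE.
Qed.

Lemma measurable_funZV (h : T -> R) f : measurable_fun setT h ->
  measurable_fun setT (f : T -> borelRV R N) ->
  measurable_fun setT (fun t => h t *: f t : borelRV R N).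
Proof.
move=> mh /measurable_coord mf; apply/measurable_coord => i.
rewrite [X in measurable_fun _ X](_ : _ = fun t => h t * f t ord0 i).
  exact: measurable_funM.
by apply/funext => t; rewrite !mxE.
Qed.

Lemma measurable_funBV f g : measurable_fun setT (f : T -> borelRV R N) ->
  measurable_fun setT (g : T -> borelRV R N) ->
  measurable_fun setT (fun t => f t - g t : borelRV R N).
Proof.
move=> /measurable_coord mf /measurable_coord mg; apply/measurable_coord => i.
rewrite [X in measurable_fun _ X](_ : _ = fun t => f t ord0 i - g t ord0 i).
  exact: measurable_funB.
by apply/funext => t; rewrite !mxE.
Qed.

End borel.

(** * Joint measurability of resolvents, measurability of distances to domains *)

Section random_operators.
Context {R : realType} {N : nat} d (Xi : measurableType d).
Local Notation V := 'rV[R]_N.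
Implicit Types (A : Xi -> operator R N) (x y c : V).

(** Caratheodory argument: the value at [x] is approximated by the value at a rational point [q],
    with error at most the distance from [x] to [q]. The preimage of a ball becomes a countable
    union of measurable rectangles. *)
Lemma measurable_nonexpansive (F : Xi -> V -> V) :
  (forall xi x y, enorm (F xi x - F xi y) <= enorm (x - y)) ->
  (forall x, measurable_fun setT (F ^~ x : Xi -> borelRV R N)) ->
  measurable_fun setT (fun z : Xi * borelRV R N => F z.1 z.2 : borelRV R N).
Proof.
move=> F1 mF; apply: measurable_borelRV => c r.
rewrite (_ : [set _ | _] = \bigcup_(k : 'rV[rat]_N * nat)
    ([set xi | enorm (F xi (map_mx ratr k.1) - c) < r - k.2.+1%:R^-1] `*`
     [set x : borelRV R N | enorm (x - map_mx ratr k.1 : V) < k.2.+1%:R^-1])).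
  apply: countable_bigcupT_measurable; first exact: countableP.
  move=> k; apply: measurableX; first exact: measurable_enorm_ball.
  exact: (@measurable_enorm_ball R N _ (borelRV R N) id).
apply/seteqP; split=> [[xi x]|[xi x] [[q n] _] []] /=.
  move=> Fr; have [n] := ltr_add_invr Fr.
  set e := _^-1 => nP.
  have e2 : 0 < e / 2 by rewrite divr_gt0// invr_gt0.
  (* Half of [n.+1%:R^-1] is again an inverse integer, whose index [n.*2.+1] selects the
     rectangle. *)
  have e2E : e / 2 = (n.*2.+1).+1%:R^-1.
    by rewrite /e -invfM -natrM muln2 doubleS.
  have [q qP] := rat_approx x e2.
  exists (q, n.*2.+1) => //; split; rewrite /= -e2E// ltrBrDr.
  apply: le_lt_trans nP; rewrite {2}(splitr e) addrA lerD2r.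
  rewrite (le_trans (enorm_triangle (F xi x) _ _))// [leLHS]addrC lerD2l.
  by rewrite (le_trans (F1 _ _ _))// enormBC ltW.
move=> h1 h2; rewrite (le_lt_trans (enorm_triangle (F xi (map_mx ratr q)) _ _))//.
by rewrite -(subrK (n.+1%:R^-1) r) [ltRHS]addrC ler_ltD// (le_trans (F1 _ _ _))// ltW.
Qed.

Lemma measurable_hit A (H : set (V * V)) : random_operator A ->
  measurable (H : set (g_sigma_algebraType (@open (V * V)%type))) ->
  measurable [set xi | exists y v, A xi y v /\ H (y, v)].
Proof.
move=> [_ mA] /mA; congr measurable; apply/seteqP; split => xi /=.
  by move=> [[y v] [? ?]]; exists y, v.
by move=> [y [v [? ?]]]; exists (y, v).
Qed.

Lemma borel_fst_ball c r : measurable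
  ([set z : V * V | enorm (z.1 - c) < r] : set (g_sigma_algebraType (@open (V * V)%type))).
Proof.
apply: sub_sigma_algebra.
apply: (@open_comp _ _ fst [set y : V | enorm (y - c) < r]).
  by move=> z _; exact: cvg_fst.
rewrite openE => y /= yr; apply/nbhs_enorm.
exists (r - enorm (y - c)); first by rewrite subr_gt0.
move=> z zy; rewrite /= (le_lt_trans (enorm_triangle y _ _))//.
by rewrite enormBC -ltrBrDr.
Qed.

Lemma borel_affine_line (g : R) x : measurable
  ([set z : V * V | z.1 + g *: z.2 = x] : set (g_sigma_algebraType (@open (V * V)%type))).
Proof.
rewrite -[X in measurable X]setCK; apply: measurableC; apply: sub_sigma_algebra.
rewrite openC.
apply: (@closed_comp _ _ (fun z : V * V => z.1 + g *: z.2) [set x]).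
  move=> z _; apply: cvgD; first exact: cvg_fst.
  by apply: cvgZr; exact: cvg_snd.
exact: accessible_closed_set1 (hausdorff_accessible (@norm_hausdorff _ _)) x.
Qed.

(** For fixed [x], the resolvent lies in a ball exactly when the graph meets the Borel set of pairs
    [(y, v)] with [y] in the ball and [y + g v = x]. Nonexpansiveness then gives joint
    measurability. *)
Lemma measurable_resolvent A g : 0 < g -> random_operator A ->
  measurable_fun setT
    (fun z : Xi * borelRV R N => resolvent g (A z.1) z.2 : borelRV R N).
Proof.
move=> g0 rA; have [maxA _] := rA.
apply: (@measurable_nonexpansive (fun xi x => resolvent g (A xi) x)).
  by move=> xi x y; exact: resolvent_nonexpansive.
move=> x; apply: measurable_borelRV => c r.
have := measurable_hit rA (measurableI _ _ (borel_fst_ball c r) (borel_affine_line g x)).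
congr measurable; apply/seteqP; split=> xi /=.
  move=> [y [v [Ayv [/= yr yx]]]]; have [w Aw xE] := resolventP x g0 (maxA xi).
  (* The resolvent equation has one solution: for two of them the differences of points and of
     values point in opposite directions, which monotonicity excludes unless both vanish. *)
  suff -> : resolvent g (A xi) x = y by [].
  have [_ mA _] := maxA xi; have := mA _ _ _ _ Aw Ayv.
  have -> : w - v = - (g^-1 *: (resolvent g (A xi) x - y)).
    have /eqP : resolvent g (A xi) x + g *: w = y + g *: v by rewrite -xE.
    rewrite -subr_eq0 opprD addrACA -scalerBr addr_eq0 => /eqP ->.
    by rewrite scalerN opprK scalerA mulVf ?scale1r ?gt_eqF.
  rewrite dotNl dotZl oppr_ge0 pmulr_rle0 ?invr_gt0// => h.
  by apply/eqP; rewrite -subr_eq0; apply/eqP/dot_eq0/eqP; rewrite eq_le h dot_ge0.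
move=> h; have [v Av xE] := resolventP x g0 (maxA xi).
by exists (resolvent g (A xi) x), v.
Qed.

Lemma measurable_dist_dom A x : random_operator A ->
  measurable_fun setT (fun xi => dist (dom (A xi)) x).
Proof.
move=> rA; have [maxA _] := rA.
apply: (measurability _ (RGenInftyO.measurableE R)) => _ [U [r ->] <-].
have := measurable_hit rA (borel_fst_ball x r); rewrite setTI.
congr measurable; apply/seteqP; split=> xi; rewrite /= in_itv /=.
  move=> [y [v [Ay /= yr]]]; apply: le_lt_trans yr; rewrite enormBC.
  by apply: dist_le; exists v.
move=> /dist_lt[|y [v Ayv] yr]; last by exists y, v; rewrite /= enormBC.
by have [[[y v] Ayv] _ _] := maxA xi; exists y, v.
Qed.

End random_operators.

(** * Processes driven by an iid sequence *)

Local Notation image_measure :=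
  measure_function_pushforward__canonical__measure_function_Measure.

Section driven_process.
Context {R : realType} d (Xi : measurableType d) (mu : probability Xi R).
Context d' (Omega : measurableType d') (P : probability Omega R).
Context (u : nat -> {RV P >-> Xi}) (iid_u : iid mu u).
Context dT (T : measurableType dT) (G : nat -> Xi * T -> T) (s : nat -> Omega -> T).
Context (s0 : T) (s0E : forall omega, s 0 omega = s0)
  (sSE : forall n omega, s n.+1 omega = G n (u n omega, s n omega))
  (mG : forall n, measurable_fun setT (G n)).

Lemma measurable_process n : measurable_fun setT (s n).
Proof.
elim: n => [|n IH].
  by rewrite (_ : s 0 = cst s0)//; apply/funext.
rewrite (_ : s n.+1 = G n \o (fun omega => (u n omega, s n omega))); last first.
  by apply/funext => omega; rewrite sSE.
by apply: measurableT_comp => //; apply: measurable_fun_pair.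
Qed.

Lemma measurable_driver_process n :
  measurable_fun setT (fun omega => (u n omega, s n omega)).
Proof. by apply: measurable_fun_pair => //; exact: measurable_process. Qed.

Let F (J : seq nat) (E : nat -> set Xi) := \bigcap_(j in [set` J]) (u j @^-1` E j).

Let mF J E : (forall n, measurable (E n)) -> measurable (F J E).
Proof.
move=> mE; apply: fin_bigcap_measurable; first exact: finite_seq.
by move=> j _; rewrite -[X in measurable X]setTI; exact: measurable_funP.
Qed.

(** Induction on [n] for all [W], [J] and [E]: [s n.+1] is a function of [(u n, s n)], and adding
    [n] to [J] settles rectangles for this pair. Two finite measures that agree on the pi-system of
    rectangles agree everywhere, in particular on the preimage of [W] under [G n]. *)
Lemma process_indep n W J E : measurable W -> uniq J ->
  (forall j, j \in J -> (n <= j)%N) -> (forall j, measurable (E j)) ->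
  P (s n @^-1` W `&` F J E) = (P (s n @^-1` W) * P (F J E))%E.
Proof.
elim: n W J E => [|n IH] W J E mW uJ nJ mE.
  have [Ws|Ws] := pselect (W s0).
    rewrite (_ : s 0 @^-1` W = setT) ?setTI ?probability_setT ?mul1e//.
    by apply/seteqP; split => // omega _; rewrite /preimage /= s0E.
  rewrite (_ : s 0 @^-1` W = set0) ?set0I ?measure0 ?mul0e//.
  by apply/seteqP; split => // omega; rewrite /preimage /= s0E.
pose h omega := (u n omega, s n omega).
have mh : measurable_fun setT h by exact: measurable_driver_process.
have FE : P (F J E) = (fine (P (F J E)))%:E.
  by rewrite fineK// fin_num_measure//; exact: mF.
have F0 : 0 <= fine (P (F J E)) by rewrite fine_ge0.
pose m1 : measure (Xi * T)%type R := image_measure (mrestr P (mF J mE)) mh.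
pose m2 : measure (Xi * T)%type R := mscale (NngNum F0) (image_measure P mh).
have m12 W' : measurable W' -> m1 W' = m2 W'.
  apply: (@measure_unique _ R (Xi * T)%type
    [set A `*` B | A in measurable & B in measurable] (fun=> setT)).
  - exact: measurable_prod_measurableType.
  - move=> _ _ [A mA [B mB <-]] [A' mA' [B' mB' <-]].
    exists (A `&` A'); first exact: measurableI.
    exists (B `&` B'); first exact: measurableI.
    by rewrite setXI.
  - by move=> _; exists setT => //; exists setT => //; rewrite setXTT.
  - by rewrite bigcup_const.
  - move=> _ [A mA [B mB <-]].
    rewrite /m1 /m2 /= /mscale /pushforward /mrestr /= -FE.
    have [_ uJind] := iid_u.
    have nJ' : n \notin J by apply/negP => /nJ; rewrite ltnn.
    (* [E'] puts the event [A] at the fresh index [n], so that independence of the drivers can be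
       used for the list [n :: J]. *)
    pose E' j := if j == n then A else E j.
    have mE' j : measurable (E' j) by rewrite /E'; case: ifP.
    have E'J j : j \in J -> E' j = E j.
      by rewrite /E'; case: eqP => // -> /(negP nJ').
    have FJ : F J E' = F J E by apply: eq_bigcapr => j /E'J ->.
    have FnJ : F (n :: J) E' = u n @^-1` A `&` F J E.
      rewrite -FJ /F bigcap_seq big_cons -bigcap_seq.
      by rewrite {1}/E' eqxx.
    have PnJ : P (F (n :: J) E') = (P (u n @^-1` A) * P (F J E))%E.
      rewrite uJind//= ?nJ'// big_cons {1}/E' eqxx -uJind// -/(F J E).
      by rewrite -FJ.
    have hE : h @^-1` (A `*` B) = s n @^-1` B `&` u n @^-1` A.
      by apply/seteqP; split=> omega [].
    have Fn : F [:: n] E' = u n @^-1` A.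
      by rewrite /F bigcap_seq big_seq1 /E' eqxx.
    rewrite hE -setIA -FnJ IH//=; last 2 first.
    - by rewrite nJ'.
    - by move=> j; rewrite inE => /orP[/eqP ->//|/nJ/ltnW].
    rewrite /pushforward hE.
    have -> : P (s n @^-1` B `&` u n @^-1` A) =
        (P (s n @^-1` B) * P (u n @^-1` A))%E.
      by rewrite -Fn IH//= => j; rewrite inE => /eqP ->.
    by rewrite PnJ muleA muleC.
  - move=> _; rewrite /m1 /= /pushforward /mrestr preimage_setT setTI.
    by rewrite ltey_eq fin_num_measure//; exact: mF.
have -> : s n.+1 @^-1` W = h @^-1` (G n @^-1` W).
  by apply/seteqP; split=> omega; rewrite /preimage /= sSE.
have mGW : measurable (G n @^-1` W).
  by rewrite -[X in measurable X]setTI; exact: mG.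
have := m12 _ mGW; rewrite /m1 /m2 /= /mscale /pushforward /mrestr /= -FE.
by rewrite muleC.
Qed.

Definition process_rv n : {RV P >-> T} :=
  HB.pack (s n) (isMeasurableFun.Build _ _ _ _ (s n) (measurable_process n)).

Lemma process_joint_law n (W : set (Xi * T)) : measurable W ->
  P ((fun omega => (u n omega, s n omega)) @^-1` W) =
  (mu \x distribution P (process_rv n))%E W.
Proof.
move=> mW; pose m1 : measure (Xi * T)%type R :=
  image_measure P (measurable_driver_process n).
rewrite (@product_measure_unique _ _ _ _ _ mu (distribution P (process_rv n)) m1)//.
move=> A B mA mB; rewrite /m1 /= /distribution /pushforward.
have := @process_indep n B [:: n] (fun=> A) mB isT.
rewrite (_ : F [:: n] (fun=> A) = u n @^-1` A); last by rewrite /F bigcap_seq big_seq1.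
have [uE _] := iid_u; rewrite -(uE n A mA) muleC => <-//; last first.
  by move=> j; rewrite inE => /eqP ->.
by congr (P _); apply/seteqP; split=> omega [].
Qed.

(** This takes the place of conditioning on the past: the law of [(u n, s n)] is a product, so the
    fresh driver is averaged with the state held fixed, without filtrations or conditional
    expectations. *)
Lemma integral_process n (h : Xi * T -> \bar R) :
  measurable_fun setT h -> (forall z, 0 <= h z)%E ->
  (\int[P]_omega h (u n omega, s n omega) =
   \int[P]_omega \int[mu]_xi h (xi, s n omega))%E.
Proof.
move=> mh h0; have mus := measurable_driver_process n.
transitivity (\int[image_measure P mus]_z h z)%E.
  by rewrite ge0_integral_pushforward.
rewrite (eq_measure_integral (mu \x distribution P (process_rv n))%E); last first.
  by move=> A mA _; exact: process_joint_law.
rewrite fubini_tonelli2// /fubini_G ge0_integral_distribution//.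
- exact: measurable_fun_fubini_tonelli_G.
- by move=> t; exact: integral_ge0.
Qed.

Lemma ae_process n (Q : Xi * T -> Prop) : measurable [set z | Q z] ->
  (forall t, {ae mu, forall xi, Q (xi, t)}) ->
  {ae P, forall omega, Q (u n omega, s n omega)}.
Proof.
move=> mQ aeQ; exists (~` [set omega | Q (u n omega, s n omega)]); split => //.
  apply: measurableC; rewrite -[X in measurable X]setTI.
  exact: (measurable_driver_process n).
have mQC : measurable (~` [set z | Q z]) by exact: measurableC.
have mus := measurable_driver_process n.
have mQC' : measurable ((fun omega => (u n omega, s n omega)) @^-1` (~` [set z | Q z])).
  by rewrite -[X in measurable X]setTI; exact: mus.
have mQt t : measurable [set xi | ~ Q (xi, t)].
  by have := @pair2_measurable _ _ Xi T t measurableT _ mQC; rewrite setTI.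
pose W := ~` [set z | Q z].
transitivity (\int[P]_omega (\1_W (u n omega, s n omega))%:E)%E.
  transitivity (P ((~` [set omega | Q (u n omega, s n omega)]) `&` setT)).
    by rewrite setIT.
  by rewrite -integral_indic.
rewrite (@integral_process n (fun z => (\1_W z)%:E)).
- apply: integral0_eq => omega _.
  transitivity (mu ([set xi | ~ Q (xi, s n omega)] `&` setT)).
    by rewrite -integral_indic.
  by rewrite setIT; apply/negligibleP => //; exact: aeQ.
- by apply/measurable_EFinP/measurable_indic.
- by move=> z; rewrite lee_fin.
Qed.

End driven_process.

(** * Summable sequences and a Cauchy criterion *)

Section real_sequences.
Context {R : realType}.
Implicit Types (w M : nat -> R).

(** For nonnegative terms, the only ones it is used with, this is summability expressed within the
    reals. *)
Definition bounded_sums w := exists C, forall n, \sum_(0 <= k < n) w k <= C.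

Lemma bounded_sums_tail w e : (forall n, 0 <= w n) -> bounded_sums w -> 0 < e ->
  exists m, forall n, \sum_(m <= k < n) w k <= e.
Proof.
move=> w0 [C wC] e0.
have cw : cvgn (series w).
  apply: nondecreasing_is_cvgn; first exact: nondecreasing_series.
  by exists C => _ [n _ <-]; exact: wC.
have /cvgrPdist_lt/(_ _ e0)[m _ hm] := cw.
exists m => n; have [nm|mn] := leqP n m; first by rewrite big_geq// ltW.
rewrite -(sub_series_geq w (ltnW mn)).
apply: le_trans (ltW (hm m (leqnn m))).
rewrite ler_normr; apply/orP; left; rewrite lerD2r.
by apply: nondecreasing_cvgn_le => //; exact: nondecreasing_series.
Qed.

Lemma cvg_cauchyP M :
  (exists l : R, M @ \oo --> l) <->
  (forall e, 0 < e -> exists m, forall n, (m <= n)%N -> `|M n - M m| < e).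
Proof.
split=> [[l Ml] e e0|h].
  have e2 : 0 < e / 2 by rewrite divr_gt0.
  have /cvgrPdist_lt/(_ _ e2)[m _ hm] := Ml.
  exists m => n mn; rewrite (splitr e) -(subrKA l) (le_lt_trans (ler_normD _ _))//.
  by rewrite ltrD//; [rewrite distrC; exact: hm|exact: hm (leqnn m)].
suff /cauchy_cvgP : cauchy (M @ \oo) by move=> c; exists (lim (M @ \oo)).
apply: cauchy_exP => e e0; have [m hm] := h e e0; exists (M m).
by exists m => // n /= mn; rewrite /ball /= distrC; exact: hm.
Qed.

End real_sequences.

Section measure_tools.
Context {R : realType} d (T : measurableType d) (mu : probability T R).

(** By Tonelli the sum of the series has a finite integral, hence is finite almost everywhere. *)
Lemma ae_bounded_sums (e : nat -> T -> R) (w : nat -> R) :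
  (forall n, measurable_fun setT (e n)) -> (forall n t, 0 <= e n t) ->
  (forall n, \int[mu]_t (e n t)%:E <= (w n)%:E)%E -> bounded_sums w ->
  {ae mu, forall t, bounded_sums (e ^~ t)}.
Proof.
move=> me e0 ew [C wC].
have mS : measurable_fun setT (fun t => \sum_(0 <= n <oo) (e n t)%:E)%E.
  apply: ge0_emeasurable_sum => [n t _ _|n _]; first by rewrite lee_fin.
  exact/measurable_EFinP.
have S0 t : (0 <= \sum_(0 <= n <oo) (e n t)%:E)%E.
  by apply: nneseries_ge0 => n _ _; rewrite lee_fin.
have iS : mu.-integrable setT (fun t => \sum_(0 <= n <oo) (e n t)%:E)%E.
  apply/integrableP; split => //.
  under eq_integral do rewrite gee0_abs//.
  rewrite integral_nneseries//; last 2 first.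
  - by move=> n; exact/measurable_EFinP.
  - by move=> n t _; rewrite lee_fin.
  apply: (@le_lt_trans _ _ C%:E); last exact: ltry.
  apply: lime_le.
    apply: is_cvg_nneseries => n _ _.
    by apply: integral_ge0 => t _; rewrite lee_fin.
  apply: nearW => n; apply: (@le_trans _ _ (\sum_(0 <= k < n) (w k)%:E)%E).
    exact: lee_sum.
  by rewrite sumEFin lee_fin.
have := integrable_ae measurableT iS; apply: filterS => t /(_ I) fS.
exists (fine (\sum_(0 <= n <oo) (e n t)%:E)%E) => n.
rewrite -lee_fin fineK// -sumEFin.
by apply: nneseries_lim_ge => k _ _; rewrite lee_fin.
Qed.

End measure_tools.

Lemma integral_prob_cst {R : realType} d (T : measurableType d)
    (mu : probability T R) (r : \bar R) : (\int[mu]_t r = r)%E.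
Proof.
rewrite integral_cst// -[RHS]mule1; congr (_ * _)%E; exact: probability_setT.
Qed.

Lemma markov_ge0 {R : realType} d (T : measurableType d) (mu : probability T R)
    (f : T -> R) (c : R) : measurable_fun setT f -> (forall t, 0 <= f t) -> 0 < c ->
  (mu [set t | (c <= f t)%R] <= (c^-1)%:E * \int[mu]_t (f t)%:E)%E.
Proof.
move=> mf f0 c0; set F := [set t | _].
have mF : measurable F.
  by rewrite -[X in measurable X]setTI; apply: measurable_fun_ler.
rewrite -[X in (mu X <= _)%E]setIT -integral_indic// -ge0_integralZl_EFin//.
- apply: ge0_le_integral => //.
  + exact/measurable_EFinP/measurable_indic.
  + by apply/measurable_EFinP; exact: measurable_funM.
  + move=> t _; rewrite -EFinM lee_fin indicE mulrC ler_pdivlMr//.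
    by case: (boolP (t \in F)) => [/[!inE] Ft|_]; rewrite ?mul1r ?mul0r.
- by move=> t _; rewrite lee_fin.
- exact/measurable_EFinP.
- by rewrite invr_ge0 ltW.
Qed.

(** The cross term has zero mean, which is the orthogonality of martingale increments. When the
    second moment is infinite the bound is trivial. *)
Lemma integral_sqr_shift {R : realType} d (T : measurableType d)
    (mu : probability T R) (f : T -> R) (a : R) :
  mu.-integrable setT (EFin \o f) -> (\int[mu]_t (f t)%:E)%E = 0%E ->
  (\int[mu]_t ((a + f t) ^+ 2)%:E <= (a ^+ 2)%:E + \int[mu]_t (f t ^+ 2)%:E)%E.
Proof.
move=> fi f0; have mf : measurable_fun setT f.
  by apply/measurable_EFinP; exact: measurable_int fi.
have mf2 : measurable_fun setT (fun t => (f t ^+ 2)%:E).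
  by apply/measurable_EFinP; exact: measurable_funX.
have [->|foo] := eqVneq (\int[mu]_t (f t ^+ 2)%:E)%E +oo%E.
  by rewrite addey// leey.
have f2i : mu.-integrable setT (fun t => (f t ^+ 2)%:E).
  apply/integrableP; split => //.
  under eq_integral do rewrite gee0_abs ?lee_fin ?sqr_ge0//.
  by rewrite ltey.
have ci : mu.-integrable setT (fun=> (a ^+ 2)%:E).
  exact: finite_measure_integrable_cst.
have afi : mu.-integrable setT (fun t => ((a *+ 2)%:E * (f t)%:E)%E).
  exact: integrableZl.
rewrite (eq_integral (fun t => ((a ^+ 2)%:E + (a *+ 2)%:E * (f t)%:E + (f t ^+ 2)%:E)%E)); last first.
  by move=> t _; rewrite sqrrD -EFinM -!EFinD mulrnAl.
rewrite integralD//; last exact: integrableD.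
rewrite integralD// integral_prob_cst integralZl//.
by rewrite [X in (_ * X)%E]f0 mule0 adde0.
Qed.

(** * Almost sure convergence of square-integrable martingales *)

Section martingale.
Context {R : realType} d (Xi : measurableType d) (mu : probability Xi R).
Context d' (Omega : measurableType d') (P : probability Omega R).
Context (u : nat -> {RV P >-> Xi}) (iid_u : iid mu u).
Context dT (T : measurableType dT) (G : nat -> Xi * T -> T) (s : nat -> Omega -> T).
Context (s0 : T) (s0E : forall omega, s 0 omega = s0)
  (sSE : forall n omega, s n.+1 omega = G n (u n omega, s n omega))
  (mG : forall n, measurable_fun setT (G n)).
Context (g : nat -> Xi * T -> R) (mg : forall n, measurable_fun setT (g n))
  (gi : forall n t, mu.-integrable setT (fun xi => (g n (xi, t))%:E))
  (g0 : forall n t, (\int[mu]_xi (g n (xi, t))%:E)%E = 0%E).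
Context (w : nat -> R) (w0 : forall n, 0 <= w n) (sw : bounded_sums w)
  (gw : forall n,
    (\int[P]_omega \int[mu]_xi (g n (xi, s n omega) ^+ 2)%:E <= (w n)%:E)%E).

(* The sum is frozen once it leaves [(- lam, lam)], so that Chebyshev's inequality
   for the last term is a maximal inequality. *)
Fixpoint stopped_sum (m : nat) (lam : R) (n : nat) (omega : Omega) : R :=
  if n is k.+1 then
    let S := stopped_sum m lam k omega in
    if (m <= k)%N && (`|S| < lam) then S + g k (u k omega, s k omega) else S
  else 0.

(** The state is enlarged by the current stopped sum, which makes the pair a driven process again;
    the independence and integration lemmas then apply to it. *)
Let G' m lam n (z : Xi * (T * R)) : T * R :=
  (G n (z.1, z.2.1),
   if (m <= n)%N && (`|z.2.2| < lam) then z.2.2 + g n (z.1, z.2.1) else z.2.2).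

Let mG' m lam n : measurable_fun setT (G' m lam n).
Proof.
have m1 : measurable_fun setT (fun z : Xi * (T * R) => (z.1, z.2.1)).
  apply: measurable_fun_pair; first exact: measurable_fst.
  by apply: measurableT_comp measurable_snd; exact: measurable_fst.
have m2 : measurable_fun setT (fun z : Xi * (T * R) => z.2.2).
  by apply: measurableT_comp measurable_snd; exact: measurable_snd.
apply: measurable_fun_pair; first exact: measurableT_comp m1.
apply: measurable_fun_ifT => //.
  apply: measurable_and; first exact: measurable_cst.
  by apply: measurable_fun_ltr => //; exact: measurableT_comp m2.
by apply: measurable_funD => //; exact: measurableT_comp m1.
Qed.

Let s' m lam n omega := (s n omega, stopped_sum m lam n omega).

Let s'0 m lam omega : s' m lam 0 omega = (s0, 0).
Proof. by rewrite /s' s0E. Qed.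

Let s'S m lam n omega : s' m lam n.+1 omega = G' m lam n (u n omega, s' m lam n omega).
Proof. by rewrite /s' sSE. Qed.

Let ms' m lam n := measurable_process (@s'0 m lam) (@s'S m lam) (mG' m lam) n.

Lemma measurable_stopped_sum m lam n : measurable_fun setT (stopped_sum m lam n).
Proof. by have /measurable_fun_pairP[] := ms' m lam n. Qed.

(** For a given past, an active step adds a centred increment and a frozen step adds nothing, so
    from time [m] on each step raises the second moment by at most [w n]. *)
Lemma stopped_sum_moment m lam n :
  (\int[P]_omega (stopped_sum m lam n omega ^+ 2)%:E <=
   (\sum_(m <= k < n) w k)%:E)%E.
Proof.
elim: n => [|n IH].
  by rewrite big_geq// integral0_eq// => omega _ /=; rewrite expr0n.
have [nm|mn] := ltnP n m.
  move: IH; rewrite !big_geq//; last exact: ltnW.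
  by under [X in (X <= _)%E -> _]eq_integral do rewrite /= ; rewrite /= leqNgt nm.
pose h (z : Xi * (T * R)) := ((G' m lam n z).2 ^+ 2)%:E.
have mh : measurable_fun setT h.
  apply/measurable_EFinP; apply: measurable_funX.
  by have /measurable_fun_pairP[] := mG' m lam n.
rewrite (_ : (\int[P]_omega (stopped_sum m lam n.+1 omega ^+ 2)%:E)%E =
  (\int[P]_omega h (u n omega, s' m lam n omega))%E)//.
rewrite (integral_process iid_u (@s'0 m lam) (@s'S m lam) (mG' m lam))//; last first.
  by move=> z; rewrite lee_fin sqr_ge0.
have mI : measurable_fun setT (fun omega => \int[mu]_xi (g n (xi, s n omega) ^+ 2)%:E)%E.
  have ms := measurable_process s0E sSE mG n.
  have mG2 : measurable_fun setT (fubini_G mu (fun z : Xi * T => (g n z ^+ 2)%:E)).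
    apply: measurable_fun_fubini_tonelli_G.
      by apply/measurable_EFinP; exact: measurable_funX.
    by move=> z; rewrite lee_fin sqr_ge0.
  exact: (measurableT_comp mG2 ms).
have mS2 : measurable_fun setT (fun omega => (stopped_sum m lam n omega ^+ 2)%:E).
  by apply/measurable_EFinP; apply: measurable_funX; exact: measurable_stopped_sum.
apply: (@le_trans _ _ (\int[P]_omega ((stopped_sum m lam n omega ^+ 2)%:E +
    \int[mu]_xi (g n (xi, s n omega) ^+ 2)%:E))%E).
  apply: ge0_le_integral => //.
  - by move=> omega _; apply: integral_ge0 => xi _; rewrite lee_fin sqr_ge0.
  - have mh2 : measurable_fun setT (fubini_G mu h).
      apply: measurable_fun_fubini_tonelli_G => // z.
      by rewrite lee_fin sqr_ge0.
    exact: (measurableT_comp mh2 (ms' m lam n)).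
  - exact: emeasurable_funD.
  - move=> omega _; rewrite /h /G' /=; case: (_ && _).
      exact: (@integral_sqr_shift _ _ _ mu (fun xi => g n (xi, s n omega))
        _ (gi n _) (g0 n _)).
    rewrite integral_prob_cst leeDl//.
    by apply: integral_ge0 => xi _; rewrite lee_fin sqr_ge0.
rewrite ge0_integralD//; last 2 first.
- by move=> omega _; rewrite lee_fin sqr_ge0.
- by move=> omega _; apply: integral_ge0 => xi _; rewrite lee_fin sqr_ge0.
by rewrite big_nat_recr//= EFinD; apply: leeD => //.
Qed.

Lemma stopped_sumE m (lam : R) n omega :
  stopped_sum m lam n omega = \sum_(m <= j < n) g j (u j omega, s j omega) \/
  lam <= `|stopped_sum m lam n omega|.
Proof.
elim: n => [|n [IH|IH]] /=; first by left; rewrite big_geq.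
  have [mn|nm] /= := leqP m n; last by left; rewrite IH !big_geq// ltnW.
  case: ltP => h; last by right.
  by left; rewrite IH big_nat_recr.
by right; rewrite ltNge IH andbF.
Qed.

Lemma stopped_sum_exit m (lam : R) n omega k : (k <= n)%N ->
  lam <= `|\sum_(m <= j < k) g j (u j omega, s j omega)| ->
  lam <= `|stopped_sum m lam n omega|.
Proof.
elim: n => [|n IH]; first by rewrite leqn0 => /eqP ->; rewrite big_geq.
rewrite leq_eqVlt => /orP[/eqP -> h|kn h].
  by have [->|] := stopped_sumE m lam n.+1 omega.
by have := IH kn h; rewrite /= => h'; rewrite ltNge h' andbF.
Qed.

(** A frozen sum stays outside, so the exit events increase with [n] and their union has the limit
    of their probabilities; each is bounded by Chebyshev's inequality. *)
Lemma martingale_maximal m (lam r : R) : 0 < lam ->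
  (forall n, \sum_(m <= k < n) w k <= r) ->
  (P (\bigcup_n [set omega | (lam <= `|stopped_sum m lam n omega|)%R])
     <= (r / lam ^+ 2)%:E)%E.
Proof.
move=> lam0 wr; set F := fun n => [set omega | lam <= `|stopped_sum m lam n omega|].
have mF n : measurable (F n).
  rewrite -[X in measurable X]setTI; apply: measurable_fun_ler => //.
  by apply: measurableT_comp => //; exact: measurable_stopped_sum.
have FS : {homo F : n k / (n <= k)%N >-> (n <= k)%O}.
  apply/nondecreasing_seqP => n; apply/subsetPset => omega.
  by rewrite /F /= => h; rewrite ltNge h andbF.
have cF := nondecreasing_cvg_mu (mu := P) mF (bigcupT_measurable _ mF) FS.
rewrite -(cvg_lim _ cF)//; apply: lime_le; first by apply/cvg_ex; eexists; exact: cF.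
apply: nearW => n /=.
have lam20 : 0 < lam ^+ 2 by rewrite exprn_gt0.
have -> : F n = [set omega | lam ^+ 2 <= stopped_sum m lam n omega ^+ 2].
  apply/seteqP; split=> omega; rewrite /F /=
    -(real_normK (num_real (stopped_sum m lam n omega)));
  by rewrite ler_pXn2r// nnegrE ltW.
apply: (le_trans (markov_ge0 _ _ _ lam20)).
- by apply: measurable_funX; exact: measurable_stopped_sum.
- by move=> omega; rewrite sqr_ge0.
rewrite mulrC EFinM lee_wpmul2l ?lee_fin ?invr_ge0 ?(ltW lam20)//.
by rewrite (le_trans (stopped_sum_moment m lam n))// lee_fin.
Qed.

(** A trajectory whose sums are not Cauchy leaves, after every starting time [m], a fixed
    neighbourhood of radius [q.+1%:R^-1]. As the tail variance tends to 0, the maximal inequality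
    makes each such event null. *)
Lemma martingale_cvg :
  {ae P, forall omega,
    exists l : R, (fun n => \sum_(0 <= k < n) g k (u k omega, s k omega)) @ \oo --> l}.
Proof.
pose M omega n := \sum_(0 <= k < n) g k (u k omega, s k omega).
pose N q := \bigcap_m \bigcup_n [set omega |
  q.+1%:R^-1 <= `|stopped_sum m q.+1%:R^-1 n omega|].
have N0 q : P.-negligible (N q).
  have q0 : (0 : R) < q.+1%:R^-1 by rewrite invr_gt0.
  have mU m : measurable (\bigcup_n [set omega |
      q.+1%:R^-1 <= `|stopped_sum m q.+1%:R^-1 n omega|]).
    apply: bigcupT_measurable => n; rewrite -[X in measurable X]setTI.
    apply: measurable_fun_ler => //.
    by apply: measurableT_comp => //; exact: measurable_stopped_sum.
  have mN : measurable (N q) by exact: bigcapT_measurable.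
  exists (N q); split => //; apply/eqP; rewrite eq_le measure_ge0 andbT.
  apply/lee_addgt0Pr => e e0; rewrite add0e.
  have [|m hm] := @bounded_sums_tail _ w (e * q.+1%:R^-1 ^+ 2) w0 sw.
    by rewrite mulr_gt0// exprn_gt0.
  apply: (@le_trans _ _ (P (\bigcup_n [set omega |
      (q.+1%:R^-1 <= `|stopped_sum m q.+1%:R^-1 n omega|)%R]))%E).
    by apply: le_measure; rewrite ?inE//; exact: bigcap_inf.
  rewrite (le_trans (martingale_maximal q0 hm))// mulfK//.
apply: (negligibleS _ (negligible_bigcup N0)) => omega /= nM.
apply: contrapT => nN; apply: nM; apply/cvg_cauchyP => e e0.
have [q qe] : exists q : nat, q.+1%:R^-1 < e.
  by have [q] := ltr_add_invr e0; rewrite add0r; exists q.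
apply: contrapT => ne; apply: nN; exists q => // m _.
have [n [mn h]] : exists n, (m <= n)%N /\ e <= `|M omega n - M omega m|.
  apply: contrapT => nn; apply: ne; exists m => n mn; rewrite ltNge.
  by apply/negP => h; apply: nn; exists n.
exists n => //=; apply: (stopped_sum_exit (leqnn n)).
rewrite (le_trans (ltW qe))// (le_trans h)// /M.
by rewrite -(sub_series_geq (fun k => g k (u k omega, s k omega)) mn).
Qed.

End martingale.

(** * Deterministic trajectories *)

Section pathwise.
Context {R : realType} {N : nat}.
Local Notation V := 'rV[R]_N.
Context (AA : operator R N) (maxAA : maximal_monotone AA).
Context (x beta : nat -> V) (gam : nat -> R) (S : R) (w : V).
Context (gam0 : forall k, 0 < gam k)
  (gam_cvg0 : forall e, 0 < e -> exists m, forall k, (m <= k)%N -> gam k <= e)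
  (gam_div : forall m C, exists n, C <= \sum_(m <= k < n) gam k).
Context (xS : forall k, enorm (x k) <= S) (betaS : forall k, enorm (beta k) <= S).
Context (x_dom : forall e, 0 < e -> exists m, forall n, (m <= n)%N ->
  exists2 p, dom AA p & enorm (x n - p) <= e).
Context (x_w : forall e, 0 < e -> exists m, forall n, (m <= n)%N ->
  `|enorm (x n - w) ^+ 2 - enorm (x m - w) ^+ 2| < e).
Context (test : nat -> V * V)
  (test_dense : forall y a e, AA y a -> 0 < e -> exists i,
    enorm (y - (test i).1) < e /\ enorm (a - (test i).2) < e).
Context (r : nat) (CD : R) (CD0 : 0 <= CD) (r0 : (0 < r)%N)
  (test_span : forall p q, dom AA p -> dom AA q -> enorm (p - q) <=
    CD * \sum_(i < r) `|dot (p - q) ((test i).1 - (test 0).1)|).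

Let f i t := enorm (x t - (test i).1) ^+ 2.

(** The starting time depends on the tolerance and on the number of tests, and may lie far beyond
    [m0]: good windows are sparse. Length 2 leaves room for [L.+1] consecutive pieces, each of
    length at most [2 / L.+1]. *)
Context (test_ineq : forall e J m0, 0 < e -> exists2 m, (m0 <= m)%N &
  forall i s t, (i < J)%N -> (m <= s <= t)%N -> \sum_(m <= k < t) gam k <= 2 ->
  f i t - f i s <=
    - 2 * (\sum_(s <= k < t) gam k * dot (beta k + (test i).2) (x k - (test i).1)) + e).

Let sum_gam_ge0 m n : 0 <= \sum_(m <= k < n) gam k.
Proof. by apply: sumr_ge0 => k _; exact: ltW. Qed.

(** The piece stops when the elapsed time first reaches [h]; the overshoot is at most one step,
    itself at most [h]. For [m < m0] a dummy end makes the choice of ends a total function. *)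
Let piece m0 h : 0 < h -> (forall k, (m0 <= k)%N -> gam k <= h) ->
  forall m, exists n, (m0 <= m)%N -> (m < n)%N /\ h <= \sum_(m <= k < n) gam k <= 2 * h.
Proof.
move=> h0 gh m; have [mm0|] := leqP m0 m; last by exists 0%N.
have ex : exists n, h <= \sum_(m <= k < n) gam k by exact: gam_div.
case: (ex_minnP ex) => n hn nmin; exists n => _.
have mn : (m < n)%N.
  by rewrite ltnNge; apply/negP => nm; move: hn; rewrite big_geq// leNgt h0.
split => //; rewrite hn /=; case: n hn nmin mn => // n hn nmin mn.
rewrite big_nat_recr//=; have := gh n (leq_trans mm0 mn).
have : \sum_(m <= k < n) gam k < h.
  by rewrite ltNge; apply/negP => /nmin; rewrite ltnn.
by lra.
Qed.

Let Y := \sum_(i < r) enorm (test i).1.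
Let Z := \sum_(i < r) enorm (test i).2.
(** Rates relative to [h]: [K2] bounds the growth of one squared distance on a piece, [F0] bounds
    the sum of all of them at any time, [K3] bounds the variation of one of them in either
    direction, and [K] bounds the displacement. *)
Let K2 := 4 * (S + Z) * (S + Y) + 1.
Let F0 := r%:R * (S + Y) ^+ 2.
Let K3 := F0 + (r.+1)%:R * K2.
Let K := CD * (r%:R * (K3 + 4 * Y)) + 2.

Let S0 : 0 <= S. Proof. exact: le_trans (enorm_ge0 _) (xS 0). Qed.
Let Y0 : 0 <= Y. Proof. by apply: sumr_ge0 => i _; exact: enorm_ge0. Qed.
Let Z0 : 0 <= Z. Proof. by apply: sumr_ge0 => i _; exact: enorm_ge0. Qed.
Let yY (i : 'I_r) : enorm (test i).1 <= Y.
Proof.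
by rewrite /Y (bigD1 i)//= lerDl; apply: sumr_ge0 => j _; exact: enorm_ge0.
Qed.
Let zZ (i : 'I_r) : enorm (test i).2 <= Z.
Proof.
by rewrite /Z (bigD1 i)//= lerDl; apply: sumr_ge0 => j _; exact: enorm_ge0.
Qed.
Let K20 : 0 <= K2.
Proof. by rewrite addr_ge0// mulr_ge0 ?mulr_ge0// addr_ge0. Qed.
Let F00 : 0 <= F0. Proof. by rewrite mulr_ge0// sqr_ge0. Qed.

Let fE i s t : f i t - f i s = dot (x t - x s) (x t + x s - 2 *: (test i).1).
Proof.
rewrite /f !enorm_sqr !dotE (dotC (x s) (x t)) !(dotC (test i).1).
by ring.
Qed.

(* A time window of length at most 2 is cut into [L + 1] pieces of length about
   [h = 1 / (L + 1)]; on some piece the sum of the squared distances to the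
   spanning points decreases by [O(h)], which bounds the displacement. *)
Lemma slow_piece (L : nat) : let h := L.+1%:R^-1 in
  exists m n, let H := \sum_(m <= k < n) gam k in
  [/\ (L <= m < n)%N, h <= H <= 2 * h,
      forall t, (m <= t <= n)%N -> enorm (x t - x m) <= K * h,
      forall i, (i < L)%N -> f i n - f i m <=
        - 2 * (\sum_(m <= k < n) gam k * dot (beta k + (test i).2) (x k - (test i).1))
        + h ^+ 2 &
      `|enorm (x n - w) ^+ 2 - enorm (x m - w) ^+ 2| <= h ^+ 2].
Proof.
move=> h; have h0 : 0 < h by rewrite invr_gt0.
have h1 : h <= 1 by rewrite invf_le1// ler1n.
have hh : h ^+ 2 <= h by rewrite expr2 ler_piMl// ltW.
have h20 : 0 < h ^+ 2 by rewrite exprn_gt0.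
have Lh : L.+1%:R * h = 1 by rewrite mulfV.
have [m1 gh] := gam_cvg0 h0.
have [m2 xh] := x_dom h0.
have h22 : 0 < h ^+ 2 / 2 by rewrite divr_gt0.
have [m3 wh] := x_w h22.
have [m0 [m01 m02 m03 m04]] : exists m0, [/\ m1 <= m0, m2 <= m0, m3 <= m0 & L <= m0]%N.
  by exists (maxn (maxn m1 m2) (maxn m3 L)); rewrite !leq_max !leqnn !orbT.
(* The bound [L + r] covers the [r] spanning points, used for the displacement, and the first [L]
   tests, required by the conclusion. *)
have [m mm0 hm] := test_ineq (L + r) m0 h20.
have /choice[tau tauP] := piece h0 gh.
pose sig l := iter l tau m.
have sigm l : (m <= sig l)%N.
  elim: l => [|l IH] //=; apply: (leq_trans IH).
  by have [|/ltnW] := tauP (sig l); first exact: leq_trans m01 (leq_trans mm0 IH).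
have sigP l : (sig l < sig l.+1)%N /\
    h <= \sum_(sig l <= k < sig l.+1) gam k <= 2 * h.
  by apply: tauP; exact: leq_trans m01 (leq_trans mm0 (sigm l)).
have sig_sum l : \sum_(m <= k < sig l) gam k <= l%:R * (2 * h).
  elim: l => [|l IH]; first by rewrite big_geq// mul0r.
  rewrite (big_cat_nat (n := sig l))//=; last by have [/ltnW] := sigP l.
  have [_ /andP[_ b]] := sigP l.
  by rewrite -addn1 natrD mulrDl mul1r lerD.
pose F t := \sum_(i < r) f i t.
(* Pigeonhole: [F] starts below [F0] and stays nonnegative, so it cannot drop by more than
   [F0 * h = F0 / L.+1] on each of the [L.+1] pieces. *)
have [l lL Fl] : exists2 l, (l <= L)%N & F (sig l) - F (sig l.+1) <= F0 * h.
  apply: contrapT => nl.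
  have lF l : (l <= L.+1)%N -> F (sig l) <= F m - l%:R * (F0 * h).
    elim: l => [_|l IH lL]; first by rewrite mul0r subr0.
    have := IH (ltnW lL).
    have : F0 * h < F (sig l) - F (sig l.+1).
      by rewrite ltNge; apply/negP => ?; apply: nl; exists l.
    by rewrite -addn1 natrD mulrDl mul1r; lra.
  have F0E : L.+1%:R * (F0 * h) = F0 by rewrite mulrCA Lh mulr1.
  have : F0 * h < F (sig L) - F (sig L.+1).
    by rewrite ltNge; apply/negP => ?; apply: nl; exists L.
  have := lF L (leqnSn _).
  have Fm : F m <= F0.
    rewrite /F /F0 -[r in leRHS]card_ord mulr_natl -sumr_const.
    apply: ler_sum => i _; rewrite /f ler_pXn2r ?nnegrE ?enorm_ge0 ?addr_ge0//.
    by rewrite (le_trans (enormB _ _))// lerD.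
  have Fp : 0 <= F (sig L.+1) by apply: sumr_ge0 => i _; exact: sqr_ge0.
  have F0E' : L%:R * (F0 * h) + F0 * h = F0.
    by rewrite -[RHS]F0E -addn1 natrD mulrDl mul1r.
  by lra.
have [ln /andP[Hl Hu]] := sigP l.
set a := sig l in ln Hl Hu Fl; set b := sig l.+1 in ln Hl Hu Fl.
have ma : (m <= a)%N by exact: sigm.
have mb2 : \sum_(m <= k < b) gam k <= 2.
  have := sig_sum l.+1; rewrite -/b => /le_trans; apply.
  have : l.+1%:R * h <= L.+1%:R * h by rewrite ler_wpM2r ?(ltW h0)// ler_nat ltnS.
  by rewrite Lh mulrCA; lra.
have mt2 t : (t <= b)%N -> \sum_(m <= k < t) gam k <= 2.
  move=> tb; apply: le_trans mb2; have [mt|tm] := leqP m t; last first.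
    by rewrite big_geq// ltnW.
  by rewrite (big_cat_nat mt tb)/= lerDl.
have fup (i : 'I_r) s t : (a <= s)%N -> (s <= t)%N -> (t <= b)%N -> f i t - f i s <= K2 * h.
  move=> as_ st tb; apply: (le_trans (hm i s t _ _ _)).
  - by rewrite ltn_addl.
  - by rewrite st (leq_trans ma).
  - exact: mt2.
  rewrite /K2 mulrDl mul1r lerD// mulNr -mulrN -sumrN.
  have -> : 4 * (S + Z) * (S + Y) * h = 2 * ((2 * h) * ((S + Z) * (S + Y))) by ring.
  rewrite ler_pM2l//.
  apply: (@le_trans _ _ (\sum_(s <= k < t) gam k * ((S + Z) * (S + Y)))).
    apply: ler_sum => k _; rewrite -mulrN -dotNl ler_pM2l//.
    rewrite (le_trans (dot_le _ _))// ler_pM ?enorm_ge0//.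
      by rewrite enormN (le_trans (enormD _ _))// lerD.
    by rewrite (le_trans (enormB _ _))// lerD.
  rewrite -mulr_suml ler_wpM2r ?mulr_ge0 ?addr_ge0//.
  apply: le_trans Hu; rewrite (big_cat_nat as_ (leq_trans st tb))/=.
  by rewrite (big_cat_nat st tb)/= addrCA lerDl addr_ge0.
(* A single distance cannot drop much either: the total drops by at most [F0 * h], and the other
   distances, as well as the same one after [t], rise by at most [K2 * h]. *)
have fabs (i : 'I_r) t : (a <= t <= b)%N -> `|f i t - f i a| <= K3 * h.
  move=> /andP[at_ tb]; rewrite ler_norml; apply/andP; split; last first.
    apply: (le_trans (fup i _ _ (leqnn a) at_ tb)).
    rewrite ler_wpM2r ?(ltW h0)// /K3 -[leLHS]add0r lerD//.
    by rewrite ler_peMl// ler1n.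
  have d : f i a - f i b = F a - F b + \sum_(j < r | j != i) (f j b - f j a).
    rewrite /F -sumrB (bigD1 i)//= -addrA -big_split/= big1 ?addr0// => j _.
    by rewrite addrC subrKA subrr.
  have e : \sum_(j < r | j != i) (f j b - f j a) <= r%:R * (K2 * h).
    apply: (@le_trans _ _ (\sum_(j < r | j != i) K2 * h)).
      by apply: ler_sum => j _; exact: fup (ltnW ln) _.
    rewrite sumr_const -[leLHS]mulr_natl ler_wpM2r//; first by rewrite mulr_ge0// ltW.
    by rewrite ler_nat -[leqRHS]card_ord max_card.
  have := fup i t b at_ tb (leqnn b); rewrite /K3 -addn1 natrD.
  by move: d e Fl; lra.
have disp t : (a <= t <= b)%N -> enorm (x t - x a) <= K * h.
  move=> atb; have [at_ tb] := andP atb.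
  (* [test_span] concerns domain points, so the iterates at times [t] and [a] are replaced by domain
     points within [h]. This is the origin of [4 * Y] and of [2] in [K]. *)
  have [p Dp xp] := xh t (leq_trans m02 (leq_trans mm0 (leq_trans ma at_))).
  have [q Dq xq] := xh a (leq_trans m02 (leq_trans mm0 ma)).
  have dy (i : 'I_r) : `|dot (p - q) ((test i).1 - (test 0).1)| <= (K3 + 4 * Y) * h.
    have y0Y : enorm (test 0).1 <= Y := yY (Ordinal r0).
    have -> : p - q = (x t - x a) - ((x t - p) - (x a - q)).
      by rewrite !opprB addrA; apply/rowP => j; rewrite !mxE; ring.
    rewrite dotDl dotNl mulrDl (le_trans (ler_normB _ _))// lerD//.
      have := fabs i t atb; have := fabs (Ordinal r0) t atb => /=.
      (* Subtracting the squared distances to two points cancels the quadratic part in [x] and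
         leaves a linear function of the displacement. *)
      have -> : dot (x t - x a) ((test i).1 - (test 0).1) =
          ((f 0 t - f 0 a) - (f i t - f i a)) / 2.
        by rewrite !fE !dotE; field.
      by rewrite !ler_norml => /andP[? ?] /andP[? ?]; apply/andP; split; lra.
    rewrite (le_trans (normr_dot_le _ _))//.
    have -> : 4 * Y * h = (h + h) * (Y + Y) by ring.
    rewrite ler_pM ?enorm_ge0//.
      by rewrite (le_trans (enormB _ _))// lerD.
    by rewrite (le_trans (enormB _ _))// lerD.
  have -> : x t - x a = (p - q) + ((x t - p) - (x a - q)).
    by apply/rowP => j; rewrite !mxE; ring.
  rewrite (le_trans (enormD _ _))// /K mulrDl lerD//; last first.
    by rewrite (le_trans (enormB _ _))// mulrDl mul1r lerD.
  rewrite (le_trans (test_span Dp Dq))// -!mulrA ler_wpM2l//.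
  rewrite mulr_natl -[r in leRHS]card_ord -sumr_const.
  exact: ler_sum.
exists a, b; split => //.
- by rewrite ln andbT (leq_trans m04)// (leq_trans mm0).
- by rewrite Hl.
- move=> i iL; apply: hm.
  + by rewrite ltn_addr.
  + by rewrite ma ltnW.
  + exact: mb2.
- have am3 : (m3 <= a)%N := leq_trans m03 (leq_trans mm0 ma).
  rewrite -(subrKA (enorm (x m3 - w) ^+ 2)) (le_trans (ler_normD _ _))//.
  rewrite (splitr (h ^+ 2)) lerD//; first exact/ltW/wh/(leq_trans am3)/ltnW.
  by rewrite distrC; exact/ltW/wh.
Qed.

(* [x_] is an ultrafilter limit of the starting points of slow windows, and
   [- (a_ + b_)] of the mean velocities on them. *)
Lemma cluster_point_critical : exists x_ a_ b_ : V,
  [/\ forall e m0, 0 < e -> exists2 m, (m0 <= m)%N & enorm (x m - x_) < e,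
      AA x_ a_,
      forall e, 0 < e -> exists m n, let H := \sum_(m <= k < n) gam k in
        [/\ 0 < H,
            forall k, (m <= k < n)%N -> enorm (x k - x_) < e &
            enorm (H^-1 *: \sum_(m <= k < n) gam k *: beta k - b_) < e] &
      dot (a_ + b_) (x_ - w) = 0].
Proof.
have /choice[mn mnP] : forall L, exists mn : nat * nat,
    let h := L.+1%:R^-1 in let m := mn.1 in let n := mn.2 in
    let H := \sum_(m <= k < n) gam k in
    [/\ (L <= m < n)%N, h <= H <= 2 * h,
      forall t, (m <= t <= n)%N -> enorm (x t - x m) <= K * h,
      forall i, (i < L)%N -> f i n - f i m <=
        - 2 * (\sum_(m <= k < n) gam k * dot (beta k + (test i).2) (x k - (test i).1))
        + h ^+ 2 &
      `|enorm (x n - w) ^+ 2 - enorm (x m - w) ^+ 2| <= h ^+ 2].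
  by move=> L; have [m [n P]] := slow_piece L; exists (m, n).
pose h L : R := L.+1%:R^-1.
pose m L := (mn L).1; pose n L := (mn L).2.
pose H L := \sum_(m L <= k < n L) gam k.
have h0 L : 0 < h L by rewrite invr_gt0.
have H0 L : 0 < H L by have [_ /andP[+ _] _ _ _] := mnP L; exact: lt_le_trans.
have hH L : h L <= H L by have [_ /andP[+ _] _ _ _] := mnP L.
have hHV L : h L / H L <= 1 by rewrite ler_pdivrMr// mul1r.
have mn_lt L : (m L < n L)%N by have [/andP[]] := mnP L.
have Lm L : (L <= m L)%N by have [/andP[]] := mnP L.
have K0 : 0 <= K.
  have [_ _ /(_ (m 0%N)) + _ _] := mnP 0%N; rewrite leqnn (ltnW (mn_lt 0%N)) => /(_ isT).
  by rewrite subrr enorm0 pmulr_lge0 ?invr_gt0.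
have [U [UU Uoo]] := @ultraFilterLemma _ \oo _.
have PU : ProperFilter U by exact: ultra_proper.
have hU : h @ U --> (0 : R) by move=> A /cvg_harmonic /Uoo.
have KhU c : (fun L => c * h L) @ U --> (0 : R).
  by rewrite -[X in _ --> X](mulr0 c); apply: cvgM => //; exact: cvg_cst.
pose X L := x (m L); pose X' L := x (n L).
(* [bb] averages the forward drift, and [cc] is the opposite of the mean velocity; in the limit,
   [c_ - b_] is therefore the contribution of the first operator. *)
pose bb L := (H L)^-1 *: \sum_(m L <= k < n L) gam k *: beta k.
pose cc L := - ((H L)^-1 *: (X' L - X L)).
have X'X L : enorm (X' L - X L) <= K * h L.
  by have [_ _ + _ _] := mnP L; apply; rewrite leqnn andbT (ltnW (mn_lt L)).
have X'E L : X' L - X L = - (H L *: cc L).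
  by rewrite /cc scalerN opprK scalerA mulfV ?scale1r// gt_eqF.
have [x_ Xx] : exists l : V, X @ U --> l.
  by apply: (@bounded_ultra_cvg _ _ _ _ _ S) => L; exact: xS.
have [b_ bbb] : exists l : V, bb @ U --> l.
  apply: (@bounded_ultra_cvg _ _ _ _ _ S) => L.
  rewrite enormZ gtr0_norm ?invr_gt0// mulrC ler_pdivrMr//.
  rewrite (le_trans (enorm_sum _ _ _))// mulrC mulr_suml; apply: ler_sum => k _.
  by rewrite enormZ gtr0_norm// ler_pM2l.
have [c_ ccc] : exists l : V, cc @ U --> l.
  apply: (@bounded_ultra_cvg _ _ _ _ _ K) => L.
  rewrite enormN enormZ gtr0_norm ?invr_gt0// mulrC ler_pdivrMr//.
  by rewrite (le_trans (X'X L))// ler_wpM2l.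
have X'x : X' @ U --> x_.
  apply/cvg_enormP; apply: (@squeeze_cvgr _ _ _ _ (fun=> 0)
      (fun L => K * h L + enorm (X L - x_))).
  - apply: nearW => L; rewrite enorm_ge0/= (le_trans (enorm_triangle (X L) _ _))//.
    by rewrite lerD2r.
  - exact: cvg_cst.
  - rewrite -[X in _ --> X]addr0; apply: cvgD; first exact: KhU.
    by move/cvg_enormP : Xx.
have dot_mid (y : V) : dot c_ (x_ + x_ - 2 *: y) = 2 * dot c_ (x_ - y).
  by rewrite !dotE; ring.
have mid_cvg (y : V) : (fun L => dot (cc L) (X' L + X L - 2 *: y)) @ U -->
    2 * dot c_ (x_ - y).
  rewrite -dot_mid; apply: cvg_dot => //.
  by apply: cvgB; [exact: cvgD|exact: cvg_cst].
(* An exact identity for the decrease of the squared distance to [y], so that division by [H L]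
   commutes with the limit without any error term. *)
have mid_eq L (y : V) : H L * dot (cc L) (X' L + X L - 2 *: y) =
    enorm (X L - y) ^+ 2 - enorm (X' L - y) ^+ 2.
  have -> : H L * dot (cc L) (X' L + X L - 2 *: y) =
      - dot (X' L - X L) (X' L + X L - 2 *: y) by rewrite X'E (dotNl (H L *: cc L)) opprK (dotZl (H L)).
  by rewrite !enorm_sqr !dotE (dotC (X L) (X' L)) !(dotC y); ring.
exists x_, (c_ - b_), b_; split.
- move=> e m0 e0; move/cvg_enormP : Xx => /cvgrPdist_lt/(_ _ e0) Ux.
  have : U (fun L => `|0 - enorm (X L - x_)| < e /\ (m0 <= L)%N).
    by apply: filterI => //; apply: Uoo; exists m0.
  move=> /filter_ex[L [+ m0L]]; rewrite sub0r normrN ger0_norm ?enorm_ge0// => XL.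
  by exists (m L) => //; exact: leq_trans (Lm L).
(* The window inequality is divided by [H L], which is at least [h L]: the error [h L ^+ 2] and the
   cost of replacing [x k] by [X L] both become multiples of [h L]. *)
- have test_rel i : 0 <= dot (c_ - b_ - (test i).2) (x_ - (test i).1).
    set y := (test i).1; set a := (test i).2.
    suff : 2 * dot (b_ + a) (x_ - y) <= 2 * dot c_ (x_ - y).
      by rewrite !dotE; lra.
    apply: (@ler_cvg2 _ _ U _ (fun L => 2 * dot (bb L + a) (X L - y) -
      (2 * (S + enorm a) * K + 1) * h L)
      (fun L => dot (cc L) (X' L + X L - 2 *: y))); last 2 first.
    + exact: mid_cvg.
    + apply: (@filterS _ U _ (fun L => (i < L)%N)); last by apply: Uoo; exists i.+1.
      move=> L iL; rewrite -(ler_pM2l (H0 L)) mid_eq.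
      have [_ _ dL /(_ i iL) + _] := mnP L; rewrite -/(m L) -/(n L) -/(h L) -/y -/a.
      rewrite /f -/y -/(X L) -/(X' L).
      set G := \sum_(_ <= _ < _) _ => hG.
      have hG' : H L * dot (bb L + a) (X L - y) - (S + enorm a) * (K * h L) * H L <= G.
        rewrite -dotZl scalerDr scalerA mulfV ?gt_eqF// scale1r.
        rewrite /H scaler_suml -big_split/= dot_suml mulr_sumr -sumrB.
        rewrite /G big_seq [leRHS]big_seq; apply: ler_sum => k.
        rewrite mem_index_iota => /andP[mk kn].
        rewrite -scalerDr dotZl [_ * gam k]mulrC -mulrBr ler_pM2l//.
        rewrite lerBlDr -lerBlDl -dotNr -dotDr.
        have -> : X L - y - (x k - y) = - (x k - X L).
          by apply/rowP => j; rewrite !mxE; ring.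
        rewrite dotNr -dotNl (le_trans (dot_le _ _))// enormN ler_pM ?enorm_ge0//.
          by rewrite (le_trans (enormD _ _))// lerD2r.
        by apply: dL; rewrite mk (ltnW kn).
      have h2 : h L ^+ 2 <= h L * H L by rewrite expr2 ler_pM2l.
      have -> : H L * (2 * dot (bb L + a) (X L - y) -
          (2 * (S + enorm a) * K + 1) * h L) =
        2 * (H L * dot (bb L + a) (X L - y) - (S + enorm a) * (K * h L) * H L) -
        h L * H L by ring.
      by lra.
    + rewrite -[X in _ --> X]subr0; apply: cvgB; last exact: KhU.
      apply: cvgM; first exact: cvg_cst.
      apply: cvg_dot; first by apply: cvgD => //; exact: cvg_cst.
      by apply: cvgB => //; exact: cvg_cst.
  apply: maximal_monotone_mem => // y a AAy.
  (* Density extends the relation from the test pairs to an arbitrary pair of the graph, as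
     maximality demands. *)
  have /choice[t tP] : forall k : nat, exists i,
      enorm (y - (test i).1) < k.+1%:R^-1 /\ enorm (a - (test i).2) < k.+1%:R^-1.
    by move=> k; apply: test_dense => //; rewrite invr_gt0.
  have ty : (fun k => (test (t k)).1) @ \oo --> y.
    apply/cvg_enormP; apply: (@squeeze_cvgr _ _ _ _ (fun=> 0) harmonic).
    + apply: nearW => k; rewrite enorm_ge0/= enormBC /harmonic /=.
      by have [/ltW] := tP k.
    + exact: cvg_cst.
    + exact: cvg_harmonic.
  have ta : (fun k => (test (t k)).2) @ \oo --> a.
    apply/cvg_enormP; apply: (@squeeze_cvgr _ _ _ _ (fun=> 0) harmonic).
    + apply: nearW => k; rewrite enorm_ge0/= enormBC /harmonic /=.
      by have [_ /ltW] := tP k.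
    + exact: cvg_cst.
    + exact: cvg_harmonic.
  apply: (@ler_cvg2 _ _ \oo _ (fun=> 0)
    (fun k => dot (c_ - b_ - (test (t k)).2) (x_ - (test (t k)).1))).
  + exact: cvg_cst.
  + by apply: cvg_dot; apply: cvgB => //; exact: cvg_cst.
  + by apply: nearW => k; exact: test_rel.
- move=> e e0; have e2 : 0 < e / 2 by rewrite divr_gt0.
  move/cvg_enormP : (Xx) => /cvgrPdist_lt/(_ _ e2) Ux.
  move/cvg_enormP : (bbb) => /cvgrPdist_lt/(_ _ e0) Ub.
  move/cvgrPdist_lt : (KhU K) => /(_ _ e2) Uh.
  have /filter_ex[L [[uX ub] uh]] : U ([set L | `|0 - enorm (X L - x_)| < e / 2] `&`
      [set L | `|0 - enorm (bb L - b_)| < e] `&` [set L | `|0 - K * h L| < e / 2]).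
    by apply: filterI => //; exact: filterI.
  exists (m L), (n L); rewrite -/(H L); split => //.
    move=> k /andP[mk kn]; rewrite (le_lt_trans (enorm_triangle (X L) _ _))//.
    rewrite (splitr e) ler_ltD//.
      have [_ _ /(_ k) + _ _] := mnP L; rewrite mk (ltnW kn) => /(_ isT)/le_trans; apply.
      move: uh; rewrite /= sub0r normrN => /ltW/(le_trans _); apply; exact: ler_norm.
    by move: uX; rewrite /= sub0r normrN ger0_norm ?enorm_ge0.
  by move: ub; rewrite /= sub0r normrN ger0_norm ?enorm_ge0.
(* On a window of length at least [h L] the squared distance to [w] varies by at most [h L ^+ 2], so
   its mean rate of change tends to 0, while by [mid_cvg] that rate also determines
   [2 * dot c_ (x_ - w)]. *)
- rewrite subrK; suff /eqP : 2 * dot c_ (x_ - w) = 0 by rewrite mulf_eq0 pnatr_eq0 => /eqP.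
  have := mid_cvg w; move=> /cvg_unique; apply => //.
  have hn : (fun L => - h L) @ U --> (0 : R).
    by rewrite -[X in _ --> X]oppr0; exact: cvgN.
  apply: (squeeze_cvgr _ hn hU); apply: nearW => L.
  rewrite -ler_norml -(ler_pM2l (H0 L)) -[X in X * `|_|](gtr0_norm (H0 L)) -normrM mid_eq.
  have [_ _ _ _] := mnP L; rewrite distrC => /le_trans; apply.
  by rewrite -/(h L) expr2 ler_pM2r.
Qed.

End pathwise.

(** * Finitely many points that control displacements in the domain *)

Section spanning_points.
Context {R : realType} {N : nat}.
Local Notation V := 'rV[R]_N.

(** Expanding one factor of [dot v v] in the family gives products of coordinates of [v] with its
    inner products with the family. Coordinates are linear, hence bounded by a constant times
    [enorm v], and one factor [enorm v] cancels. *)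
Lemma span_norm_bound (X : seq V) : exists2 C : R, 0 <= C &
  forall v, v \in <<X>>%VS -> enorm v <= C * \sum_(i < size X) `|dot v X`_i|.
Proof.
pose T := in_tuple X.
pose c (i : 'I_(size X)) := \sum_(k < N) `|coord T i (delta_mx 0 k : V)|.
have c0 i : 0 <= c i by apply: sumr_ge0.
have cP i (v : V) : `|coord T i v| <= c i * enorm v.
  rewrite {1}(row_sum_delta v) linear_sum (le_trans (ler_norm_sum _ _ _))//.
  rewrite mulr_suml; apply: ler_sum => k _; rewrite linearZ normrM mulrC.
  by rewrite ler_wpM2l// coord_le_enorm.
pose C := \sum_i c i; have C0 : 0 <= C by apply: sumr_ge0.
have cC i : c i <= C by rewrite /C (bigD1 i)//= lerDl; apply: sumr_ge0.
exists C => // v vX.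
have [->|v0] := eqVneq v 0.
  by rewrite enorm0 mulr_ge0//; apply: sumr_ge0.
have ev : 0 < enorm v.
  by rewrite lt_def enorm_ge0 andbT; apply: contra_neq v0 => /enorm_eq0.
rewrite -(ler_pM2l ev) -expr2 enorm_sqr {1}(coord_span (X := T) vX) dot_suml.
rewrite !mulr_sumr; apply: ler_sum => i _; rewrite dotZl (le_trans (ler_norm _))//.
rewrite normrM mulrA (dotC v) ler_pM// mulrC (le_trans (cP _ _))//.
by rewrite ler_wpM2r// enorm_ge0.
Qed.

(** Among finite families of points of [D], one whose differences with [y0] span a space of maximal
    dimension spans all such differences: a point outside would raise the dimension. *)
Lemma spanning_points (D : set V) : D !=set0 ->
  exists s : seq V, exists2 C : R, 0 <= C & [/\ (0 < size s)%N,
    forall y, y \in s -> D y &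
    forall p q, D p -> D q ->
      enorm (p - q) <= C * \sum_(i < size s) `|dot (p - q) (s`_i - s`_0)|].
Proof.
move=> [y0 Dy0]; pose diffs (s : seq V) := [seq y - y0 | y <- s].
pose Q n := `[< exists2 s : seq V, (forall y, y \in s -> D y) & \dim <<diffs s>> = n >].
have exQ : exists n, Q n by exists (\dim <<diffs [::]>>); apply/asboolP; exists [::].
have ubQ n : Q n -> (n <= \dim {: V})%N.
  by move=> /asboolP[s _ <-]; apply: dimvS; exact: subvf.
case: (ex_maxnP exQ ubQ) => n /asboolP[s sD sn] nmax.
have inS y : D y -> y - y0 \in <<diffs s>>%VS.
  move=> Dy; apply/negPn/negP => nin.
  have : Q (\dim <<diffs (y :: s)>>).
    by apply/asboolP; exists (y :: s) => // z; rewrite inE => /orP[/eqP ->|/sD].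
  move=> /nmax; rewrite -sn leqNgt => /negP; apply.
  rewrite ltnNge; apply/negP => le; move/negP : nin; apply.
  have /eqP : (<<diffs s>> == <<diffs (y :: s)>>)%VS.
    rewrite eqEdim le andbT; apply: sub_span => z zs.
    by rewrite /diffs /= inE zs orbT.
  by move=> ->; apply: memv_span; rewrite /diffs /= mem_head.
have [C C0 CP] := span_norm_bound (diffs s).
(* With [y0] in front, the entry of index 0 is the base point of the differences, and its own term
   in the sum vanishes. *)
exists (y0 :: s), C => //; split => //.
  by move=> y; rewrite inE => /orP[/eqP ->|/sD].
move=> p q Dp Dq; have -> : p - q = (p - y0) - (q - y0).
  by rewrite opprB addrA subrK.
apply: (le_trans (CP _ _)); first by rewrite memvB// inS.
rewrite ler_wpM2l// big_ord_recl/= subrr dot0r normr0 add0r size_map.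
by apply: ler_sum => i _; rewrite (nth_map 0).
Qed.

End spanning_points.

(** * Integrals of vectors and of sets *)

Section vector_integral.
Context {R : realType} {N : nat} d (T : measurableType d) (mu : probability T R).
Local Notation V := 'rV[R]_N.
Implicit Types f g : T -> V.

Definition vintegrable f := forall i, mu.-integrable setT (fun t => (f t ord0 i)%:E).

Lemma dominated_vintegrable f (h : T -> R) :
  measurable_fun setT (f : T -> borelRV R N) ->
  mu.-integrable setT (EFin \o h) -> {ae mu, forall t, enorm (f t) <= h t} ->
  vintegrable f.
Proof.
move=> mf hi fh i; have mfi : measurable_fun setT (fun t => f t ord0 i).
  by have /measurable_coord := mf; apply.
have mh : measurable_fun setT h by apply/measurable_EFinP; exact: measurable_int hi.
apply/integrableP; split; first exact/measurable_EFinP.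
have /integrableP[_ hoo] := hi; apply: le_lt_trans hoo.
apply: ae_ge0_le_integral => //.
- by apply/measurable_EFinP; exact: measurableT_comp.
- by apply/measurable_EFinP; exact: measurableT_comp.
- apply: filterS fh => t ft _; rewrite lee_fin (le_trans (coord_le_enorm _ _))//.
  by rewrite (le_trans ft)// ler_norm.
Qed.

Lemma vintegralD f g : vintegrable f -> vintegrable g ->
  vintegral mu (fun t => f t + g t) = vintegral mu f + vintegral mu g.
Proof.
move=> fi gi; apply/rowP => i; rewrite !mxE -RintegralD; [|by []|exact: fi|exact: gi].
by apply: eq_Rintegral => t _; rewrite mxE.
Qed.

Lemma vintegralZ (a : R) f : vintegrable f ->
  vintegral mu (fun t => a *: f t) = a *: vintegral mu f.
Proof.
move=> fi; apply/rowP => i; rewrite !mxE -RintegralZl; [|by []|exact: fi].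
by apply: eq_Rintegral => t _; rewrite mxE.
Qed.

Lemma vintegrableD f g : vintegrable f -> vintegrable g ->
  vintegrable (fun t => f t + g t).
Proof.
move=> fi gi i; have := integrableD measurableT (fi i) (gi i).
by apply: (eq_integrable measurableT) => t _; rewrite /= mxE EFinD.
Qed.

Lemma vintegrableZ (a : R) f : vintegrable f -> vintegrable (fun t => a *: f t).
Proof.
move=> fi i; have := integrableZl measurableT a (fi i).
by apply: (eq_integrable measurableT) => t _; rewrite /= mxE EFinM.
Qed.

Lemma vintegrable0 : vintegrable (fun=> 0 : V).
Proof.
move=> i; have := integrable0 mu setT.
by apply: (eq_integrable measurableT) => t _; rewrite /= mxE.
Qed.

Lemma vintegral0 : vintegral mu (fun=> 0 : V) = 0.
Proof.
by apply/rowP => i; rewrite !mxE Rintegral_cst// mul0r.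
Qed.

Lemma vintegrable_sum (I : Type) (s : seq I) (F : I -> T -> V) :
  (forall i, vintegrable (F i)) -> vintegrable (fun t => \sum_(i <- s) F i t).
Proof.
move=> Fi; elim: s => [|i s IH].
  by under eq_fun do rewrite big_nil; exact: vintegrable0.
by under eq_fun do rewrite big_cons; exact: vintegrableD.
Qed.

Lemma vintegral_sum (I : Type) (s : seq I) (F : I -> T -> V) :
  (forall i, vintegrable (F i)) ->
  vintegral mu (fun t => \sum_(i <- s) F i t) = \sum_(i <- s) vintegral mu (F i).
Proof.
move=> Fi; elim: s => [|i s IH].
  by under eq_fun do rewrite big_nil; rewrite big_nil vintegral0.
under eq_fun do rewrite big_cons.
by rewrite big_cons -IH vintegralD//; exact: vintegrable_sum.
Qed.

Lemma integrable_dot f y : vintegrable f ->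
  mu.-integrable setT (fun t => (dot (f t) y)%:E).
Proof.
move=> fi; have := integrable_sum measurableT (index_enum 'I_N) (P := xpredT)
  (fun i _ => integrableZl measurableT (y ord0 i) (fi i)).
apply: (eq_integrable measurableT) => t _.
by rewrite sumEFin; congr EFin; apply: eq_bigr => i _; rewrite mulrC.
Qed.

Lemma integral_dot f y : vintegrable f ->
  (\int[mu]_t (dot (f t) y)%:E = (dot (vintegral mu f) y)%:E)%E.
Proof.
move=> fi; under eq_integral do rewrite /dot -sumEFin.
rewrite integral_sum//; last first.
  move=> i; have := integrableZl measurableT (y ord0 i) (fi i).
  by apply: (eq_integrable measurableT) => t _; rewrite mulrC.
rewrite /dot -sumEFin; apply: eq_bigr => i _.
under eq_integral do rewrite mulrC EFinM.
rewrite (integralZl measurableT (fi i)).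
rewrite mxE mulrC EFinM /Rintegral fineK//; exact: integrable_fin_num (fi i).
Qed.

End vector_integral.

(** The coordinatewise upper limit is measurable and defined everywhere, and equals the limit where
    one exists; the set of convergence need not be handled. *)
Lemma measurable_vlimit {R : realType} {N : nat} d (T : measurableType d)
    (f : nat -> T -> 'rV[R]_N) :
  (forall n, measurable_fun setT (f n : T -> borelRV R N)) ->
  exists2 F : T -> 'rV[R]_N, measurable_fun setT (F : T -> borelRV R N) &
    forall t l, f ^~ t @ \oo --> l -> F t = l.
Proof.
move=> mf; exists (fun t => \row_i fine (limn_esup (fun n => (f n t ord0 i)%:E))).
  apply/measurable_coord => i.
  rewrite [X in measurable_fun _ X](_ : _ = fine \o
    (fun t => limn_esup (fun n => (f n t ord0 i)%:E))); last first.
    by apply/funext => t; rewrite mxE.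
  apply: measurableT_comp => //; apply: measurable_fun_limn_esup => n.
  by apply/measurable_EFinP; have /measurable_coord := mf n; apply.
move=> t l /cvg_coord fl; apply/rowP => i; rewrite mxE.
have fli : (fun n => (f n t ord0 i)%:E) @ \oo --> (l ord0 i)%:E.
  by apply/cvg_EFin; [exact: nearW|exact: fl].
by rewrite (cvg_limn_einf_sup fli).2.
Qed.

Lemma bounded_sums_vcvg {R : realType} {N : nat} (z : nat -> 'rV[R]_N) :
  bounded_sums (fun k => enorm (z k.+1 - z k)) -> exists l : 'rV[R]_N, z @ \oo --> l.
Proof.
move=> bz; have /choice[l lP] i : exists l : R, (fun n => z n ord0 i) @ \oo --> l.
  apply/cvg_cauchyP => e e0; have e2 : 0 < e / 2 by rewrite divr_gt0.
  have [m hm] := bounded_sums_tail (fun k => enorm_ge0 _) bz e2.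
  exists m => n mn; apply: (@le_lt_trans _ _ (e / 2)).
    apply: le_trans (hm n).
    rewrite -(telescope_sumr (fun n => z n ord0 i) mn).
    rewrite (le_trans (ler_norm_sum _ _ _))//; apply: ler_sum => k _.
    by apply: le_trans (coord_le_enorm _ i); rewrite !mxE.
  by rewrite ltr_pdivrMr// ltr_pMr// ltr1n.
exists (\row_i l i); apply/cvg_coord => i; rewrite mxE; exact: lP.
Qed.

Lemma bounded_sums_half {R : realType} : bounded_sums (fun k => 2^-1 ^+ k : R).
Proof.
exists 2 => n; suff -> : \sum_(0 <= k < n) 2^-1 ^+ k = 2 - 2 * 2^-1 ^+ n :> R.
  by rewrite lerBlDr lerDl mulr_ge0// exprn_ge0// invr_ge0.
elim: n => [|n IH]; first by rewrite big_geq// expr0; lra.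
by rewrite big_nat_recr//= IH exprS; lra.
Qed.

(** * Mazur's lemma through almost minimal L2 norms *)

Section mazur.
Context {R : realType} {N : nat} d (T : measurableType d) (mu : probability T R).
Local Notation V := 'rV[R]_N.
Context (Phi : nat -> set (T -> V)) (h : T -> R).
Context (hi : mu.-integrable setT (EFin \o h))
  (Phi_meas : forall n g, Phi n g -> measurable_fun setT (g : T -> borelRV R N))
  (Phi_bnd : forall n g, Phi n g -> forall t, enorm (g t) ^+ 2 <= h t)
  (Phi0 : forall n, Phi n !=set0)
  (PhiS : forall n, Phi n.+1 `<=` Phi n)
  (Phi_mid : forall n g g', Phi n g -> Phi n g' ->
     Phi n (fun t => 2^-1 *: (g t + g' t))).

Let J (g : T -> V) : R := \int[mu]_t (enorm (g t) ^+ 2).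

Let PhiW n m : (n <= m)%N -> Phi m `<=` Phi n.
Proof.
elim: m => [|m IH]; first by rewrite leqn0 => /eqP ->.
by rewrite leq_eqVlt => /orP[/eqP ->//|/IH nm] g /PhiS/nm.
Qed.

Let integrable_sqr g (c : R) : measurable_fun setT (g : T -> borelRV R N) ->
  (forall t, enorm (g t) ^+ 2 <= c * h t) ->
  mu.-integrable setT (EFin \o (fun t => enorm (g t) ^+ 2)).
Proof.
move=> mg gh; apply: le_integrable (integrableZl measurableT c hi) => //.
  by apply/measurable_EFinP; apply: measurable_funX; exact: measurable_enorm.
move=> t _; rewrite /= lee_fin ger0_norm ?sqr_ge0// (le_trans (gh t))//.
exact: ler_norm.
Qed.

Let PhiJ n g : Phi n g -> mu.-integrable setT (EFin \o (fun t => enorm (g t) ^+ 2)).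
Proof.
move=> Pg; apply: (@integrable_sqr _ 1); first exact: Phi_meas Pg.
by move=> t; rewrite mul1r; exact: Phi_bnd Pg t.
Qed.

(** The parallelogram law turns near-minimality of two functions and of their midpoint into a bound
    on their distance, so stability under midpoints is the only convexity required of [Phi]. *)
Let J_parallelogram n g g' : Phi n g -> Phi n g' ->
  mu.-integrable setT (EFin \o (fun t => enorm (g t - g' t) ^+ 2)) /\
  J (fun t => g t - g' t) = 2 * J g + 2 * J g' - 4 * J (fun t => 2^-1 *: (g t + g' t)).
Proof.
move=> Pg Pg'; split.
  apply: (@integrable_sqr _ 4).
    exact: measurable_funBV (Phi_meas Pg) (Phi_meas Pg').
  move=> t; rewrite (le_trans (enormD_sqr _ _))// enormN.
  by have h1 := Phi_bnd Pg t; have h2 := Phi_bnd Pg' t; lra.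
have i1 := PhiJ Pg; have i2 := PhiJ Pg'; have i3 := PhiJ (Phi_mid Pg Pg').
have z1 : mu.-integrable setT (EFin \o (fun t => 2 * enorm (g t) ^+ 2)).
  by apply: (eq_integrable measurableT) (integrableZl measurableT 2 i1) => t _.
have z2 : mu.-integrable setT (EFin \o (fun t => 2 * enorm (g' t) ^+ 2)).
  by apply: (eq_integrable measurableT) (integrableZl measurableT 2 i2) => t _.
have z3 : mu.-integrable setT
    (EFin \o (fun t => 4 * enorm (2^-1 *: (g t + g' t)) ^+ 2)).
  by apply: (eq_integrable measurableT) (integrableZl measurableT 4 i3) => t _.
have z12 : mu.-integrable setT
    (EFin \o (fun t => 2 * enorm (g t) ^+ 2 + 2 * enorm (g' t) ^+ 2)).
  by apply: (eq_integrable measurableT) (integrableD measurableT z1 z2) => t _.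
rewrite /J -(RintegralZl (mu := mu) _ measurableT i1) -(RintegralZl (mu := mu) _ measurableT i2).
rewrite -(RintegralZl (mu := mu) _ measurableT i3) -(RintegralD measurableT z1 z2).
rewrite -(RintegralB measurableT z12 z3).
apply: eq_Rintegral => t _; rewrite !enorm_sqr !dotE (dotC (g' t)).
by field.
Qed.

Let dd n := inf (J @` Phi n).

Let J_ge0 g : 0 <= J g.
Proof. by apply: Rintegral_ge0 => t _; exact: sqr_ge0. Qed.

Let dd_le n g : Phi n g -> dd n <= J g.
Proof. by move=> Pg; apply: ge_inf; [exists 0 => _ [g' _ <-]|exists g]. Qed.

Let ddS : nondecreasing_seq dd.
Proof.
apply/nondecreasing_seqP => n; apply: lb_le_inf.
  by have [g Pg] := Phi0 n.+1; exists (J g), g.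
by move=> _ [g Pg <-]; apply: dd_le; exact: PhiS.
Qed.

Let dd_ub n : dd n <= \int[mu]_t h t.
Proof.
have [g Pg] := Phi0 n; rewrite (le_trans (dd_le Pg))//.
by apply: le_Rintegral => //; [exact: PhiJ Pg|move=> t _; exact: Phi_bnd Pg t].
Qed.

(* Near-minimizers of the L2 norm over decreasing convex sets are Cauchy. *)
Lemma mazur_sequence : exists2 g : nat -> T -> V,
  (forall k, Phi k (g k)) & {ae mu, forall t, exists l : V, g ^~ t @ \oo --> l}.
Proof.
have /choice[g gP] n : exists g, Phi n g /\ J g <= dd n + n.+1%:R^-1.
  have hinf : has_inf (J @` Phi n).
    split; first by have [g Pg] := Phi0 n; exists (J g), g.
    by exists 0 => _ [g' _ <-].
  have [|_ [g Pg <-] lt] := @inf_adherent _ _ n.+1%:R^-1 _ hinf.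
    by rewrite invr_gt0.
  by exists g; split => //; exact: ltW.
have cauchy_g e : 0 < e -> exists n0, forall n m, (n0 <= n)%N -> (n <= m)%N ->
    J (fun t => g m t - g n t) <= e.
  move=> e0; have e8 : 0 < e / 8 by rewrite divr_gt0.
  have [n1 hn1] : exists m, forall n, (m <= n)%N -> `|dd n - dd m| < e / 8.
    apply: (cvg_cauchyP dd).1 => //; exists (limn dd).
    apply: nondecreasing_is_cvgn => //.
    by exists (\int[mu]_t h t) => _ [n _ <-].
  have [n2 hn2] := ltr_add_invr e8; rewrite add0r in hn2.
  exists (maxn n1 n2) => n m; rewrite geq_max => /andP[n1n n2n] nm.
  have [Pn Jn] := gP n; have [Pm Jm] := gP m.
  (* Both functions lie in the larger set [Phi n], and so does their midpoint, whose value is at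
     least [dd n]. What remains is [2 * (dd m - dd n)] plus the near-minimality errors, each
     estimated through [e / 8]. *)
  have [_ ->] := J_parallelogram (PhiW nm Pm) Pn.
  have := dd_le (Phi_mid (PhiW nm Pm) Pn).
  have i k : (n2 <= k)%N -> k.+1%:R^-1 <= e / 8.
    by move=> n2k; rewrite (le_trans _ (ltW hn2))// lef_pV2 ?posrE// ler_nat ltnS.
  have := i n n2n; have := i m (leq_trans n2n nm).
  have := hn1 n n1n; have := hn1 m (leq_trans n1n nm).
  rewrite !ltr_norml => /andP[a1 a2] /andP[a3 a4].
  move: (J (fun t => 2^-1 *: (g m t + g n t))) (J (g m)) (J (g n)) Jm Jn.
  move: (m.+1%:R^-1) (n.+1%:R^-1) => p q c1 c2 c3 h1 h2 h3 h4 h5; lra.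
have /choice[M MP] k : exists n0, (k <= n0)%N /\
    forall n m, (n0 <= n)%N -> (n <= m)%N ->
    J (fun t => g m t - g n t) <= 2^-1 ^+ k * 2^-1 ^+ k.
  have [|n0 hn0] := cauchy_g (2^-1 ^+ k * 2^-1 ^+ k).
    by rewrite mulr_gt0 ?exprn_gt0 ?invr_gt0.
  exists (maxn k n0); rewrite leq_maxl; split => // n m.
  by rewrite geq_max => /andP[_ ?]; exact: hn0.
(* Partial sums make the indices nondecreasing while keeping them above the thresholds [M k]. *)
pose s k := (\sum_(j < k.+1) M j)%N.
have Ms k : (M k <= s k)%N by rewrite /s big_ord_recr leq_addl.
have sS k : (s k <= s k.+1)%N by rewrite /s [X in (_ <= X)%N]big_ord_recr leq_addr.
have ks k : (k <= s k)%N by apply: leq_trans (Ms k); have [] := MP k.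
exists (fun k => g (s k)).
  by move=> k; apply: (PhiW (ks k)); have [] := gP (s k).
pose e k t := enorm (g (s k.+1) t - g (s k) t).
have mgs k : measurable_fun setT (g (s k) : T -> borelRV R N).
  by have [+ _] := gP (s k); exact: Phi_meas.
have me k : measurable_fun setT (e k).
  by apply: measurable_enorm; exact: measurable_funBV.
have ei k : (\int[mu]_t (e k t)%:E <= (2^-1 ^+ k)%:E)%E.
  have [Pk _] := gP (s k); have [Pk1 _] := gP (s k.+1).
  have [i _] := J_parallelogram (PhiW (sS k) Pk1) Pk.
  set c : R := 2^-1 ^+ k; have c0 : 0 < c by rewrite exprn_gt0// invr_gt0.
  have Jc : J (fun t => g (s k.+1) t - g (s k) t) <= c * c.
    by have [_] := MP k; apply.
  (* Young's inequality with weight [c] replaces Cauchy-Schwarz: a second moment at most [c * c]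
     gives a first moment at most [c]. *)
  apply: (@le_trans _ _ (\int[mu]_t (c / 2 + (2 * c)^-1 * e k t ^+ 2)%:E)%E).
    apply: ge0_le_integral => //.
    - by move=> t _; rewrite lee_fin enorm_ge0.
    - exact/measurable_EFinP.
    - apply/measurable_EFinP; apply: measurable_funD => //.
      by apply: measurable_funM => //; exact: measurable_funX.
    - move=> t _; rewrite lee_fin -(ler_pM2l (_ : 0 < 2 * c)) ?mulr_gt0//.
      move: (e k t) => E; have := sqr_ge0 (E - c).
      have -> : 2 * c * (c / 2 + (2 * c)^-1 * E ^+ 2) = c * c + E ^+ 2.
        by field; rewrite gt_eqF.
      by lra.
  under eq_integral do rewrite EFinD.
  rewrite ge0_integralD//; last 3 first.
  - by move=> t _; rewrite lee_fin divr_ge0// ltW.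
  - by move=> t _; rewrite lee_fin mulr_ge0 ?sqr_ge0// invr_ge0 mulr_ge0// ltW.
  - by apply/measurable_EFinP; apply: measurable_funM => //; exact: measurable_funX.
  rewrite integral_prob_cst; under eq_integral do rewrite EFinM.
  rewrite ge0_integralZl_EFin//; last 3 first.
  - by move=> t _; rewrite lee_fin sqr_ge0.
  - by apply/measurable_EFinP; exact: measurable_funX.
  - by rewrite invr_ge0 mulr_ge0// ltW.
  have -> : (\int[mu]_t (e k t ^+ 2)%:E)%E = (J (fun t => g (s k.+1) t - g (s k) t))%:E.
    by rewrite /J /Rintegral fineK//; exact: integrable_fin_num i.
  rewrite -EFinM -EFinD lee_fin -(ler_pM2l (_ : 0 < 2 * c)) ?mulr_gt0//.
  move: (J _) Jc => E Jc.
  have -> : 2 * c * (c / 2 + (2 * c)^-1 * E) = c * c + E by field; rewrite gt_eqF.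
  by lra.
have := ae_bounded_sums me (fun k t => enorm_ge0 _) ei bounded_sums_half.
by apply: filterS => t; exact: bounded_sums_vcvg.
Qed.

End mazur.

(** * Limits of averaged selections in an Aumann integral *)

Section aumann_closure.
Context {R : realType} {N : nat} d (Xi : measurableType d) (mu : probability Xi R).
Local Notation V := 'rV[R]_N.
Context (B : Xi -> operator R N) (maxB : forall xi, maximal_monotone (B xi)).
Context (b : Xi -> V -> V)
  (mb : forall x, measurable_fun setT (b ^~ x : Xi -> borelRV R N))
  (bB : forall x, {ae mu, forall xi, B xi x (b xi x)}).
Context (m2 : Xi -> R) (m2_ge0 : forall xi, 0 <= m2 xi)
  (m2i : mu.-integrable setT (EFin \o m2))
  (bm2 : forall xi x, enorm (b xi x) ^+ 2 <= m2 xi * (1 + enorm x) ^+ 2).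

Lemma enorm_le_sqr (v : V) (a : R) : enorm v ^+ 2 <= a -> enorm v <= 1 + a.
Proof.
move=> va; have := sqr_ge0 (enorm v - 2^-1).
by rewrite sqrrB; lra.
Qed.

Lemma vintegrable_sqr_bound (g : Xi -> V) (c : R) :
  measurable_fun setT (g : Xi -> borelRV R N) ->
  (forall xi, enorm (g xi) ^+ 2 <= m2 xi * c) -> vintegrable mu g.
Proof.
move=> mg gc; apply: (@dominated_vintegrable _ _ _ _ mu g (fun xi => 1 + m2 xi * c)) => //.
  have i1 : mu.-integrable setT (EFin \o cst (1 : R)).
    exact: finite_measure_integrable_cst.
  have i2 := integrableZl measurableT c m2i.
  apply: (eq_integrable measurableT) (integrableD measurableT i1 i2) => t _.
  by rewrite /= -EFinM mulrC.
by apply: filterE => xi; exact: enorm_le_sqr.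
Qed.

(* Mazur: convex combinations of the selections [b ^~ (p k)] converge a.e.; being
   nearly monotonically related to the graph of [B xi], they have their limit in
   [B xi x] by maximality. *)
Lemma aumann_closed x beta :
  (forall e, 0 < e -> exists (m n : nat) (wt : nat -> R) (p : nat -> V),
    [/\ forall k, 0 <= wt k, \sum_(m <= k < n) wt k = 1,
        forall k, (m <= k < n)%N -> enorm (p k - x) < e &
        enorm (\sum_(m <= k < n) wt k *: vintegral mu (b ^~ (p k)) - beta) < e]) ->
  aumann mu (fun xi => B xi x) beta.
Proof.
(* The points [p k] lie within 1 of [x], so [1 + enorm (p k)] is at most [2 + enorm x]. *)
move=> H; pose c := (2 + enorm x) ^+ 2; pose h xi := m2 xi * c.
have c0 : 0 <= c by exact: sqr_ge0.
have h0 xi : 0 <= h xi by rewrite mulr_ge0.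
pose e n : R := n.+1%:R^-1.
have e0 n : 0 < e n by rewrite invr_gt0.
have e1 n : e n <= 1 by rewrite invf_le1// ler1n.
have eS n : e n.+1 <= e n by rewrite lef_pV2 ?posrE// ler_nat.
(* Averages of values at different points belong to no single image of [B xi]. The inequality with
   slack is affine in [g], hence survives averaging, and becomes the exact monotone relation as
   [e n] tends to 0. *)
pose Phi n := [set g : Xi -> V | [/\ measurable_fun setT (g : Xi -> borelRV R N),
  forall xi, enorm (g xi) ^+ 2 <= h xi,
  {ae mu, forall xi, forall y v, B xi y v ->
    - (e n * (1 + h xi + enorm v)) <= dot (g xi - v) (x - y)} &
  enorm (vintegral mu g - beta) <= e n]].
have Phi_int n g : Phi n g -> vintegrable mu g.
  by move=> [mg gh _ _]; apply: vintegrable_sqr_bound gh.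
have hi : mu.-integrable setT (EFin \o h).
  apply: (eq_integrable measurableT) (integrableZl measurableT c m2i) => t _.
  by rewrite /= /h -EFinM mulrC.
have [|||||G PhiG Gcvg] := @mazur_sequence _ _ _ _ mu Phi h hi.
- by move=> n g [].
- by move=> n g [].
- move=> n; have [m [k [wt [p0 [wt0 wt1 p0e wtb]]]]] := H _ (e0 n).
  (* Setting the points equal to [x] outside the window makes the closeness bound hold for every
     index. *)
  pose p j := if (m <= j < k)%N then p0 j else x.
  have pe j : enorm (p j - x) < e n.
    by rewrite /p; case: ifPn => [/p0e//|_]; rewrite subrr enorm0.
  have pb j : forall xi, enorm (b xi (p j)) ^+ 2 <= h xi.
    move=> xi; rewrite (le_trans (bm2 _ _))// ler_wpM2l//.
    rewrite ler_pXn2r ?nnegrE ?addr_ge0 ?enorm_ge0//.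
    have := enormD (p j - x) x; rewrite subrK.
    by have := pe j; have := e1 n; lra.
  exists (fun xi => \sum_(m <= j < k) wt j *: b xi (p j)); split.
  + apply/measurable_coord => i.
    rewrite [X in measurable_fun _ X](_ : _ =
      fun xi => \sum_(m <= j < k) wt j * b xi (p j) ord0 i); last first.
      by apply/funext => xi; rewrite summxE; apply: eq_bigr => j _; rewrite mxE.
    apply: measurable_sumr => j; apply: measurable_funM => //.
    by have /measurable_coord := mb (p j); apply.
  + move=> xi; have : enorm (\sum_(m <= j < k) wt j *: b xi (p j)) <= Num.sqrt (h xi).
      rewrite (le_trans (enorm_sum _ _ _))//.
      rewrite -[leRHS]mul1r -wt1 mulr_suml; apply: ler_sum => j _.
      rewrite enormZ ger0_norm// ler_wpM2l//.
      by rewrite -(ger0_norm (enorm_ge0 _)) -sqrtr_sqr ler_sqrt.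
    move=> le_h; rewrite -[leRHS](sqr_sqrtr (h0 xi)).
    by rewrite ler_pXn2r ?nnegrE ?enorm_ge0 ?sqrtr_ge0.
  + have : {ae mu, forall xi, forall j, B xi (p j) (b xi (p j))}.
      exact: ae_foralln.
    apply: filterS => xi bBp y v Byv.
    have -> : dot (\sum_(m <= j < k) wt j *: b xi (p j) - v) (x - y) =
        \sum_(m <= j < k) wt j * dot (b xi (p j) - v) (x - y).
      rewrite -{1}[v]scale1r -wt1 scaler_suml -sumrB dot_suml.
      by apply: eq_bigr => j _; rewrite -scalerBr dotZl.
    rewrite -[leLHS]mul1r -{1}wt1 mulr_suml; apply: ler_sum => j _.
    rewrite ler_wpM2l//.
    have [_ mB _] := maxB xi; have h1 := mB _ _ _ _ (bBp j) Byv.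
    have -> : x - y = (p j - y) - (p j - x) by apply/rowP => i; rewrite !mxE; ring.
    rewrite [leRHS]dotDr.
    have : dot (b xi (p j) - v) (p j - x) <= (1 + h xi + enorm v) * e n.
      rewrite (le_trans (dot_le _ _))// ler_pM ?enorm_ge0//; last exact: ltW.
      by rewrite (le_trans (enormB _ _))// lerD2r enorm_le_sqr.
    by rewrite dotNr; lra.
  + rewrite vintegral_sum; last first.
      move=> j; apply: vintegrableZ; exact: vintegrable_sqr_bound (pb j).
    rewrite (eq_big_nat _ _ (F2 := fun j => wt j *: vintegral mu (b ^~ (p0 j)))).
      exact: ltW.
    move=> j mjk; rewrite vintegralZ; first by rewrite /p mjk.
    exact: vintegrable_sqr_bound (pb j).
- move=> n g [mg gh ag ig]; split => //; last exact: le_trans (eS n).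
  apply: filterS ag => xi ag y v /ag; apply: le_trans.
  by rewrite lerN2 ler_wpM2r// !addr_ge0 ?enorm_ge0.
- move=> n g g' Pg Pg'; have [mg gh ag ig] := Pg; have [mg' gh' ag' ig'] := Pg'.
  split.
  + by apply: measurable_funZV => //; exact: measurable_funDV.
  + move=> xi; have := enormD_sqr (g xi) (g' xi).
    rewrite enormZ exprMn gtr0_norm ?invr_gt0//.
    by have := gh xi; have := gh' xi; lra.
  + apply: filterS2 ag ag' => xi h1 h2 y v Byv.
    have := h1 _ _ Byv; have := h2 _ _ Byv.
    by rewrite !dotE; lra.
  + have ii := vintegrableD (Phi_int _ _ Pg) (Phi_int _ _ Pg').
    rewrite (vintegralZ _ ii) (vintegralD (Phi_int _ _ Pg) (Phi_int _ _ Pg')).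
    have -> : 2^-1 *: (vintegral mu g + vintegral mu g') - beta =
        2^-1 *: ((vintegral mu g - beta) + (vintegral mu g' - beta)).
      by apply/rowP => i; rewrite !mxE; field.
    rewrite enormZ gtr0_norm ?invr_gt0//.
    by have := enormD (vintegral mu g - beta) (vintegral mu g' - beta); lra.
have mG k : measurable_fun setT (G k : Xi -> borelRV R N) by have [] := PhiG k.
have [F mF FP] := measurable_vlimit mG.
have GF : {ae mu, forall xi, G ^~ xi @ \oo --> F xi}.
  by apply: filterS Gcvg => xi [l Gl]; rewrite (FP _ _ Gl).
have e_cvg : e @ \oo --> (0 : R) by exact: cvg_harmonic.
have F_bnd : {ae mu, forall xi, enorm (F xi) <= 1 + h xi}.
  apply: filterS GF => xi /cvg_enormP GFx.
  apply: (@ler_cvg2 _ _ \oo _ (fun k => enorm (F xi) - enorm (G k xi - F xi))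
    (fun=> 1 + h xi)).
  - rewrite -[X in _ --> X]subr0; apply: cvgB => //; exact: cvg_cst.
  - exact: cvg_cst.
  - apply: nearW => k; have [_ gh _ _] := PhiG k.
    have := enormB (G k xi) (G k xi - F xi); rewrite opprB addrC subrK.
    by have := enorm_le_sqr (gh xi); lra.
have h1i : mu.-integrable setT (EFin \o (fun xi => 1 + h xi)).
  have i1 : mu.-integrable setT (EFin \o cst (1 : R)).
    exact: finite_measure_integrable_cst.
  by apply: (eq_integrable measurableT) (integrableD measurableT i1 hi) => t _.
exists F; last first.
  apply/rowP => i; rewrite mxE.
  (* The integrals of [G k] tend to that of [F] by domination, and to [beta] by the last clause of
     [Phi]. *)
  have := @dominated_convergence _ _ _ mu setT measurableT
    (fun k xi => (G k xi ord0 i)%:E) (fun xi => (F xi ord0 i)%:E)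
    (EFin \o (fun xi => 1 + h xi)).
  case=> //.
  - by move=> k; apply/measurable_EFinP; have /measurable_coord := mG k; apply.
  - by apply/measurable_EFinP; have /measurable_coord := mF; apply.
  - apply: filterS GF => xi /cvg_coord/(_ i) Gi _; apply/cvg_EFin => //.
    exact: nearW.
  - apply: filterE => xi k _; rewrite lee_fin (le_trans (coord_le_enorm _ _))//.
    by have [_ gh _ _] := PhiG k; exact: enorm_le_sqr (gh xi).
  - move=> iF _; rewrite -(fineK (integrable_fin_num measurableT iF)) => /fine_cvg G1.
    have G2 : (fun k => vintegral mu (G k) ord0 i) @ \oo --> beta ord0 i.
      suff /cvg_coord : (fun k => vintegral mu (G k)) @ \oo --> beta by apply.
      apply/cvg_enormP; apply: (squeeze_cvgr _ (cvg_cst 0) e_cvg).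
      by apply: nearW => k; rewrite enorm_ge0/=; have [] := PhiG k.
    apply: (cvg_unique _ G1 _) => //.
    rewrite (_ : _ \o _ = (fun k => vintegral mu (G k) ord0 i))//.
    by apply/funext => k; rewrite mxE.
split => //.
  under eq_integral do rewrite powRr1 ?enorm_ge0//.
  have /integrableP[_ hoo] := h1i; apply: le_lt_trans hoo.
  apply: ae_ge0_le_integral => //.
  - by move=> t _; rewrite lee_fin enorm_ge0.
  - by apply/measurable_EFinP; exact: measurable_enorm.
  - by apply/measurable_EFinP/measurableT_comp => //; apply/measurable_EFinP;
      exact: measurable_int h1i.
  - by apply: filterS F_bnd => t Ft _; rewrite lee_fin (le_trans Ft)// ler_norm.
have : {ae mu, forall xi, forall k, forall y v, B xi y v ->
    - (e k * (1 + h xi + enorm v)) <= dot (G k xi - v) (x - y)}.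
  by apply: ae_foralln => k; have [] := PhiG k.
apply: filterS2 GF => xi GFx Gineq; apply: maximal_monotone_mem => // y v Byv.
apply: (@ler_cvg2 _ _ \oo _ (fun k => - (e k * (1 + h xi + enorm v)))
  (fun k => dot (G k xi - v) (x - y))).
- rewrite -oppr0 -[X in - X](mul0r (1 + h xi + enorm v)).
  by apply: cvgN; apply: cvgM => //; exact: cvg_cst.
- by apply: cvg_dotl; apply: cvgB => //; exact: cvg_cst.
- by apply: nearW => k; exact: Gineq.
Qed.

End aumann_closure.

(** * Deterministic perturbed recursions *)

Section growth.
Context {R : realType}.

(** Discrete Gronwall inequality, from [1 + c n <= expR (c n)]. *)
Lemma bounded_growth (a c : nat -> R) : (forall n, 0 <= a n) -> (forall n, 0 <= c n) ->
  bounded_sums c -> (forall n, a n.+1 <= (1 + c n) * a n) ->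
  exists C, forall n, a n <= C.
Proof.
move=> a0 c0 [C cC] aS.
have H n : a n <= expR (\sum_(0 <= k < n) c k) * a 0%N.
  elim: n => [|n IH]; first by rewrite big_geq// expR0 mul1r.
  rewrite (le_trans (aS n))// big_nat_recr//= expRD -mulrA mulrCA.
  by rewrite ler_pM ?addr_ge0// expR_ge1Dx.
exists (expR C * a 0%N) => n; rewrite (le_trans (H n))// ler_wpM2r// ler_expR.
exact: cC.
Qed.

Lemma bounded_sums_cvg (e : nat -> R) : (forall n, 0 <= e n) -> bounded_sums e ->
  exists l : R, (fun n => \sum_(0 <= k < n) e k) @ \oo --> l.
Proof.
move=> e0 [C eC]; exists (limn (series e)).
apply: nondecreasing_is_cvgn; first exact: nondecreasing_series.
by exists C => _ [n _ <-].
Qed.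

Lemma bounded_sums_cvg0 (e : nat -> R) : (forall n, 0 <= e n) -> bounded_sums e ->
  forall eps, 0 < eps -> exists m, forall n, (m <= n)%N -> e n <= eps.
Proof.
move=> e0 be eps eps0; have [m hm] := bounded_sums_tail e0 be eps0.
exists m => n mn; apply: le_trans (hm n.+1).
by rewrite big_nat_recr//= lerDr sumr_ge0.
Qed.

(** Subtracting the two sums of perturbations from [v] leaves a nonincreasing sequence, bounded
    below because both sums are bounded. The terms [xi] may have any sign: convergence of their sums
    suffices. *)
Lemma quasi_decreasing_cvg (v xi e : nat -> R) :
  (forall n, 0 <= v n) -> (forall n, 0 <= e n) -> bounded_sums e ->
  (exists l : R, (fun n => \sum_(0 <= k < n) xi k) @ \oo --> l) ->
  (forall n, v n.+1 <= v n + xi n + e n) ->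
  exists l : R, v @ \oo --> l.
Proof.
move=> v0 e0 be [l1 xil] vS; have [l2 el] := bounded_sums_cvg e0 be.
pose z n := v n - \sum_(0 <= k < n) xi k - \sum_(0 <= k < n) e k.
have zd : nonincreasing_seq z.
  apply/nonincreasing_seqP => n; rewrite /z !big_nat_recr//=.
  by have := vS n; lra.
have : cvgn z.
  apply: nonincreasing_is_cvgn => //.
  have [B [_ hB]] := cvg_seq_bounded (cvgP _ xil).
  have [C eC] := be.
  exists (- (B + 1) - C) => _ [n _ <-]; rewrite /z.
  have B1 : B < B + 1 by rewrite ltrDl.
  have := hB _ B1 n I; rewrite /= ler_norml => /andP[_ h1].
  by have := eC n; have := v0 n; lra.
move=> /cvg_ex[l3 zl]; exists (l3 + l1 + l2).
rewrite (_ : v = fun n => z n + \sum_(0 <= k < n) xi k + \sum_(0 <= k < n) e k).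
  by apply: cvgD => //; exact: cvgD.
by apply/funext => n; rewrite /z; ring.
Qed.

Lemma moment_recursion (a dl c : nat -> R) : (forall n, 0 <= a n) ->
  (forall n, 0 <= dl n) -> (forall n, 0 <= c n) -> bounded_sums c ->
  (forall n, a n.+1 + 2^-1 * dl n <= (1 + c n) * a n + c n) ->
  (exists C, forall n, a n <= C) /\ bounded_sums dl.
Proof.
move=> a0 dl0 c0 bc step.
(* The additive error is absorbed by passing to [1 + a n], which is multiplied by at most [1 + c n]
   at each step. *)
have [C hC] : exists C, forall n, 1 + a n <= C.
  apply: (bounded_growth _ c0 bc) => n; first by rewrite addr_ge0.
  by have := step n; have := dl0 n; lra.
split; first by exists C => n; have := hC n; lra.
have [D hD] := bc; exists (2 * (a 0%N + D * C)) => n.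
suff : a n + 2^-1 * (\sum_(0 <= k < n) dl k) <= a 0%N + (\sum_(0 <= k < n) c k) * C.
  have C0 : 0 <= C by rewrite (le_trans _ (hC 0%N))// addr_ge0.
  by have := ler_wpM2r C0 (hD n); have := a0 n; lra.
elim: n => [|n IH]; first by rewrite !big_geq// mulr0 mul0r.
rewrite !big_nat_recr//=; have := step n.
have := ler_wpM2l (c0 n) (hC n).
by lra.
Qed.

End growth.

Section selection_tools.
Context {R : realType} {N : nat} d (Xi : measurableType d) (mu : probability Xi R).
Local Notation V := 'rV[R]_N.

(** Pairing the integral [v] with itself gives the integral of [dot (f xi) v], at most [enorm v]
    times that of [h]; one factor [enorm v] cancels. *)
Lemma enorm_vintegral_le (f : Xi -> V) (h : Xi -> R) :
  measurable_fun setT (f : Xi -> borelRV R N) ->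
  mu.-integrable setT (EFin \o h) -> (forall xi, enorm (f xi) <= h xi) ->
  enorm (vintegral mu f) <= \int[mu]_xi h xi.
Proof.
move=> mf hi fh; have fi : vintegrable mu f.
  by apply: (dominated_vintegrable mf hi); apply: filterE.
set v := vintegral mu f.
have [->|v0] := eqVneq v 0.
  by rewrite enorm0 Rintegral_ge0// => xi _; apply: le_trans (fh xi); exact: enorm_ge0.
have ev : 0 < enorm v.
  by rewrite lt_def enorm_ge0 andbT; apply: contra_neq v0 => /enorm_eq0.
rewrite -(ler_pM2l ev) -expr2 enorm_sqr -RintegralZl//.
have -> : dot v v = \int[mu]_xi dot (f xi) v.
  by rewrite /Rintegral (integral_dot _ fi).
apply: le_Rintegral => //.
- exact: integrable_dot.
- by apply: (eq_integrable measurableT) (integrableZl measurableT (enorm v) hi) => t _.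
- move=> xi _; rewrite (le_trans (dot_le _ _))// mulrC ler_wpM2l ?enorm_ge0//.
Qed.

Lemma selection1_integrable (F : Xi -> set V) phi : selections mu 1 F phi ->
  mu.-integrable setT (EFin \o (fun xi => enorm (phi xi))).
Proof.
move=> [mphi phioo _]; apply/integrableP; split.
  by apply/measurable_EFinP; exact: measurable_enorm.
under eq_integral do rewrite /= ger0_norm ?enorm_ge0//.
by under eq_integral do rewrite -[enorm _]powRr1 ?enorm_ge0//.
Qed.

Lemma selection1_vintegrable (F : Xi -> set V) phi : selections mu 1 F phi ->
  vintegrable mu phi.
Proof.
move=> sphi; have [mphi _ _] := sphi.
apply: (dominated_vintegrable mphi (selection1_integrable sphi)).
by apply: filterE => xi; rewrite lexx.
Qed.

Lemma selection2_integrable (F : Xi -> set V) phi : selections mu 2 F phi ->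
  mu.-integrable setT (EFin \o (fun xi => enorm (phi xi) ^+ 2)).
Proof.
move=> [mphi phioo _]; apply/integrableP; split.
  by apply/measurable_EFinP; apply: measurable_funX; exact: measurable_enorm.
under eq_integral do rewrite /= ger0_norm ?sqr_ge0//.
by under eq_integral do rewrite -powR_mulrn ?enorm_ge0//.
Qed.

Lemma selection2_vintegrable (F : Xi -> set V) phi : selections mu 2 F phi ->
  vintegrable mu phi.
Proof.
move=> sphi; have [mphi _ _] := sphi.
have i1 : mu.-integrable setT (EFin \o cst (1 : R)).
  exact: finite_measure_integrable_cst.
apply: (@dominated_vintegrable _ _ _ _ mu phi (fun xi => 1 + enorm (phi xi) ^+ 2)) => //.
  have i2 := selection2_integrable sphi.
  by apply: (eq_integrable measurableT) (integrableD measurableT i1 i2) => t _.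
by apply: filterE => xi; exact: enorm_le_sqr.
Qed.

Lemma measurable_vintegral dT (T : measurableType dT) (f : Xi -> T -> V) :
  measurable_fun setT (fun z : Xi * T => f z.1 z.2 : borelRV R N) ->
  measurable_fun setT (fun t => vintegral mu (f ^~ t) : borelRV R N).
Proof.
move=> /measurable_coord mf; apply/measurable_coord => i.
pose g (z : Xi * T) := (f z.1 z.2 ord0 i)%:E.
have mg : measurable_fun setT g by apply/measurable_EFinP; exact: mf.
have mp : measurable_fun setT (fubini_G mu (g^\+)%E).
  by apply: measurable_fun_fubini_tonelli_G => //; exact: measurable_funepos.
have mn : measurable_fun setT (fubini_G mu (g^\-)%E).
  by apply: measurable_fun_fubini_tonelli_G => //; exact: measurable_funeneg.
rewrite [X in measurable_fun _ X](_ : _ =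
    fine \o (fun t => fubini_G mu (g^\+)%E t - fubini_G mu (g^\-)%E t)%E).
  by apply: measurableT_comp => //; exact: emeasurable_funB.
apply/funext => t; rewrite mxE /Rintegral integralE /=.
by congr (fine (_ - _)%E); apply: eq_integral => xi _; rewrite ?funeposE ?funenegE.
Qed.

Lemma measurable_dist (C : set V) dT (T : measurableType dT) (f : T -> V) :
  C !=set0 -> measurable_fun setT (f : T -> borelRV R N) ->
  measurable_fun setT (fun t => dist C (f t)).
Proof.
move=> C0 mf.
apply: (measurability _ (RGenInftyO.measurableE R)) => _ [U [r ->] <-].
apply: (mf _ [set y : V | dist C y < r]) => //; apply: sub_sigma_algebra.
rewrite openE => y /= /(dist_lt C0)[c Cc yc]; apply/nbhs_enorm.
exists (r - enorm (y - c)); first by rewrite subr_gt0.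
move=> z yz; apply: (le_lt_trans (dist_le _ Cc)).
by rewrite (le_lt_trans (enorm_triangle y _ _))// enormBC -ltrBrDr.
Qed.

End selection_tools.

(** * Truncated selections along short windows *)

Section driver_windows.
Context {R : realType} d (Xi : measurableType d) (mu : probability Xi R).
Context d' (Omega : measurableType d') (P : probability Omega R).
Context (U : nat -> {RV P >-> Xi}) (iidU : iid mu U).

Lemma ae_driver n (Q : Xi -> Prop) : {ae mu, forall xi, Q xi} ->
  {ae P, forall omega, Q (U n omega)}.
Proof.
move=> [E [mE E0 QE]]; exists (U n @^-1` E); split.
- by rewrite -[X in measurable X]setTI; exact: measurable_funP.
- by have [law _] := iidU; rewrite -E0 -(law n E mE).
- by move=> omega nQ; exact: QE.
Qed.

Lemma integral_driver n (h : Xi -> \bar R) : measurable_fun setT h ->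
  (forall xi, 0 <= h xi)%E -> (\int[P]_omega h (U n omega) = \int[mu]_xi h xi)%E.
Proof.
move=> mh h0; have <- := ge0_integral_distribution (U n) mh h0.
by apply: eq_measure_integral => E mE _; have [law _] := iidU; exact: law.
Qed.

(** For fixed [M], Markov's inequality bounds the probability that [W M m] is eventually at least
    [eta] by [dl M / eta]. A trajectory that fails for every admissible [M] lies in all these
    events, whose probabilities have infimum 0. *)
Lemma frequently_small (W : nat -> nat -> Omega -> R) (dl : nat -> R) (eta : R) :
  (forall M m, measurable_fun setT (W M m)) -> (forall M m omega, 0 <= W M m omega) ->
  (forall M m, \int[P]_omega (W M m omega)%:E <= (dl M)%:E)%E ->
  (forall e, 0 < e -> exists M, dl M <= e) -> 0 < eta ->
  {ae P, forall omega, exists M, dl M <= eta /\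
    forall m0, exists2 m, (m0 <= m)%N & W M m omega < eta}.
Proof.
move=> mW W0 Wdl dl0 eta0.
pose F M m0 := \bigcap_(m in [set m | (m0 <= m)%N]) [set omega | eta <= W M m omega].
pose Bad M := \bigcup_m0 F M m0.
have mE M m : measurable [set omega | eta <= W M m omega].
  by rewrite -[X in measurable X]setTI; exact: measurable_fun_ler.
have mF M m0 : measurable (F M m0) by apply: bigcap_measurable => //; exists m0 => /=.
have mBad M : measurable (Bad M) by exact: bigcupT_measurable.
have PBad M : (P (Bad M) <= (eta^-1 * dl M)%:E)%E.
  have FS : {homo F M : n k / (n <= k)%N >-> (n <= k)%O}.
    move=> n k nk; apply/subsetPset => omega h m /= km.
    by apply: h => /=; exact: leq_trans km.
  have cF := nondecreasing_cvg_mu (mu := P) (mF M) (mBad M) FS.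
  rewrite -(cvg_lim _ cF)//; apply: lime_le; first by apply/cvg_ex; eexists; exact: cF.
  apply: nearW => m0 /=.
  apply: (@le_trans _ _ (P [set omega | eta <= W M m0 omega]%R)).
    by apply: le_measure; rewrite ?inE// => omega; apply => /=.
  apply: (le_trans (markov_ge0 _ (mW M m0) (W0 M m0) eta0)).
  by rewrite EFinM lee_wpmul2l ?lee_fin ?invr_ge0// ltW.
have negl : P.-negligible (\bigcap_(M in [set M | dl M <= eta]) Bad M).
  have [M0 hM0] := dl0 _ eta0.
  have mB : measurable (\bigcap_(M in [set M | dl M <= eta]) Bad M).
    by apply: bigcap_measurable => //; exists M0.
  exists (\bigcap_(M in [set M | dl M <= eta]) Bad M); split => //.
  apply/eqP; rewrite eq_le measure_ge0 andbT; apply/lee_addgt0Pr => e e0; rewrite add0e.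
  have [|M hM] := dl0 (Num.min eta (eta * e)); first by rewrite lt_min eta0 mulr_gt0.
  move: hM; rewrite le_min => /andP[Meta Me].
  apply: (@le_trans _ _ (P (Bad M))).
    by apply: le_measure; rewrite ?inE//; exact: bigcap_inf.
  by rewrite (le_trans (PBad M))// lee_fin ler_pdivrMl.
apply: negligibleS negl => omega /= nG M /= Meta; apply: contrapT => nB; apply: nG.
exists M; split => // m0; apply: contrapT => nm; apply: nB; exists m0 => // m /= mm.
by rewrite leNgt; apply/negP => h; apply: nm; exists m.
Qed.

(** All drivers have law [mu], so the weighted sum over a window of length at most 2 has mean at
    most [2 * dl M], whatever its starting time. *)
Lemma rare_windows (F : nat -> Xi -> R) (gam dl : nat -> R) (e : nat -> nat) (eta : R) :
  (forall M, measurable_fun setT (F M)) -> (forall M xi, 0 <= F M xi) ->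
  (forall M, \int[mu]_xi (F M xi)%:E = (dl M)%:E)%E ->
  (forall e, 0 < e -> exists M, dl M <= e) ->
  (forall k, 0 <= gam k) -> (forall m, \sum_(m <= k < e m) gam k <= 2) -> 0 < eta ->
  {ae P, forall omega, exists M, dl M <= eta /\
    forall m0, exists2 m, (m0 <= m)%N &
      \sum_(m <= k < e m) gam k * F M (U k omega) < eta}.
Proof.
move=> mF F0 Fdl dl0 g0 ge eta0.
have dlp M : 0 <= dl M.
  by rewrite -lee_fin -Fdl integral_ge0// => xi _; rewrite lee_fin.
pose W M m omega := \sum_(m <= k < e m) gam k * F M (U k omega).
have mFU M k : measurable_fun setT (fun omega => F M (U k omega)).
  by apply: measurableT_comp.
apply: filterS (@frequently_small W (fun M => 2 * dl M) eta _ _ _ _ eta0).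
- move=> omega [M [dM hM]]; exists M; split => //.
  by apply: le_trans dM; rewrite ler_peMl// ler1n.
- by move=> M m; apply: measurable_sum => k; exact: measurable_funM.
- by move=> M m omega; apply: sumr_ge0 => k _; rewrite mulr_ge0.
- move=> M m; rewrite /W; under eq_integral do rewrite -sumEFin.
  rewrite ge0_integral_sum//; last 2 first.
  + by move=> k; apply/measurable_EFinP; exact: measurable_funM.
  + by move=> k omega _; rewrite lee_fin mulr_ge0.
  rewrite (eq_bigr (fun k => (gam k * dl M)%:E)).
    by rewrite sumEFin lee_fin -mulr_suml ler_wpM2r.
  move=> k _; under eq_integral do rewrite EFinM.
  rewrite ge0_integralZl_EFin//; last 2 first.
  + by move=> omega _; rewrite lee_fin.
  + exact/measurable_EFinP.
  rewrite (integral_driver k (h := EFin \o F M)) ?Fdl -?EFinM//.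
  + exact/measurable_EFinP.
  + by move=> xi; rewrite lee_fin.
- move=> eps eps0; have [|M hM] := dl0 (eps / 2); first by rewrite divr_gt0.
  by exists M; rewrite -ler_pdivlMl// mulrC.
Qed.

End driver_windows.

Section truncation.
Context {R : realType} {N : nat}.
Local Notation V := 'rV[R]_N.

Definition trunc (M : R) (v : V) : V := if enorm v <= M then v else 0.

Lemma enorm_trunc M v : 0 <= M -> enorm (trunc M v) <= M.
Proof. by rewrite /trunc; case: ifPn => // _; rewrite enorm0. Qed.

Lemma enorm_trunc_le M v : enorm (trunc M v) <= enorm v.
Proof. by rewrite /trunc; case: ifPn => // _; rewrite enorm0 enorm_ge0. Qed.

Lemma enorm_subr_trunc M v : enorm (v - trunc M v) <= enorm v.
Proof. by rewrite /trunc; case: ifPn; rewrite ?subr0// subrr enorm0 enorm_ge0. Qed.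

Context d (Xi : measurableType d) (mu : probability Xi R).

Lemma measurable_trunc M (f : Xi -> V) : measurable_fun setT (f : Xi -> borelRV R N) ->
  measurable_fun setT (fun xi => trunc M (f xi) : borelRV R N).
Proof.
move=> mf; apply: (@measurable_fun_ifT _ _ Xi (borelRV R N) f (fun=> 0 : V)) => //.
by apply: measurable_fun_ler => //; exact: measurable_enorm.
Qed.

(** At a given [xi] the remainders vanish once [M] exceeds the sum of the norms, so dominated
    convergence applies. Summing over [J] functions lets one window serve all of them. *)
Lemma truncation_remainders (phi : nat -> Xi -> V) J :
  (forall i, measurable_fun setT (phi i : Xi -> borelRV R N)) ->
  (forall i, mu.-integrable setT (EFin \o (fun xi => enorm (phi i xi)))) ->
  let F M xi := \sum_(i < J) enorm (phi i xi - trunc M%:R (phi i xi)) in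
  [/\ forall M, measurable_fun setT (F M),
      forall M, mu.-integrable setT (EFin \o F M) &
      forall e, 0 < e -> exists M, \int[mu]_xi F M xi <= e].
Proof.
move=> mphi iphi F.
have mF M : measurable_fun setT (F M).
  apply: measurable_sum => i; apply: measurable_enorm; apply: measurable_funBV => //.
  exact: measurable_trunc.
pose S xi := \sum_(i < J) enorm (phi i xi).
have iS : mu.-integrable setT (EFin \o S).
  have := integrable_sum measurableT (index_enum 'I_J) (P := xpredT) (fun (i : 'I_J) _ => iphi i).
  by apply: (eq_integrable measurableT) => xi _; rewrite /= /S sumEFin.
have F0 M xi : 0 <= F M xi by apply: sumr_ge0 => i _; exact: enorm_ge0.
have FS M xi : F M xi <= S xi by apply: ler_sum => i _; exact: enorm_subr_trunc.
have iF M : mu.-integrable setT (EFin \o F M).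
  apply: le_integrable iS => //; first exact/measurable_EFinP.
  by move=> xi _; rewrite /= lee_fin !ger0_norm// (le_trans (F0 M xi)).
split => // e e0.
have cF : (\int[mu]_xi (F M xi)%:E)%E @[M --> \oo] --> 0%E.
  rewrite -[X in _ --> X](integral0 mu setT).
  apply: (@dominated_cvg _ _ _ mu setT measurableT (fun M => EFin \o F M) _ (EFin \o S)) => //.
  - by move=> M; exact/measurable_EFinP.
  - move=> xi _; apply: cvg_near_cst.
    have [M0 hM0] : exists M0 : nat, S xi <= M0%:R.
      exists (Num.bound (S xi)); apply: ltW; apply: archi_boundP.
      by apply: le_trans (FS 0%N xi); exact: F0.
    near=> M; congr EFin; apply: big1 => i _; rewrite /trunc ifT ?subrr ?enorm0//.
    apply: (@le_trans _ _ M0%:R); last by rewrite ler_nat; near: M; exists M0.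
    by apply: le_trans hM0; rewrite /S (bigD1 i)//= lerDl sumr_ge0// => j _; exact: enorm_ge0.
  - by move=> M xi _; rewrite /= lee_fin ger0_norm.
have : (fun M => \int[mu]_xi F M xi) @ \oo --> (0 : R).
  exact: (fine_cvg cF).
move=> /cvgrPdist_le/(_ _ e0)[M _ /(_ M (leqnn M))] /=; rewrite sub0r normrN => h.
by exists M; apply: le_trans h; exact: ler_norm.
Unshelve. all: by end_near. Qed.

End truncation.

(** * Stochastic forward-backward iterates *)

Section forward_backward.
Context {R : realType} {N : nat} d (Xi : measurableType d) (mu : probability Xi R).
Context d' (Omega : measurableType d') (P : probability Omega R).
Local Notation V := 'rV[R]_N.
Context (A B : Xi -> operator R N) (b : Xi -> V -> V) (m2 : Xi -> R)
  (U : nat -> {RV P >-> Xi}) (gam : nat -> R) (x0 : V) (x : nat -> Omega -> V).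
Context (rA : random_operator A) (maxB : forall xi, maximal_monotone (B xi))
  (mb : measurable_fun setT (fun z : Xi * borelRV R N => b z.1 z.2 : borelRV R N))
  (bB : forall y, {ae mu, forall xi, B xi y (b xi y)})
  (m2_ge0 : forall xi, 0 <= m2 xi) (m2i : mu.-integrable setT (EFin \o m2))
  (bm2 : forall xi y, enorm (b xi y) ^+ 2 <= m2 xi * (1 + enorm y) ^+ 2)
  (iidU : iid mu U) (gam0 : forall k, 0 < gam k)
  (gam2 : bounded_sums (fun k => gam k ^+ 2))
  (x_0 : forall omega, x 0 omega = x0)
  (xS : forall n omega, x n.+1 omega =
    resolvent (gam n) (A (U n omega)) (x n omega - gam n *: b (U n omega) (x n omega))).

Let G n (z : Xi * borelRV R N) : borelRV R N :=
  resolvent (gam n) (A z.1) (z.2 - gam n *: b z.1 z.2).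

Let maxA xi : maximal_monotone (A xi). Proof. by have [] := rA. Qed.

Lemma measurable_iteration_map n : measurable_fun setT (G n).
Proof.
have m1 : measurable_fun setT
    (fun z : Xi * borelRV R N => (z.2 : V) - gam n *: b z.1 z.2 : borelRV R N).
  apply: measurable_funBV; first exact: measurable_snd.
  by apply: measurable_funZV => //; exact: measurable_cst.
have mp : measurable_fun setT (fun z : Xi * borelRV R N =>
    (z.1, ((z.2 : V) - gam n *: b z.1 z.2 : borelRV R N))).
  by apply: measurable_fun_pair => //; exact: measurable_fst.
exact: (measurableT_comp (measurable_resolvent (gam0 n) rA) mp).
Qed.
Let mG := measurable_iteration_map.

Let mx n : measurable_fun setT (x n : Omega -> borelRV R N).
Proof. exact: (measurable_process (s := x : nat -> Omega -> borelRV R N) x_0 xS mG). Qed.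

Let mUx n : measurable_fun setT (fun omega => (U n omega, x n omega : borelRV R N)).
Proof.
exact: (measurable_driver_process (s := x : nat -> Omega -> borelRV R N) x_0 xS mG n).
Qed.

Let ae_Ux n (Q : Xi * borelRV R N -> Prop) : measurable [set z | Q z] ->
  (forall y, {ae mu, forall xi, Q (xi, y)}) ->
  {ae P, forall omega, Q (U n omega, x n omega)}.
Proof. exact: (ae_process (s := x : nat -> Omega -> borelRV R N) iidU x_0 xS mG). Qed.

Let mx2 (y : V) : measurable_fun setT (fun z : Xi * borelRV R N => (z.2 : V) - y : borelRV R N).
Proof.
by apply: measurable_funBV; [exact: measurable_snd|exact: measurable_cst].
Qed.

Let mb1 y : measurable_fun setT (b ^~ y : Xi -> borelRV R N).
Proof. exact: (measurable_fun_pair1 (y : borelRV R N) mb). Qed.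

Let integrable_b y : vintegrable mu (b ^~ y).
Proof. by apply: (vintegrable_sqr_bound m2i (mb1 y)) => xi; exact: bm2. Qed.

(** * Squared distance to a zero of the mean operator *)

Section lyapunov.
Context (w : V) (phi psi : Xi -> V)
  (sphi : selections mu 2 (fun xi => A xi w) phi)
  (spsi : selections mu 2 (fun xi => B xi w) psi)
  (phi_psi0 : vintegral mu phi + vintegral mu psi = 0).

Let W (y : V) := enorm (y - w) ^+ 2.
Let theta xi := phi xi + psi xi.
(** The last two terms, times [1 + W y], dominate [2 * enorm (phi xi + b xi y) ^+ 2], since
    [(1 + enorm y) ^+ 2] is at most [2 * (1 + enorm w) ^+ 2 + 2 * W y]. The first term makes
    [step_bound] nonnegative by completing a square. *)
Let kappa xi := enorm (theta xi) ^+ 2 + 4 * enorm (phi xi) ^+ 2 +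
  8 * ((1 + enorm w) ^+ 2 + 1) * m2 xi.
Let step_bound n (z : Xi * borelRV R N) :=
  W z.2 - 2 * gam n * dot (theta z.1) ((z.2 : V) - w) +
  gam n ^+ 2 * (kappa z.1 * (1 + W z.2)).

Let mphi : measurable_fun setT (phi : Xi -> borelRV R N).
Proof. by have [] := sphi. Qed.
Let mpsi : measurable_fun setT (psi : Xi -> borelRV R N).
Proof. by have [] := spsi. Qed.
Let mtheta : measurable_fun setT (theta : Xi -> borelRV R N).
Proof. exact: measurable_funDV. Qed.

Let mkappa : measurable_fun setT kappa.
Proof.
apply: measurable_funD; [apply: measurable_funD|apply: measurable_funM => //].
- by apply: measurable_funX; exact: measurable_enorm.
- apply: measurable_funM; first exact: measurable_cst.
  by apply: measurable_funX; exact: measurable_enorm.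
- by apply/measurable_EFinP; exact: measurable_int m2i.
Qed.

Let kappa_ge0 xi : 0 <= kappa xi.
Proof.
apply: addr_ge0; first apply: addr_ge0.
- exact: sqr_ge0.
- by rewrite mulr_ge0 ?sqr_ge0.
- by rewrite mulr_ge0// mulr_ge0// addr_ge0 ?sqr_ge0.
Qed.

Let integrable_theta : vintegrable mu theta.
Proof.
by apply: vintegrableD; [exact: selection2_vintegrable sphi|
  exact: selection2_vintegrable spsi].
Qed.

Let integrable_kappa : mu.-integrable setT (EFin \o kappa).
Proof.
have i1 := selection2_integrable sphi; have i2 := selection2_integrable spsi.
pose c := 8 * ((1 + enorm w) ^+ 2 + 1).
have i3 : mu.-integrable setT (EFin \o (fun xi =>
    6 * enorm (phi xi) ^+ 2 + 2 * enorm (psi xi) ^+ 2 + c * m2 xi)).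
  apply: (eq_integrable measurableT) (integrableD measurableT
    (integrableD measurableT (integrableZl measurableT 6 i1)
      (integrableZl measurableT 2 i2)) (integrableZl measurableT c m2i)) => xi _.
  by [].
apply: le_integrable i3 => //; first exact/measurable_EFinP.
move=> xi _; rewrite /= lee_fin ger0_norm//.
rewrite (le_trans _ (ler_norm _))// /kappa lerD2r.
by have := enormD_sqr (phi xi) (psi xi); rewrite /theta; lra.
Qed.

Let step_bound_ge0 n z : 0 <= step_bound n z.
Proof.
rewrite /step_bound /kappa /W.
have k1 : 0 <= 4 * enorm (phi z.1) ^+ 2 + 8 * ((1 + enorm w) ^+ 2 + 1) * m2 z.1.
  apply: addr_ge0; first by rewrite mulr_ge0 ?sqr_ge0.
  by rewrite mulr_ge0// mulr_ge0// addr_ge0 ?sqr_ge0.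
rewrite -[_ + 4 * _ + _]addrA.
move: (theta z.1) ((z.2 : V) - w) (4 * _ + _) k1 => t y k k1.
have := sqr_ge0 (enorm (y - gam n *: t)).
have -> : enorm (y - gam n *: t) ^+ 2 =
    enorm y ^+ 2 - 2 * gam n * dot t y + gam n ^+ 2 * enorm t ^+ 2.
  by rewrite !enorm_sqr !dotE (dotC y t); ring.
have g2 : 0 <= gam n ^+ 2 by exact: sqr_ge0.
have k2 : 0 <= enorm t ^+ 2 * enorm y ^+ 2 by rewrite mulr_ge0 ?sqr_ge0.
have := mulr_ge0 g2 (addr_ge0 k1 (addr_ge0 k2 (mulr_ge0 k1 (sqr_ge0 (enorm y))))).
by lra.
Qed.

(** Young's inequality spends half of the squared increment on the cross term of the
    forward-backward estimate. The other half is kept, and will show that the iterates approach the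
    domain. *)
Let step_le n y : {ae mu, forall xi,
  W (G n (xi, y)) + 2^-1 * enorm ((G n (xi, y) : V) - y) ^+ 2 <= step_bound n (xi, y)}.
Proof.
have [_ _ phiA] := sphi; have [_ _ psiB] := spsi.
apply: filterS3 phiA psiB (bB y) => xi Aphi Bpsi Bb.
have [_ mB _] := maxB xi.
have := forward_backward_step (x := y) (gam0 n) (maxA xi) Aphi (mB _ _ _ _ Bb Bpsi) erefl.
rewrite -/(G n (xi, y)) -/(theta xi) /step_bound /= /W.
have [q qE] : exists q, q = phi xi + b xi y by eexists.
have [D DE] : exists D, D = (G n (xi, y) : V) - y by eexists.
rewrite -qE -DE => h; have g0 := gam0 n.
have young : - (2 * gam n * dot q D) <= 2^-1 * enorm D ^+ 2 + 2 * (gam n ^+ 2 * enorm q ^+ 2).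
  have := dot_ge0 (D + (2 * gam n) *: q); rewrite !dotE !enorm_sqr (dotC D q).
  by lra.
have qle : 2 * enorm q ^+ 2 <= kappa xi * (1 + enorm (y - w) ^+ 2).
  have h1 := enormD_sqr (phi xi) (b xi y); rewrite -qE in h1; have h2 := bm2 xi y.
  have h3 : (1 + enorm y) ^+ 2 <= 2 * (1 + enorm w) ^+ 2 + 2 * enorm (y - w) ^+ 2.
    have h4 : (1 + enorm y) <= (1 + enorm w) + enorm (y - w).
      by rewrite -addrA lerD2l addrC -{1}(subrK w y) enormD.
    have h5 : (1 + enorm y) ^+ 2 <= ((1 + enorm w) + enorm (y - w)) ^+ 2.
      by rewrite ler_pXn2r ?nnegrE ?addr_ge0 ?enorm_ge0.
    by have := sqr_ge0 ((1 + enorm w) - enorm (y - w)); rewrite sqrrB; move: h5; rewrite sqrrD; lra.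
  have h6 := ler_wpM2l (m2_ge0 xi) h3.
  rewrite /kappa; set v2 := enorm (y - w) ^+ 2 in h3 h6 *.
  have v20 : 0 <= v2 by exact: sqr_ge0.
  have := mulr_ge0 (sqr_ge0 (enorm (theta xi))) v20.
  have := mulr_ge0 (sqr_ge0 (enorm (phi xi))) v20.
  have := mulr_ge0 (m2_ge0 xi) v20.
  have := mulr_ge0 (mulr_ge0 (m2_ge0 xi) (sqr_ge0 (1 + enorm w))) v20.
  have := sqr_ge0 (enorm (theta xi)); have := m2_ge0 xi.
  move: (m2 xi) (enorm (phi xi) ^+ 2) (enorm (theta xi) ^+ 2) ((1 + enorm w) ^+ 2)
    h1 h2 h6 => ? ? ? ? *.
  by lra.
have := ler_wpM2l (sqr_ge0 (gam n)) qle.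
by lra.
Qed.

Let K := \int[mu]_xi kappa xi.
Let K_ge0 : 0 <= K. Proof. by apply: Rintegral_ge0 => xi _; exact: kappa_ge0. Qed.
Let cc n := gam n ^+ 2 * K.
Let cc_ge0 n : 0 <= cc n. Proof. by rewrite mulr_ge0 ?sqr_ge0. Qed.
Let cc_sums : bounded_sums cc.
Proof.
have [C hC] := gam2; exists (C * K) => n.
by rewrite -mulr_suml ler_wpM2r.
Qed.

Let W_ge0 y : 0 <= W y. Proof. exact: sqr_ge0. Qed.

Let mW dT (T : measurableType dT) (f : T -> V) :
  measurable_fun setT (f : T -> borelRV R N) -> measurable_fun setT (fun t => W (f t)).
Proof.
move=> mf; apply: measurable_funX; apply: measurable_enorm.
by apply: measurable_funBV => //; exact: measurable_cst.
Qed.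

Let mDelta n : measurable_fun setT (fun z => enorm ((G n z : V) - z.2) ^+ 2).
Proof.
by apply: measurable_funX; apply: measurable_enorm; apply: measurable_funBV.
Qed.

Let integral_kappaZ (a : R) : 0 <= a ->
  (\int[mu]_xi (a * kappa xi)%:E = (a * K)%:E)%E.
Proof.
move=> a0; under eq_integral do rewrite EFinM.
rewrite integralZl// EFinM /K /Rintegral fineK//.
exact: integrable_fin_num integrable_kappa.
Qed.

(** The linear term drops out because [theta] has zero mean by [phi_psi0]. *)
Lemma step_expectation n y :
  (\int[mu]_xi (W (G n (xi, y)))%:E +
   (2^-1)%:E * \int[mu]_xi (enorm ((G n (xi, y) : V) - y) ^+ 2)%:E
   <= (W y + cc n * (1 + W y))%:E)%E.
Proof.
have mWy := measurable_fun_pair1 (y : borelRV R N) (mW (@mG n)).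
have mDy := measurable_fun_pair1 (y : borelRV R N) (@mDelta n).
have mWyE : measurable_fun setT (fun xi => (W (G n (xi, y)))%:E).
  exact/measurable_EFinP.
have mDyE : measurable_fun setT (fun xi => (enorm ((G n (xi, y) : V) - y) ^+ 2)%:E).
  exact/measurable_EFinP.
rewrite -ge0_integralZl_EFin//; last by move=> xi _; rewrite lee_fin sqr_ge0.
rewrite -ge0_integralD//; last 3 first.
- by move=> xi _; rewrite lee_fin.
- by move=> xi _; rewrite -EFinM lee_fin mulr_ge0 ?sqr_ge0.
- exact: measurable_funeM.
rewrite (eq_integral (fun xi =>
    (W (G n (xi, y)) + 2^-1 * enorm ((G n (xi, y) : V) - y) ^+ 2)%:E)); last first.
  by move=> xi _; rewrite -EFinM -EFinD.
have msb : measurable_fun setT (fun xi => step_bound n (xi, y)).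
  rewrite /step_bound /=; apply: measurable_funD.
    apply: measurable_funB => //; apply: measurable_funM => //.
    by apply: measurable_dot => //; exact: measurable_cst.
  by apply: measurable_funM => //; exact: measurable_funM.
apply: (@le_trans _ _ (\int[mu]_xi (step_bound n (xi, y))%:E)%E).
  apply: ae_ge0_le_integral => //.
  - by move=> xi _; rewrite lee_fin addr_ge0// mulr_ge0 ?invr_ge0 ?sqr_ge0.
  - apply/measurable_EFinP; apply: measurable_funD.
      exact: mWy.
    by apply: measurable_funM => //; exact: mDy.
  - by move=> xi _; rewrite lee_fin.
  - exact/measurable_EFinP.
  - by apply: filterS (step_le n y) => xi h _; rewrite lee_fin.
have i1 : mu.-integrable setT (EFin \o cst (W y)).
  exact: finite_measure_integrable_cst.
have i2 := integrable_dot (y - w) integrable_theta.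
have i3 := integrableZl measurableT (- (2 * gam n)) i2.
have c0 : 0 <= gam n ^+ 2 * (1 + W y) by rewrite mulr_ge0 ?addr_ge0 ?sqr_ge0.
have i4 := integrableZl measurableT (gam n ^+ 2 * (1 + W y)) integrable_kappa.
rewrite (eq_integral (fun xi => ((W y)%:E +
    (- (2 * gam n))%:E * (dot (theta xi) (y - w))%:E +
    (gam n ^+ 2 * (1 + W y))%:E * (kappa xi)%:E)%E)); last first.
  by move=> xi _; rewrite -!EFinM -!EFinD /step_bound /=; congr EFin; ring.
rewrite integralD//; last exact: integrableD.
rewrite integralD// integral_prob_cst integralZl//.
rewrite integral_dot// vintegralD; last 2 first.
- exact: selection2_vintegrable sphi.
- exact: selection2_vintegrable spsi.
rewrite phi_psi0 dot0l mule0 adde0.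
under eq_integral do rewrite -EFinM.
by rewrite integral_kappaZ// -EFinD lee_fin /cc le_eqVlt; apply/orP; left; apply/eqP; ring.
Qed.

Lemma iterates_moment :
  (exists C, forall n, (\int[P]_omega (W (x n omega))%:E <= C%:E)%E) /\
  (exists2 dl : nat -> R, bounded_sums dl & forall n,
    (\int[P]_omega \int[mu]_xi
      (enorm ((G n (xi, x n omega) : V) - x n omega) ^+ 2)%:E <= (dl n)%:E)%E).
Proof.
pose al n := (\int[P]_omega (W (x n omega))%:E)%E.
pose de n := (\int[P]_omega \int[mu]_xi
      (enorm ((G n (xi, x n omega) : V) - x n omega) ^+ 2)%:E)%E.
have al0 n : (0 <= al n)%E by apply: integral_ge0 => omega _; rewrite lee_fin.
have de0 n : (0 <= de n)%E.
  apply: integral_ge0 => omega _; apply: integral_ge0 => xi _.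
  by rewrite lee_fin sqr_ge0.
have step n : (al n.+1 + (2^-1)%:E * de n <= (1 + cc n)%:E * al n + (cc n)%:E)%E.
  have mGn := mW (@mG n).
  have mWx k : measurable_fun setT (fun omega => (W (x k omega))%:E).
    by apply/measurable_EFinP; exact: mW.
  have mfD : measurable_fun setT (fubini_G mu
      (fun z : Xi * borelRV R N => (enorm ((G n z : V) - z.2) ^+ 2)%:E)).
    apply: measurable_fun_fubini_tonelli_G; first exact/measurable_EFinP.
    by move=> z; rewrite lee_fin sqr_ge0.
  have mID : measurable_fun setT (fun omega => \int[mu]_xi
      (enorm ((G n (xi, x n omega) : V) - x n omega) ^+ 2)%:E)%E.
    exact: (measurableT_comp mfD (mx n)).
  have mfW : measurable_fun setT (fubini_G mu
      (fun z : Xi * borelRV R N => (W (G n z))%:E)).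
    apply: measurable_fun_fubini_tonelli_G; first exact/measurable_EFinP.
    by move=> z; rewrite lee_fin.
  have mIW : measurable_fun setT (fun omega => \int[mu]_xi
      (W (G n (xi, x n omega)))%:E)%E.
    exact: (measurableT_comp mfW (mx n)).
  have E1 : al n.+1 = (\int[P]_omega \int[mu]_xi (W (G n (xi, x n omega)))%:E)%E.
    have hm : measurable_fun setT (fun z : Xi * borelRV R N => (W (G n z))%:E).
      exact/measurable_EFinP.
    have h0 (z : Xi * borelRV R N) : (0 <= (W (G n z))%:E)%E by rewrite lee_fin.
    rewrite /al -(integral_process (s := x : nat -> Omega -> borelRV R N)
      iidU x_0 xS mG n hm h0).
    by apply: eq_integral => omega _; rewrite xS.
  have ID0 omega : (0 <= \int[mu]_xi
      (enorm ((G n (xi, x n omega) : V) - x n omega) ^+ 2)%:E)%E.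
    by apply: integral_ge0 => xi _; rewrite lee_fin sqr_ge0.
  have half0 : 0 <= 2^-1 :> R by rewrite invr_ge0.
  rewrite E1 /de -(ge0_integralZl_EFin P measurableT (fun omega _ => ID0 omega) mID half0).
  rewrite -ge0_integralD//; last 3 first.
  - by move=> omega _; apply: integral_ge0 => xi _; rewrite lee_fin.
  - by move=> omega _; apply: mule_ge0; rewrite ?lee_fin.
  - exact: (measurable_funeM _ mID).
  rewrite -ge0_integralZl_EFin//; last 2 first.
  - by move=> omega _; rewrite lee_fin.
  - by rewrite addr_ge0.
  rewrite -[X in (_ <= _ + X)%E](@integral_prob_cst _ _ _ P) -ge0_integralD//; last 3 first.
  - by move=> omega _; rewrite mule_ge0 ?lee_fin ?addr_ge0.
  - exact: (measurable_funeM _ (mWx n)).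
  - by move=> omega _; rewrite lee_fin.
  apply: ge0_le_integral => //.
  - move=> omega _; apply: adde_ge0; first by apply: integral_ge0 => xi _; rewrite lee_fin.
    by apply: mule_ge0; rewrite ?lee_fin.
  - exact: (emeasurable_funD mIW (measurable_funeM _ mID)).
  - exact: (emeasurable_funD (measurable_funeM _ (mWx n)) (measurable_cst _)).
  - move=> omega _; have := step_expectation n (x n omega).
    move=> /le_trans; apply; rewrite -EFinM -EFinD lee_fin le_eqVlt.
    by apply/orP; left; apply/eqP; ring.
(* Finiteness has to precede the passage to real numbers: it propagates along [step], whose
   left-hand side contains both [al n.+1] and [de n]. *)
have fin n : al n \is a fin_num /\ de n \is a fin_num.
  suff alfin : al n \is a fin_num.
    split => //; have := step n; rewrite -(fineK alfin) -EFinM -EFinD => h.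
    rewrite ge0_fin_numE//; apply: contraTT h; rewrite -leNgt leye_eq => /eqP ->.
    rewrite mulry gtr0_sg ?invr_gt0// mul1e addey ?leye_eq//.
    by rewrite gt_eqF// (lt_le_trans _ (al0 _))// ltNy0.
  elim: n => [|n IH].
    rewrite /al; under eq_integral do rewrite x_0.
    by rewrite integral_prob_cst.
  have := step n; rewrite -(fineK IH) -EFinM -EFinD => h.
  rewrite ge0_fin_numE//; apply: le_lt_trans (ltry _); apply: le_trans h.
  by rewrite leeDl// mule_ge0// lee_fin invr_ge0.
pose a n := fine (al n); pose dl n := fine (de n).
have alE n : al n = (a n)%:E by rewrite fineK//; have [] := fin n.
have deE n : de n = (dl n)%:E by rewrite fineK//; have [] := fin n.
have a0 n : 0 <= a n by rewrite fine_ge0.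
have dl0 n : 0 <= dl n by rewrite fine_ge0.
have stepR n : a n.+1 + 2^-1 * dl n <= (1 + cc n) * a n + cc n.
  by have := step n; rewrite !alE deE -!EFinM -!EFinD lee_fin.
have [[C hC] sdl] := moment_recursion a0 dl0 cc_ge0 cc_sums stepR.
split; first by exists C => n; rewrite -/(al n) alE lee_fin.
by exists dl => // n; rewrite -/(de n) deE.
Qed.

Let martingale_part n (z : Xi * borelRV R N) : R :=
  - (2 * gam n) * dot (theta z.1) ((z.2 : V) - w).

Let mtheta_dot : measurable_fun setT
  (fun z : Xi * borelRV R N => dot (theta z.1) ((z.2 : V) - w)).
Proof. by apply: measurable_dot => //; exact: measurableT_comp measurable_fst. Qed.

Let mkappa_W : measurable_fun setT
  (fun z : Xi * borelRV R N => kappa z.1 * (1 + W z.2)).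
Proof.
apply: measurable_funM; first exact: measurableT_comp measurable_fst.
by apply: measurable_funD => //; exact: (mW (@measurable_snd _ _ Xi (borelRV R N))).
Qed.

Lemma noise_sums : {ae P, forall omega,
  bounded_sums (fun n => gam n ^+ 2 * (kappa (U n omega) * (1 + W (x n omega))))}.
Proof.
have [[C hC] _] := iterates_moment.
pose h n (z : Xi * borelRV R N) := gam n ^+ 2 * (kappa z.1 * (1 + W z.2)).
have h0 n z : 0 <= h n z by rewrite mulr_ge0 ?sqr_ge0// mulr_ge0// addr_ge0.
have mh n : measurable_fun setT (h n) by exact: measurable_funM.
have mhU n : measurable_fun setT (fun omega => h n (U n omega, x n omega)).
  exact: (measurableT_comp (mh n) (mUx n)).
apply: (ae_bounded_sums mhU (fun n omega => h0 n _) (w := fun n => cc n * (1 + C))); last first.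
  by have [D hD] := cc_sums; exists (D * (1 + C)) => n; rewrite -mulr_suml ler_wpM2r// addr_ge0//;
    rewrite -lee_fin (le_trans _ (hC 0%N))// integral_ge0// => omega _; rewrite lee_fin.
move=> n; have mhE : measurable_fun setT (fun z => (h n z)%:E) by exact/measurable_EFinP.
have hE0 z : (0 <= (h n z)%:E)%E by rewrite lee_fin.
rewrite (integral_process (s := x : nat -> Omega -> borelRV R N) iidU x_0 xS mG n mhE hE0).
rewrite (eq_integral (fun omega => ((cc n)%:E + (cc n)%:E * (W (x n omega))%:E)%E)); last first.
  move=> omega _; rewrite (eq_integral (fun xi => ((gam n ^+ 2 * (1 + W (x n omega))) * kappa xi)%:E)).
    rewrite integral_kappaZ; last by rewrite mulr_ge0 ?sqr_ge0// addr_ge0.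
    by rewrite -EFinM -EFinD /cc; congr EFin; ring.
  by move=> xi _; rewrite /h /=; congr EFin; ring.
rewrite ge0_integralD//; last 3 first.
- by move=> omega _; rewrite lee_fin.
- by move=> omega _; rewrite -EFinM lee_fin mulr_ge0.
- by apply: measurable_funeM; apply/measurable_EFinP; exact: mW.
rewrite integral_prob_cst ge0_integralZl_EFin//; last 2 first.
- by move=> omega _; rewrite lee_fin.
- by apply/measurable_EFinP; exact: mW.
have -> : ((cc n * (1 + C))%:E = (cc n)%:E + (cc n)%:E * C%:E)%E.
  by rewrite -EFinM -EFinD; congr EFin; ring.
by apply: leeD2l; apply: lee_wpmul2l; rewrite ?lee_fin.
Qed.

(** Given the state, the summand is centred and its variance is at most a constant times
    [gam n ^+ 2 * W (x n)]; the moment bound makes these variances summable. *)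
Lemma drift_sums_cvg : {ae P, forall omega, exists l : R,
  (fun n => \sum_(0 <= k < n) martingale_part k (U k omega, x k omega)) @ \oo --> l}.
Proof.
have [[C hC] _] := iterates_moment.
have itheta2 : mu.-integrable setT (EFin \o (fun xi => enorm (theta xi) ^+ 2)).
  apply: le_integrable integrable_kappa => //.
    by apply/measurable_EFinP; apply: measurable_funX; exact: measurable_enorm.
  move=> xi _; rewrite /= lee_fin ger0_norm ?sqr_ge0// ger0_norm// /kappa -addrA lerDl.
  apply: addr_ge0; first by rewrite mulr_ge0 ?sqr_ge0.
  by rewrite mulr_ge0// mulr_ge0// addr_ge0 ?sqr_ge0.
pose T2 := \int[mu]_xi enorm (theta xi) ^+ 2.
have T20 : 0 <= T2 by apply: Rintegral_ge0 => xi _; exact: sqr_ge0.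
have C0 : 0 <= C.
  by rewrite -lee_fin (le_trans _ (hC 0%N))// integral_ge0// => omega _; rewrite lee_fin.
apply: (@martingale_cvg _ _ _ mu _ _ P U iidU _ (borelRV R N) G x x0 x_0 xS mG
  martingale_part _ _ _ (fun n => 4 * (T2 * C) * gam n ^+ 2)).
- by move=> n; exact: measurable_funM.
- move=> n y; have := integrableZl measurableT (- (2 * gam n))
    (integrable_dot (y - w : V) integrable_theta).
  by apply: (eq_integrable measurableT) => xi _.
- move=> n y; rewrite /martingale_part /=; under eq_integral do rewrite EFinM.
  rewrite integralZl//; last exact: integrable_dot.
  rewrite integral_dot// vintegralD; last 2 first.
  + exact: selection2_vintegrable sphi.
  + exact: selection2_vintegrable spsi.
  by rewrite phi_psi0 dot0l mule0.
- by move=> n; rewrite mulr_ge0 ?sqr_ge0// mulr_ge0// mulr_ge0.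
- have [D hD] := gam2; exists (4 * (T2 * C) * D) => n.
  by rewrite -mulr_sumr ler_wpM2l// mulr_ge0// mulr_ge0.
- move=> n; pose k := 4 * T2 * gam n ^+ 2.
  have k0 : 0 <= k by rewrite mulr_ge0 ?sqr_ge0// mulr_ge0.
  apply: (@le_trans _ _ (\int[P]_omega (k%:E * (W (x n omega))%:E))%E); last first.
    rewrite ge0_integralZl_EFin//; last 2 first.
    + by move=> omega _; rewrite lee_fin.
    + by apply/measurable_EFinP; exact: mW.
    have -> : 4 * (T2 * C) * gam n ^+ 2 = k * C by rewrite /k; ring.
    by rewrite [(k * C)%:E]EFinM; apply: lee_wpmul2l; rewrite ?lee_fin.
  have mm : measurable_fun setT (fun z => (martingale_part n z ^+ 2)%:E).
    by apply/measurable_EFinP; apply: measurable_funX; exact: measurable_funM.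
  have mfm : measurable_fun setT (fubini_G mu (fun z => (martingale_part n z ^+ 2)%:E)).
    by apply: measurable_fun_fubini_tonelli_G => // z; rewrite lee_fin sqr_ge0.
  apply: ge0_le_integral => //.
  + by move=> omega _; apply: integral_ge0 => xi _; rewrite lee_fin sqr_ge0.
  + exact: (measurableT_comp mfm (mx n)).
  + by apply: measurable_funeM; apply/measurable_EFinP; exact: mW.
  move=> omega _; set y := x n omega.
  apply: (@le_trans _ _ (\int[mu]_xi ((4 * gam n ^+ 2 * W y)%:E * (enorm (theta xi) ^+ 2)%:E))%E).
    apply: ge0_le_integral => //.
    + by move=> xi _; rewrite lee_fin sqr_ge0.
    + exact: (measurable_fun_pair1 (y : borelRV R N) mm).
    + apply: measurable_funeM; apply/measurable_EFinP.
      by apply: measurable_funX; exact: measurable_enorm.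
    + move=> xi _; rewrite -EFinM lee_fin /martingale_part /=.
      have : dot (theta xi) (y - w) ^+ 2 <= enorm (theta xi) ^+ 2 * W y.
        rewrite /W -exprMn -(real_normK (num_real (dot _ _))) ler_pXn2r ?nnegrE//.
          exact: normr_dot_le.
        by rewrite mulr_ge0 ?enorm_ge0.
      by move=> /(ler_wpM2l (sqr_ge0 (2 * gam n))); lra.
  rewrite integralZl// -EFinM.
  have -> : (\int[mu]_xi (enorm (theta xi) ^+ 2)%:E = T2%:E)%E.
    by rewrite /T2 /Rintegral fineK//; exact: integrable_fin_num itheta2.
  by rewrite -EFinM lee_fin /k le_eqVlt; apply/orP; left; apply/eqP; ring.
Qed.

(** The Robbins-Siegmund argument in pathwise form: the drift sums converge and the quadratic errors
    are summable on the same trajectory. *)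
Lemma lyapunov_cvg : {ae P, forall omega, exists l : R,
  (fun n => enorm (x n omega - w) ^+ 2) @ \oo --> l}.
Proof.
have stepP : {ae P, forall omega, forall n,
    W (G n (U n omega, x n omega)) + 2^-1 *
      enorm ((G n (U n omega, x n omega) : V) - x n omega) ^+ 2
    <= step_bound n (U n omega, x n omega)}.
  apply: ae_foralln => n.
  apply: (@ae_Ux n (fun z =>
    W (G n z) + 2^-1 * enorm ((G n z : V) - z.2) ^+ 2 <= step_bound n z)); last first.
    by move=> y; exact: step_le.
  rewrite -[X in measurable X]setTI; apply: measurable_fun_ler => //.
    apply: measurable_funD; first exact: mW.
    exact: measurable_funM.
  apply: measurable_funD; last exact: measurable_funM.
  apply: measurable_funB; first exact: (mW (@measurable_snd _ _ Xi (borelRV R N))).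
  exact: measurable_funM.
apply: filterS3 stepP noise_sums drift_sums_cvg => omega step ns ds.
apply: (quasi_decreasing_cvg (xi := fun k => martingale_part k (U k omega, x k omega))
  (e := fun k => gam k ^+ 2 * (kappa (U k omega) * (1 + W (x k omega))))) => //.
- by move=> n; exact: sqr_ge0.
- by move=> n; rewrite mulr_ge0 ?sqr_ge0// mulr_ge0// addr_ge0.
- move=> n; have := step n; rewrite -/(W _) -/(W _) xS /step_bound /martingale_part /=.
  set D := enorm _ ^+ 2; have : 0 <= D by exact: sqr_ge0.
  by rewrite -/(G n (U n omega, x n omega)); lra.
Qed.

(** [kappa] dominates the squared forward drift up to the factor [1 + W]. The result no longer
    refers to [w] and controls the quadratic errors of the test inequalities. *)
Lemma forward_sums : {ae P, forall omega,
  bounded_sums (fun n => gam n ^+ 2 * enorm (b (U n omega) (x n omega)) ^+ 2)}.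
Proof.
apply: filterS noise_sums => omega [C hC]; exists C => n; apply: le_trans (hC n).
apply: ler_sum => k _; rewrite ler_wpM2l ?sqr_ge0// (le_trans (bm2 _ _))//.
set y := x k omega; set xi := U k omega.
have h3 : (1 + enorm y) ^+ 2 <= 2 * (1 + enorm w) ^+ 2 + 2 * W y.
  have h4 : (1 + enorm y) <= (1 + enorm w) + enorm (y - w).
    by rewrite -addrA lerD2l addrC -{1}(subrK w y) enormD.
  have h5 : (1 + enorm y) ^+ 2 <= ((1 + enorm w) + enorm (y - w)) ^+ 2.
    by rewrite ler_pXn2r ?nnegrE ?addr_ge0 ?enorm_ge0.
  by have := sqr_ge0 ((1 + enorm w) - enorm (y - w)); rewrite sqrrB /W; move: h5; rewrite sqrrD; lra.
apply: (le_trans (ler_wpM2l (m2_ge0 xi) h3)).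
have Wy := W_ge0 y; have m0 := m2_ge0 xi.
have p1 := mulr_ge0 (sqr_ge0 (enorm (theta xi))) Wy.
have p2 := mulr_ge0 (sqr_ge0 (enorm (phi xi))) Wy.
have p3 := mulr_ge0 m0 Wy.
have p4 := mulr_ge0 (mulr_ge0 m0 (sqr_ge0 (1 + enorm w))) Wy.
have p5 := sqr_ge0 (enorm (theta xi)); have p6 := sqr_ge0 (enorm (phi xi)).
have p7 := mulr_ge0 m0 (sqr_ge0 (1 + enorm w)).
rewrite /kappa.
move: (W y) (m2 xi) (enorm (phi xi) ^+ 2) (enorm (theta xi) ^+ 2) ((1 + enorm w) ^+ 2)
  Wy m0 p1 p2 p3 p4 p5 p6 p7 => ? ? ? ? ? *.
by lra.
Qed.

(** The resolvent lands in the domain of [A xi], so the distance from [x n] to that domain is at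
    most the length of the step. Squared steps are summable in mean, and the regularity inequality
    transfers this to [DD]. *)
Lemma dist_cvg0 (DD : set V) (C : R) : DD !=set0 -> 0 < C ->
  (forall y, (C * dist DD y ^+ 2)%:E <= \int[mu]_xi (dist (dom (A xi)) y ^+ 2)%:E)%E ->
  {ae P, forall omega, forall e, 0 < e ->
    exists m, forall n, (m <= n)%N -> dist DD (x n omega) < e}.
Proof.
move=> DD0 C0 hDD; have [_ [dl sdl hdl]] := iterates_moment.
have md n : measurable_fun setT (fun omega => C * dist DD (x n omega) ^+ 2).
  by apply: measurable_funM => //; apply: measurable_funX; exact: measurable_dist.
have d0 n omega : 0 <= C * dist DD (x n omega) ^+ 2 by rewrite mulr_ge0 ?sqr_ge0// ltW.
have bs : {ae P, forall omega, bounded_sums (fun n => C * dist DD (x n omega) ^+ 2)}.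
  apply: (ae_bounded_sums md d0 _ sdl) => n.
  apply: le_trans (hdl n); apply: ge0_le_integral => //.
  - by move=> omega _; rewrite lee_fin.
  - exact/measurable_EFinP.
  - have mfD : measurable_fun setT (fubini_G mu
      (fun z : Xi * borelRV R N => (enorm ((G n z : V) - z.2) ^+ 2)%:E)).
      apply: measurable_fun_fubini_tonelli_G; first exact/measurable_EFinP.
      by move=> z; rewrite lee_fin sqr_ge0.
    exact: (measurableT_comp mfD (mx n)).
  - move=> omega _; apply: (le_trans (hDD _)); apply: ge0_le_integral => //.
    + by move=> xi _; rewrite lee_fin sqr_ge0.
    + apply/measurable_EFinP; apply: measurable_funX; exact: measurable_dist_dom.
    + apply/measurable_EFinP.
      exact: (measurable_fun_pair1 (x n omega : borelRV R N) (@mDelta n)).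
    + move=> xi _; rewrite lee_fin ler_pXn2r ?nnegrE ?dist_ge0 ?enorm_ge0//.
      by rewrite enormBC dist_le//; exact: resolvent_dom.
apply: filterS bs => omega bs e e0.
have e2 : 0 < C * (e / 2) ^+ 2 by rewrite mulr_gt0// exprn_gt0// divr_gt0.
have [m hm] := bounded_sums_cvg0 (d0 ^~ omega) bs e2.
exists m => n /hm; rewrite ler_pM2l// ler_pXn2r ?nnegrE ?dist_ge0 ?divr_ge0 ?(ltW e0)//.
move=> /le_lt_trans; apply; by rewrite ltr_pdivrMr// ltr_pMr// ltr1n.
Qed.

End lyapunov.

(** * Inequalities at test points along windows *)

Section tests.

(** Second moments of the noise are bounded for bounded states only, hence the cut-off at [rho]. It
    depends on the current state, so the increments remain centred, and it is inactive once [rho]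
    exceeds a bound of the trajectory. *)
Lemma test_noise_cvg (f : Xi -> V -> V) (h : Xi -> R) (rho : R) (y : V) :
  measurable_fun setT (fun z : Xi * borelRV R N => f z.1 z.2 : borelRV R N) ->
  mu.-integrable setT (EFin \o h) ->
  (forall xi z, enorm z <= rho -> enorm (f xi z) ^+ 2 <= h xi) ->
  {ae P, forall omega, exists l : R, (fun n => \sum_(0 <= k < n) gam k *
    (if enorm (x k omega) <= rho then
       dot (f (U k omega) (x k omega) - vintegral mu (f ^~ (x k omega))) (x k omega - y)
     else 0)) @ \oo --> l}.
Proof.
move=> mf hi fh.
have ih1 : mu.-integrable setT (EFin \o (fun xi => 1 + h xi)).
  have i1 : mu.-integrable setT (EFin \o cst (1 : R)).
    exact: finite_measure_integrable_cst.
  by apply: (eq_integrable measurableT) (integrableD measurableT i1 hi) => t _.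
have mfz z : measurable_fun setT (f ^~ z : Xi -> borelRV R N).
  exact: (measurable_fun_pair1 (z : borelRV R N) mf).
have fi z : enorm z <= rho -> vintegrable mu (f ^~ z).
  move=> zr; apply: (dominated_vintegrable (mfz z) ih1); apply: filterE => xi.
  exact/enorm_le_sqr/fh.
pose fbar z := vintegral mu (f ^~ z).
have mfbar : measurable_fun setT (fbar : borelRV R N -> borelRV R N).
  exact: (@measurable_vintegral _ _ _ _ mu _ (borelRV R N) f mf).
pose H := \int[mu]_xi (1 + h xi).
have fbarH z : enorm z <= rho -> enorm (fbar z) <= H.
  by move=> zr; apply: (@enorm_vintegral_le _ _ _ _ mu _ _ (mfz z) ih1) => xi; exact/enorm_le_sqr/fh.
pose g n (z : Xi * borelRV R N) := gam n *
  (if enorm z.2 <= rho then dot (f z.1 z.2 - fbar z.2) ((z.2 : V) - y) else 0).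
have mfb : measurable_fun setT
    (fun z : Xi * borelRV R N => f z.1 z.2 - fbar z.2 : borelRV R N).
  apply: measurable_funBV => //; exact: measurableT_comp measurable_snd.
have mg n : measurable_fun setT (g n).
  apply: measurable_funM => //; apply: measurable_fun_ifT => //.
    by apply: measurable_fun_ler => //; apply: measurable_enorm; exact: measurable_snd.
  exact: measurable_dot.
pose c := rho + enorm y; pose k xi := 2 * c ^+ 2 * (1 + h xi) + 2 * c ^+ 2 * H ^+ 2.
have i0 : mu.-integrable setT (EFin \o k).
  have i1 : mu.-integrable setT (EFin \o cst (2 * c ^+ 2 * H ^+ 2)).
    exact: finite_measure_integrable_cst.
  by apply: (eq_integrable measurableT)
    (integrableD measurableT (integrableZl measurableT (2 * c ^+ 2) ih1) i1) => t _.
pose K2 := \int[mu]_xi k xi.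
apply: (@martingale_cvg _ _ _ mu _ _ P U iidU _ (borelRV R N) G x x0 x_0 xS mG g _ _ _
  (fun n => gam n ^+ 2 * `|K2|)) => //.
- move=> n z; rewrite /g /=; case zr: (enorm z <= rho); last first.
    by rewrite mulr0; exact: integrable0.
  have i1 := integrable_dot (z - y : V) (fi _ zr).
  have i2 : mu.-integrable setT (EFin \o cst (dot (fbar z) (z - y : V))).
    exact: finite_measure_integrable_cst.
  apply: (eq_integrable measurableT) (integrableZl measurableT (gam n)
    (integrableB measurableT i1 i2)) => t _.
  by rewrite /= dotDl dotNl EFinM EFinD.
- move=> n z; rewrite /g /=; case zr: (enorm z <= rho); last first.
    by rewrite mulr0; exact: integral0.
  have i1 := integrable_dot (z - y : V) (fi _ zr).
  have i2 : mu.-integrable setT (EFin \o cst (dot (fbar z) (z - y : V))).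
    exact: finite_measure_integrable_cst.
  under eq_integral do rewrite EFinM dotDl dotNl EFinB.
  rewrite integralZl//; last exact: integrableB.
  rewrite integralB// integral_dot; last exact: fi.
  by rewrite integral_prob_cst subee ?mule0.
- by move=> n; rewrite mulr_ge0 ?sqr_ge0.
- have [D hD] := gam2; exists (D * `|K2|) => n.
  by rewrite -mulr_suml ler_wpM2r.
- move=> n; rewrite -[X in (_ <= X)%E](@integral_prob_cst _ _ _ P).
  have mg2 : measurable_fun setT (fun z => (g n z ^+ 2)%:E).
    by apply/measurable_EFinP; apply: measurable_funX.
  have mfg : measurable_fun setT (fubini_G mu (fun z => (g n z ^+ 2)%:E)).
    by apply: measurable_fun_fubini_tonelli_G => // z; rewrite lee_fin sqr_ge0.
  apply: ge0_le_integral => //.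
  + by move=> omega _; apply: integral_ge0 => xi _; rewrite lee_fin sqr_ge0.
  + exact: (measurableT_comp mfg (mx n)).
  move=> omega _; move: (x n omega) => z.
  have [zr|zr] := boolP (enorm z <= rho); last first.
    rewrite integral0_eq; first by rewrite lee_fin mulr_ge0 ?sqr_ge0.
    by move=> xi _; rewrite /g /= (negbTE zr) mulr0 expr0n.
  apply: (@le_trans _ _ (\int[mu]_xi ((gam n ^+ 2)%:E *
(k xi)%:E))%E).
    apply: ge0_le_integral => //.
    + by move=> xi _; rewrite lee_fin sqr_ge0.
    + exact: (measurable_fun_pair1 (z : borelRV R N) mg2).
    + by apply: measurable_funeM; exact: measurable_int i0.
    + move=> xi _; rewrite -EFinM lee_fin /g /= zr exprMn ler_wpM2l ?sqr_ge0//.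
      apply: (@le_trans _ _ (enorm (f xi z - fbar z) ^+ 2 * c ^+ 2)).
        rewrite -exprMn -(real_normK (num_real (dot _ _))) ler_pXn2r ?nnegrE//.
          apply: (le_trans (normr_dot_le _ _)); rewrite ler_wpM2l ?enorm_ge0//.
          by rewrite (le_trans (enormB _ _))// lerD2r.
        by rewrite mulr_ge0 ?enorm_ge0// addr_ge0 ?enorm_ge0// (le_trans _ zr) ?enorm_ge0.
      have h1 := enormD_sqr (f xi z) (- fbar z); rewrite enormN in h1.
      have h2 := fh xi z zr.
      have h3 : enorm (fbar z) ^+ 2 <= H ^+ 2.
        have := fbarH z zr; have := enorm_ge0 (fbar z).
        by move=> p q; rewrite ler_pXn2r ?nnegrE// (le_trans p).
      have -> : k xi = (2 * (1 + h xi) + 2 * H ^+ 2) * c ^+ 2 by rewrite /k; ring.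
      by rewrite ler_wpM2r ?sqr_ge0//; lra.
  rewrite integralZl//.
  have -> : (\int[mu]_xi (k xi)%:E = K2%:E)%E.
    by rewrite /K2 /Rintegral fineK//; exact: integrable_fin_num i0.
  by rewrite -EFinM lee_fin ler_wpM2l ?sqr_ge0// ler_norm.
Qed.

(** The truncated part is paired with [x n] at the cost of its square, the remainder with [x n.+1]:
    completing the square for the truncated part alone means that the square of the merely
    integrable remainder never appears. *)
Lemma test_step (y : V) (phi : Xi -> V) : {ae mu, forall xi, A xi y (phi xi)} ->
  {ae P, forall omega, forall n M, let q := trunc M (phi (U n omega)) in
    enorm (x n.+1 omega - y) ^+ 2 <= enorm (x n omega - y) ^+ 2
      - 2 * (gam n * dot (q + b (U n omega) (x n omega)) (x n omega - y))
      + gam n ^+ 2 * enorm (q + b (U n omega) (x n omega)) ^+ 2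
      - 2 * (gam n * dot (phi (U n omega) - q) (x n.+1 omega - y))}.
Proof.
move=> Aphi.
have hA : {ae P, forall omega, forall n, A (U n omega) y (phi (U n omega))}.
  by apply: ae_foralln => n; exact: (ae_driver iidU n Aphi).
apply: filterS hA => omega hA n M.
have psi0 : 0 <= dot (b (U n omega) (x n omega) - b (U n omega) (x n omega)) (x n omega - y).
  by rewrite subrr dot0l.
have := forward_backward_step (gam0 n) (maxA _) (hA n) psi0 (xS n omega).
set s := trunc _ _ + _; set r := phi _ - _.
have -> : phi (U n omega) + b (U n omega) (x n omega) = s + r.
  by rewrite /s /r; apply/rowP => j; rewrite !mxE; ring.
have -> : x n.+1 omega - y = (x n.+1 omega - x n omega) + (x n omega - y).
  by rewrite addrA subrK.
have := sqr_ge0 (enorm ((x n.+1 omega - x n omega) + gam n *: s)).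
move: (_ - x n omega) (x n omega - y) (s) (r) => D v {}s {}r.
by rewrite !enorm_sqr !dotE (dotC s D); lra.
Qed.

Lemma truncated_noise_cvg (y : V) (phi : Xi -> V) :
  selections mu 1 (fun xi => A xi y) phi ->
  {ae P, forall omega, forall M rho : nat, exists l : R,
    (fun n => \sum_(0 <= k < n) gam k * (if enorm (x k omega) <= rho%:R then
       dot (trunc M%:R (phi (U k omega)) + b (U k omega) (x k omega) -
         (vintegral mu (fun xi => trunc M%:R (phi xi)) + vintegral mu (b ^~ (x k omega))))
         (x k omega - y) else 0)) @ \oo --> l}.
Proof.
move=> sphi; have [mphi _ _] := sphi.
apply: ae_foralln => M; apply: ae_foralln => rho.
have mt := measurable_trunc M%:R mphi.
have ti : vintegrable mu (fun xi => trunc M%:R (phi xi)).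
  apply: (dominated_vintegrable mt (selection1_integrable sphi)).
  by apply: filterE => xi; exact: enorm_trunc_le.
have mf : measurable_fun setT (fun z : Xi * borelRV R N =>
    trunc M%:R (phi z.1) + b z.1 z.2 : borelRV R N).
  by apply: measurable_funDV => //; exact: (measurableT_comp mt measurable_fst).
have hi : mu.-integrable setT
    (EFin \o (fun xi => 2 * M%:R ^+ 2 + 2 * (1 + rho%:R) ^+ 2 * m2 xi)).
  have i1 : mu.-integrable setT (EFin \o cst (2 * M%:R ^+ 2 : R)).
    exact: finite_measure_integrable_cst.
  by apply: (eq_integrable measurableT) (integrableD measurableT i1
    (integrableZl measurableT (2 * (1 + rho%:R) ^+ 2) m2i)) => t _.
apply: filterS (test_noise_cvg (f := fun xi z => trunc M%:R (phi xi) + b xi z)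
  (rho := rho%:R) y mf hi _) => [omega [l hl]|xi z zr].
  exists l; apply: cvg_trans hl; apply: near_eq_cvg; apply: nearW => n.
  by apply: eq_bigr => k _; rewrite vintegralD.
apply: (le_trans (enormD_sqr _ _)).
have h1 : enorm (trunc M%:R (phi xi)) ^+ 2 <= M%:R ^+ 2.
  by rewrite ler_pXn2r ?nnegrE ?enorm_ge0 ?ler0n ?enorm_trunc ?ler0n.
have h2 : (1 + enorm z) ^+ 2 <= (1 + rho%:R) ^+ 2.
  by rewrite ler_pXn2r ?nnegrE ?lerD2l ?addr_ge0 ?enorm_ge0.
have := le_trans (bm2 xi z) (ler_wpM2l (m2_ge0 xi) h2).
by lra.
Qed.

Context (test : nat -> V * V) (phi : nat -> Xi -> V)
  (sphi : forall i, selections mu 1 (fun xi => A xi (test i).1) (phi i))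
  (phiE : forall i, vintegral mu (phi i) = (test i).2).
Context (e : nat -> nat) (e_le : forall m, \sum_(m <= k < e m) gam k <= 2)
  (e_max : forall m t, (m <= t)%N -> \sum_(m <= k < t) gam k <= 2 -> (t <= e m)%N).

(** For a fixed truncation level, the noise sums and the quadratic errors become small on all late
    windows; the remainder alone restricts the window. So the tolerance and [J] fix [q], the
    trajectory then fixes [M], and a rare window is taken beyond all tail thresholds. *)
Lemma test_inequalities : {ae P, forall omega,
  bounded_sums (fun n => gam n ^+ 2 * enorm (b (U n omega) (x n omega)) ^+ 2) ->
  (exists r, forall n, enorm (x n omega) <= r) ->
  forall eps J m0, 0 < eps -> exists2 m, (m0 <= m)%N & forall i s t, (i < J)%N ->
    (m <= s <= t)%N -> \sum_(m <= k < t) gam k <= 2 ->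
    enorm (x t omega - (test i).1) ^+ 2 - enorm (x s omega - (test i).1) ^+ 2 <=
    - (2 * (\sum_(s <= k < t) gam k *
       dot (vintegral mu (b ^~ (x k omega)) + (test i).2) (x k omega - (test i).1))) + eps}.
Proof.
pose F J M xi := \sum_(i < J) enorm (phi i xi - trunc M%:R (phi i xi)).
have mphi i : measurable_fun setT (phi i : Xi -> borelRV R N) by have [] := sphi i.
have iphi i := selection1_integrable (sphi i).
have FP J := truncation_remainders J mphi iphi.
pose dl J M := \int[mu]_xi F J M xi.
have F0 J M xi : 0 <= F J M xi by apply: sumr_ge0 => i _; exact: enorm_ge0.
have H1 : {ae P, forall omega, forall i n M, let q := trunc M (phi i (U n omega)) in
    enorm (x n.+1 omega - (test i).1) ^+ 2 <= enorm (x n omega - (test i).1) ^+ 2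
      - 2 * (gam n * dot (q + b (U n omega) (x n omega)) (x n omega - (test i).1))
      + gam n ^+ 2 * enorm (q + b (U n omega) (x n omega)) ^+ 2
      - 2 * (gam n * dot (phi i (U n omega) - q) (x n.+1 omega - (test i).1))}.
  by apply: ae_foralln => i; apply: test_step; have [] := sphi i.
have H2 := ae_foralln (fun i => truncated_noise_cvg (sphi i)).
have H3 : {ae P, forall omega, forall J q : nat, exists M, dl J M <= q.+1%:R^-1 /\
    forall m0, exists2 m, (m0 <= m)%N &
      \sum_(m <= k < e m) gam k * F J M (U k omega) < q.+1%:R^-1}.
  apply: ae_foralln => J; apply: ae_foralln => q; have [mF iF dl0] := FP J.
  apply: (rare_windows iidU (F := F J)) => // [M|k]; last exact: ltW.
  by rewrite /dl /Rintegral fineK//; exact: integrable_fin_num (iF M).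
apply: filterS3 H1 H2 H3 => omega H1 H2 H3 bs [r xr] eps J m0 eps0.
have r0 : 0 <= r by rewrite (le_trans _ (xr 0%N)) ?enorm_ge0.
pose Q := r + \sum_(i < J) enorm (test i).1 + 1.
have Q0 : 0 < Q by rewrite ltr_wpDl// addr_ge0// sumr_ge0// => i _; exact: enorm_ge0.
have xQ i n : (i < J)%N -> enorm (x n omega - (test i).1) <= Q.
  move=> iJ; apply: (le_trans (enormB _ _)).
  have yS : enorm (test i).1 <= \sum_(i < J) enorm (test i).1.
    by rewrite (bigD1 (Ordinal iJ))//= lerDl sumr_ge0// => j _; exact: enorm_ge0.
  by have := xr n; rewrite /Q; lra.
have [rho rrho] : exists rho : nat, r <= rho%:R.
  by exists (Num.bound r); apply: ltW; exact: archi_boundP.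
(* The two remainder terms are at most [4 * Q / q.+1] and [2 * Q / q.+1], so this choice makes them
   at most [eps / 4] together; noise and quadratic errors contribute [eps / 8] each. *)
have [q qQ] : exists q : nat, q.+1%:R^-1 < eps / (24 * Q).
  have [|q] := @ltr_add_invr R 0 (eps / (24 * Q)); last by rewrite add0r; exists q.
  by rewrite divr_gt0// mulr_gt0.
have [M [dM WM]] := H3 J q.
pose tr i k := trunc M%:R (phi i (U k omega)).
pose aM i := vintegral mu (fun xi => trunc M%:R (phi i xi)).
pose bb k := vintegral mu (b ^~ (x k omega)).
pose v i k := x k omega - (test i).1.
pose g i k := gam k * dot (tr i k + b (U k omega) (x k omega) - (aM i + bb k)) (v i k).
pose p i k := gam k ^+ 2 * enorm (tr i k + b (U k omega) (x k omega)) ^+ 2.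
have p0 i k : 0 <= p i k by rewrite mulr_ge0 ?sqr_ge0.
have tails i : exists m1, forall s t, (m1 <= s <= t)%N ->
    `|\sum_(s <= k < t) g i k| <= eps / 16 /\ \sum_(s <= k < t) p i k <= eps / 8.
  have e32 : 0 < eps / 32 by rewrite divr_gt0.
  have e8 : 0 < eps / 8 by rewrite divr_gt0.
  have gl : exists l : R, (fun n => \sum_(0 <= k < n) g i k) @ \oo --> l.
    have [l hl] := H2 i M rho; exists l; apply: cvg_trans hl.
    apply: near_eq_cvg; apply: nearW => n; apply: eq_bigr => k _.
    by rewrite (le_trans (xr k) rrho).
  have [m1 hm1] := (cvg_cauchyP _).1 gl _ e32.
  have bp : bounded_sums (p i).
    have [C1 hC1] := bs; have [C2 hC2] := gam2.
    exists (2 * M%:R ^+ 2 * C2 + 2 * C1) => n.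
    have h1 := ler_wpM2l (ler0n R 2) (hC1 n).
    have M20 : 0 <= 2 * M%:R ^+ 2 :> R by rewrite mulr_ge0 ?sqr_ge0.
    have h2 := ler_wpM2l M20 (hC2 n).
    apply: le_trans (lerD h2 h1); rewrite !mulr_sumr -big_split/=; apply: ler_sum => k _.
    rewrite /p; have := enormD_sqr (tr i k) (b (U k omega) (x k omega)).
    have h3 : enorm (tr i k) ^+ 2 <= M%:R ^+ 2.
      by rewrite ler_pXn2r ?nnegrE ?enorm_ge0 ?ler0n ?enorm_trunc ?ler0n.
    move=> /le_trans h4; have /h4/(ler_wpM2l (sqr_ge0 (gam k))) := lerD
      (ler_wpM2l (ler0n R 2) h3) (lexx (2 * enorm (b (U k omega) (x k omega)) ^+ 2)).
    by lra.
  have [m2' hm2] := bounded_sums_tail (p0 i) bp e8.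
  exists (maxn m1 m2') => s t /andP[]; rewrite geq_max => /andP[m1s m2s] st; split.
    have := sub_series_geq (g i) st; rewrite /series /= => <-.
    have a1 := hm1 s m1s; have a2 := hm1 t (leq_trans m1s st).
    rewrite -(subrKA (\sum_(0 <= k < m1) g i k)) (le_trans (ler_normD _ _))//.
    by rewrite [`|\sum_(0 <= _ < m1) _ - _|]distrC; move: a1 a2; lra.
  apply: le_trans (hm2 t); rewrite (big_cat_nat m2s st)/= lerDr.
  by apply: sumr_ge0 => k _.
have [mf hmf] := choice tails.
(* The window starts after the thresholds of all [J] tests, so the same [m] serves every [i < J]. *)
have [m m0m Wm] := WM (maxn m0 (\max_(i < J) mf i)).
move: m0m; rewrite geq_max => /andP[m0m mfm].
exists m => // i s t iJ /andP[ms st] mt2.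
have mfs : (mf i <= s <= t)%N.
  rewrite st andbT (leq_trans _ ms)// (leq_trans _ mfm)//.
  exact: (leq_bigmax (Ordinal iJ)).
have [gs ps] := hmf i _ _ mfs.
have [mF iF _] := FP J.
(* The drift of the truncated selection differs from the second component of the test pair by at
   most the mean of the remainder. *)
have aMa : enorm (aM i - (test i).2) <= dl J M.
  rewrite enormBC -phiE /aM /dl.
  have mt := measurable_trunc M%:R (mphi i).
  have ti : vintegrable mu (fun xi => -1 *: trunc M%:R (phi i xi)).
    apply: vintegrableZ; apply: (dominated_vintegrable mt (iphi i)).
    by apply: filterE => xi; exact: enorm_trunc_le.
  have ti' : vintegrable mu (fun xi => trunc M%:R (phi i xi)).
    apply: (dominated_vintegrable mt (iphi i)).
    by apply: filterE => xi; exact: enorm_trunc_le.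
  rewrite -scaleN1r -vintegralZ// -vintegralD//; last exact: selection1_vintegrable (sphi i).
  apply: (@enorm_vintegral_le _ _ _ _ mu _ _ _ (iF M)).
    by under eq_fun do rewrite scaleN1r; exact: measurable_funBV.
  move=> xi; rewrite scaleN1r /F (bigD1 (Ordinal iJ))//= lerDl sumr_ge0// => j _.
  exact: enorm_ge0.
have step k : enorm (v i k.+1) ^+ 2 - enorm (v i k) ^+ 2 <=
    - 2 * (gam k * dot (bb k + (test i).2) (v i k)) - 2 * g i k + p i k
    + 2 * Q * dl J M * gam k + 2 * Q * (gam k * F J M (U k omega)).
  have := H1 i k M%:R; rewrite /= -/(tr i k) -/(v i k) -/(v i k.+1) -/(p i k).
  have rF : enorm (phi i (U k omega) - tr i k) <= F J M (U k omega).
    rewrite /F (bigD1 (Ordinal iJ))//= lerDl sumr_ge0// => j _; exact: enorm_ge0.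
  have d1 : - dot (phi i (U k omega) - tr i k) (v i k.+1) <= F J M (U k omega) * Q.
    apply: (@le_trans _ _ `|dot (phi i (U k omega) - tr i k) (v i k.+1)|).
      by rewrite -normrN ler_norm.
    apply: (le_trans (normr_dot_le _ _)); apply: ler_pM; rewrite ?enorm_ge0//.
    exact: xQ.
  have d2 : - dot (aM i - (test i).2) (v i k) <= dl J M * Q.
    apply: (@le_trans _ _ `|dot (aM i - (test i).2) (v i k)|).
      by rewrite -normrN ler_norm.
    apply: (le_trans (normr_dot_le _ _)); apply: ler_pM; rewrite ?enorm_ge0//.
    exact: xQ.
  have := ler_wpM2l (ltW (gam0 k)) d1; have := ler_wpM2l (ltW (gam0 k)) d2.
  have -> : dot (tr i k + b (U k omega) (x k omega)) (v i k) =
      dot (tr i k + b (U k omega) (x k omega) - (aM i + bb k)) (v i k) +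
      dot (bb k + (test i).2) (v i k) + dot (aM i - (test i).2) (v i k).
    by rewrite -!dotDl; congr dot; apply/rowP => j; rewrite !mxE; ring.
  rewrite /g; move: (dot (aM i - _) _) (dot (_ - tr i k) _) (dot (_ - (aM i + _)) _)
    (dot (bb k + _) _) (enorm (v i k.+1)) (enorm (v i k)) (F _ _ _) (dl _ _) (p i k).
  by move=> *; lra.
have tel : enorm (v i t) ^+ 2 - enorm (v i s) ^+ 2 <=
    - 2 * (\sum_(s <= k < t) gam k * dot (bb k + (test i).2) (v i k))
    - 2 * (\sum_(s <= k < t) g i k) + \sum_(s <= k < t) p i k
    + 2 * Q * dl J M * (\sum_(s <= k < t) gam k)
    + 2 * Q * (\sum_(s <= k < t) gam k * F J M (U k omega)).
  rewrite -(telescope_sumr (fun k => enorm (v i k) ^+ 2) st) !mulr_sumr -!sumrN -!big_split/=.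
  by apply: ler_sum => k _; have := step k; lra.
(* The maximal end [e m] depends on [m] only, so the remainder bound for the longest window covers
   every [s] and [t] at once. *)
have te : (t <= e m)%N by apply: e_max => //; exact: leq_trans st.
have WF : \sum_(s <= k < t) gam k * F J M (U k omega) <= q.+1%:R^-1.
  apply: le_trans (ltW Wm); rewrite (big_cat_nat ms (leq_trans st te))/=.
  rewrite (big_cat_nat st te)/= addrCA lerDl addr_ge0// sumr_ge0// => k _;
    by rewrite mulr_ge0// ltW.
have gs2 : \sum_(s <= k < t) gam k <= 2.
  apply: le_trans mt2; rewrite (big_cat_nat ms st)/= lerDr sumr_ge0// => k _.
  exact: ltW.
have gs0 : 0 <= \sum_(s <= k < t) gam k by apply: sumr_ge0 => k _; exact: ltW.
have dl0 : 0 <= dl J M by apply: Rintegral_ge0 => xi _; exact: F0.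
have qe : q.+1%:R^-1 * Q <= eps / 24.
  by move: qQ; rewrite invfM mulrA ltr_pdivlMr// => /ltW.
have h1 := ler_wpM2l (ltW Q0) WF.
have h2 : Q * (dl J M * (\sum_(s <= k < t) gam k)) <= Q * (q.+1%:R^-1 * 2).
  by rewrite ler_wpM2l ?(ltW Q0)// ler_pM.
have h3 : - (\sum_(s <= k < t) g i k) <= eps / 16.
  by apply: le_trans gs; rewrite -normrN ler_norm.
move: tel ps h1 h2 h3 qe; rewrite /bb /v.
move: (\sum_(s <= k < t) g i k) (\sum_(s <= k < t) p i k) (\sum_(s <= k < t) gam k)
  (\sum_(s <= k < t) gam k * F _ _ _) (\sum_(s <= k < t) gam k * dot _ _) (q.+1%:R^-1)
  (dl J M) (enorm _ ^+ 2) (enorm _ ^+ 2) => *.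
lra.
Qed.

End tests.
End forward_backward.

(** * Step-size series and ends of windows *)

Section step_sizes.
Context {R : realType}.
Implicit Types gam : nat -> R.

Lemma bounded_sums_of_series gam : (forall n, 0 <= gam n.+1) ->
  (\sum_(1 <= n <oo) (gam n)%:E < +oo)%E -> bounded_sums (fun k => gam k.+1).
Proof.
move=> g0 goo; have S0 : (0 <= \sum_(1 <= n <oo) (gam n)%:E)%E.
  by apply: nneseries_ge0 => -[|n]// _ _; rewrite lee_fin.
exists (fine (\sum_(1 <= n <oo) (gam n)%:E)%E) => n.
rewrite -lee_fin fineK; last by rewrite ge0_fin_numE.
rewrite -[X in (X%:E <= _)%E](big_add1 _ _ 0 n.+1 xpredT) /= -sumEFin.
by apply: nneseries_lim_ge => -[|k]// _ _; rewrite lee_fin.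
Qed.

Lemma divergent_tails gam : (forall n, 0 <= gam n.+1) ->
  (\sum_(1 <= n <oo) (gam n)%:E = +oo)%E ->
  forall m C, exists n, C <= \sum_(m <= k < n) gam k.+1.
Proof.
move=> g0 goo m C; apply: contrapT => nC.
have bd n : \sum_(0 <= k < n) gam k.+1 <= \sum_(0 <= k < m) gam k.+1 + C.
  have [nm|mn] := leqP n m; last first.
    rewrite (big_cat_nat _ (ltnW mn))//= lerD2l leNgt.
    by apply/negP => /ltW h; apply: nC; exists n.
  rewrite (big_cat_nat (n := n) (p := m))//= -addrA lerDl addr_ge0 ?sumr_ge0//.
  rewrite leNgt; apply/negP => C0; apply: nC; exists m.
  by rewrite big_geq// ltW.
suff : (\sum_(1 <= n <oo) (gam n)%:E <= (\sum_(0 <= k < m) gam k.+1 + C)%:E)%E.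
  by rewrite goo leye_eq.
apply: lime_le.
  by apply: is_cvg_nneseries => -[|n]// _ _; rewrite lee_fin.
apply: nearW => -[|n]; first by rewrite big_geq// lee_fin (le_trans _ (bd 0%N))// big_geq.
by rewrite sumEFin lee_fin big_add1.
Qed.

Lemma window_ends gam : (forall m C, exists n, C <= \sum_(m <= k < n) gam k) ->
  (forall k, 0 <= gam k) ->
  exists e : nat -> nat, (forall m, \sum_(m <= k < e m) gam k <= 2) /\
    forall m t, (m <= t)%N -> \sum_(m <= k < t) gam k <= 2 -> (t <= e m)%N.
Proof.
move=> gdiv g0.
suff /choice[e eP] m : exists e, \sum_(m <= k < e) gam k <= 2 /\
    forall t, (m <= t)%N -> \sum_(m <= k < t) gam k <= 2 -> (t <= e)%N.
  by exists e; split=> m; [have [] := eP m|move=> t; have [_] := eP m; apply].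
pose Q t := (m <= t)%N && (\sum_(m <= k < t) gam k <= 2).
have exQ : exists t, Q t by exists m; rewrite /Q leqnn big_geq ?ler0n.
(* Any value above 2 would do: once the elapsed time has reached 3, no later end is admissible, so a
   largest one exists. *)
have [n hn] := gdiv m 3.
have ubQ t : Q t -> (t <= n)%N.
  move=> /andP[mt t2]; rewrite leqNgt; apply/negP => nt.
  have [nm|mn] := leqP n m; first by move: hn; rewrite big_geq//; lra.
  move: t2; rewrite (big_cat_nat (ltnW mn) (ltnW nt))/=.
  have : 0 <= \sum_(n <= k < t) gam k by exact: sumr_ge0.
  by lra.
case: (ex_maxnP exQ ubQ) => e /andP[_ e2] emax; exists e; split => // t mt t2.
by apply: emax; rewrite /Q mt.
Qed.

End step_sizes.

Section test_points.
Context {R : realType} {N : nat}.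
Local Notation V := 'rV[R]_N.

Lemma enorm_row_mx (y a : V) : enorm (row_mx y a) ^+ 2 = enorm y ^+ 2 + enorm a ^+ 2.
Proof.
rewrite !enorm_sqr /dot big_split_ord/=.
congr (_ + _); by apply: eq_bigr => i _; rewrite ?row_mxEl ?row_mxEr.
Qed.

(** A pair is stored as one row vector of length [N + N], so density in a subset of a Euclidean
    space applies; both components are bounded by the norm of the row. *)
Lemma countable_dense_graph (AA : operator R N) : gr AA !=set0 ->
  exists2 f : nat -> V * V, forall n, AA (f n).1 (f n).2 &
    forall y a e, AA y a -> 0 < e -> exists n,
      enorm (y - (f n).1) < e /\ enorm (a - (f n).2) < e.
Proof.
move=> [[y0 a0] /= Aya0].
pose C := [set z : 'rV[R]_(N + N) | AA (lsubmx z) (rsubmx z)].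
have [|f Cf fd] := @countable_dense _ _ C.
  by exists (row_mx y0 a0); rewrite /C /= row_mxKl row_mxKr.
exists (fun n => (lsubmx (f n), rsubmx (f n))) => // y a e Aya e0.
have [|n hn] := fd (row_mx y a) e _ e0; first by rewrite /C /= row_mxKl row_mxKr.
have : enorm (row_mx y a - f n) ^+ 2 < e ^+ 2.
  by rewrite ltr_pXn2r ?nnegrE ?enorm_ge0 ?ltW.
rewrite -{1}(hsubmxK (f n)) opp_row_mx add_row_mx enorm_row_mx => h.
exists n; rewrite /= -(ltr_pXn2r (n := 2))// ?nnegrE ?enorm_ge0 ?ltW//.
  split; first by apply: le_lt_trans h; rewrite lerDl sqr_ge0.
rewrite -(ltr_pXn2r (n := 2))// ?nnegrE ?enorm_ge0 ?ltW//.
by apply: le_lt_trans h; rewrite lerDr sqr_ge0.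
Qed.

(** One sequence serves two purposes: spanning points with arbitrary images come first, and a dense
    sequence of the graph follows, shifted by their number. *)
Lemma test_points (AA : operator R N) : gr AA !=set0 ->
  exists (test : nat -> V * V) (r : nat), exists2 C : R, 0 <= C &
    [/\ (0 < r)%N, forall i, AA (test i).1 (test i).2,
        forall y a e, AA y a -> 0 < e -> exists i,
          enorm (y - (test i).1) < e /\ enorm (a - (test i).2) < e &
        forall p q, dom AA p -> dom AA q -> enorm (p - q) <=
          C * \sum_(i < r) `|dot (p - q) ((test i).1 - (test 0).1)|].
Proof.
move=> grA; have [f fA fd] := countable_dense_graph grA.
have [|s [C C0 [s0 sD sC]]] := @spanning_points _ _ (dom AA).
  by have [[y a] Aya] := grA; exists y, a.
have /choice[g gA] y : exists a, dom AA y -> AA y a.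
  have [[a Aya]|nD] := pselect (dom AA y); first by exists a.
  by exists 0.
pose test i := if (i < size s)%N then (s`_i, g s`_i) else f (i - size s)%N.
exists test, (size s), C => //; split => //.
- move=> i; rewrite /test; case: ifPn => // si /=.
  by apply: gA; apply: sD; exact: mem_nth.
- move=> y a e Aya e0; have [n hn] := fd y a e Aya e0.
  by exists (size s + n)%N; rewrite /test ltnNge leq_addr/= addKn.
- move=> p q Dp Dq; apply: (le_trans (sC p q Dp Dq)).
  by rewrite ler_wpM2l// ler_sum// => i _; rewrite /test ltn_ord s0.
Qed.

End test_points.

(** The cluster point is approximated by some [w n]; along the sequence the distance to this [w n]
    nearly stabilizes, at the small value it takes when the sequence visits [x_]. Hence a dense
    sequence of reference points is enough. *)
Lemma opial_cvg {R : realType} {N : nat} (x w : nat -> 'rV[R]_N) (x_ : 'rV[R]_N) :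
  (forall e, 0 < e -> exists n, enorm (x_ - w n) < e) ->
  (forall n, exists l : R, (fun k => enorm (x k - w n) ^+ 2) @ \oo --> l) ->
  (forall e m0, 0 < e -> exists2 m, (m0 <= m)%N & enorm (x m - x_) < e) ->
  x @ \oo --> x_.
Proof.
move=> wd wl cl; apply/cvg_enorm_ltP => e e0.
have e4 : 0 < e / 4 by rewrite divr_gt0.
have [n wn] := wd _ e4.
have d0 : 0 < e ^+ 2 / 16 by rewrite divr_gt0// exprn_gt0.
have [m0 hm0] := (cvg_cauchyP _).1 (wl n) _ d0.
have [m m0m xm] := cl _ m0 e4.
exists m0 => k m0k.
have h1 := hm0 k m0k; have h2 := hm0 m m0m.
have h3 : enorm (x m - w n) < e / 2.
  by apply: (le_lt_trans (enorm_triangle x_ _ _)); lra.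
have h4 : enorm (x m - w n) ^+ 2 <= (e / 2) ^+ 2.
  by rewrite ler_pXn2r ?nnegrE ?enorm_ge0 ?ltW ?divr_gt0.
have h5 : enorm (x k - w n) < 3 / 4 * e.
  rewrite -(ltr_pXn2r (n := 2))// ?nnegrE ?enorm_ge0//; last by rewrite mulr_ge0// ltW.
  by move: h1 h2 h4; rewrite !ltr_norml => /andP[_ ?] /andP[? _] ?; lra.
apply: (le_lt_trans (enorm_triangle (w n) _ _)).
by rewrite [enorm (w n - x_)]enormBC; lra.
Qed.

Theorem corollary3p2 (R : realType) (N : nat)
  (d : measure_display) (Xi : measurableType d) (mu : probability Xi R)
  (d' : measure_display) (Omega : measurableType d') (P : probability Omega R)
  (A B : Xi -> operator R N) (b : Xi -> 'rV[R]_N -> 'rV[R]_N)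
  (u : nat -> {RV P >-> Xi}) (gamma : nat -> R) :
  let DD := mean_domain mu A in
  let AA := mean_operator mu A in
  let BB : operator R N := fun x => aumann mu (fun xi => B xi x) in
  let ZZ := zeros (addop AA BB) in
  measure_is_complete mu ->
  (* the random operator A *)
  random_operator A ->
  DD !=set0 ->
  (forall x, DD x -> set_integrable mu (fun xi => A xi x)) ->
  (* the random operator B and its selection b *)
  random_operator B ->
  {ae mu, forall xi, dom (B xi) = setT} ->
  (forall x, set_integrable mu (fun xi => B xi x)) ->
  measurable_fun setT (fun z : Xi * borelRV R N => b z.1 z.2 : borelRV R N) ->
  (forall x, selections mu 1 (fun xi => B xi x) (b ^~ x)) ->
  (* the random sequence u_1, u_2, ... and the step sizes gamma_1, gamma_2, ... *)
  iid mu (fun n => u n.+1) ->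
  (forall n, 0 < gamma n.+1) ->
  (\sum_(1 <= n <oo) (gamma n ^+ 2)%:E < +oo)%E ->
  (\sum_(1 <= n <oo) (gamma n)%:E = +oo)%E ->
  (* 1 *)
  maximal_monotone AA ->
  (* 2 *)
  forall p : nat, (1 <= p)%N ->
  (exists2 x, ZZ x & zero_selections mu A B (2 * p)%:R x !=set0) ->
  (* 3 *)
  (forall K : set 'rV[R]_N, compact K ->
     exists eps : R,
       [/\ 0 < eps <= 1,
           (ereal_sup [set \int[mu]_xi (enorm (least_norm (A xi x))
                                          `^ (1 + eps))%:E
                      | x in K `&` DD] < +oo)%E &
           exists2 y0, DD y0 &
             (\int[mu]_xi (enorm (least_norm (A xi y0))
                             `^ (1 + 1 / eps))%:E < +oo)%E]) ->
  (* 4 *)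
  (exists2 C : R, 0 < C &
     forall x : 'rV[R]_N,
       ((C * dist DD x ^+ 2)%:E
        <= \int[mu]_xi (dist (dom (A xi)) x ^+ 2)%:E)%E) ->
  (fun n => gamma n.+1 / gamma n) @ \oo --> (1 : R) ->
  (* 5 *)
  (exists2 C : R, 0 < C &
     forall (x : 'rV[R]_N) (g : R), 0 < g ->
       ((1 / g ^+ 4)%:E *
          \int[mu]_xi (enorm (resolvent g (A xi) x
                              - proj_on (closure (dom (A xi))) x) ^+ 4)%:E
        <= (C * (1 + enorm x ^+ (2 * p)))%:E)%E) ->
  (* 6 *)
  (exists M : Xi -> R,
     [/\ forall xi, 0 <= M xi,
         mu.-integrable setT (fun xi => (M xi ^+ (2 * p))%:E) &
         forall xi x, enorm (b xi x) <= M xi * (1 + enorm x)]) ->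
  (exists2 C : R, 0 < C &
     forall x : 'rV[R]_N,
       (\int[mu]_xi (enorm (b xi x) ^+ 4)%:E
        <= (C * (1 + enorm x ^+ (2 * p)))%:E)%E) ->
  (* 7 *)
  demipositive (addop AA BB) ->
  (* 8 *)
  (forall x, ZZ x -> zero_selections mu A B 2 x !=set0) ->
  forall x0 : 'rV[R]_N,
  exists U : {RV P >-> borelRV R N},
    {ae P, forall omega, ZZ (U omega)} /\
    {ae P, forall omega,
       (fun n => iterates A b gamma u x0 n omega) @ \oo
         --> (U omega : 'rV[R]_N)}.
Proof.
move=> DD AA BB ZZ _ rA DD0 Aint [maxB _] _ _ mb bsel iidu g0 g2 g1 maxAA p p1 [w0 Zw0 _].
move=> _ [C C0 hC] _ _ [M [M0 Mi bM]] _ [w Zw demi] sel x0.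
(* The shift by one makes step [n] use the driver and the step size of index [n], as in the
   recursion of driven processes. *)
pose U n := u n.+1; pose gam n := gamma n.+1.
pose x n omega := iterates A b gamma u x0 n omega.
have gam0 k : 0 < gam k by exact: g0.
have gam2 : bounded_sums (fun k => gam k ^+ 2).
  by apply: (bounded_sums_of_series (gam := fun n => gamma n ^+ 2)) => // n; exact: sqr_ge0.
have gdiv : forall m C, exists n, C <= \sum_(m <= k < n) gam k.
  by apply: divergent_tails => // n; exact/ltW/g0.
have [e [e_le e_max]] := window_ends gdiv (fun k => ltW (g0 k)).
have gam_cvg0 eps : 0 < eps -> exists m, forall k, (m <= k)%N -> gam k <= eps.
  move=> eps0; have e2 : 0 < eps ^+ 2 by rewrite exprn_gt0.
  have [m hm] := bounded_sums_cvg0 (fun k => sqr_ge0 (gam k)) gam2 e2.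
  by exists m => k /hm; rewrite ler_pXn2r ?nnegrE ?(ltW (gam0 k)) ?(ltW eps0).
(* An integrable majorant of [M xi ^+ 2]: the term 1 covers [M xi <= 1], and [1 <= p] covers the
   rest. *)
pose m2 xi := 1 + M xi ^+ (2 * p).
have m20 xi : 0 <= m2 xi by rewrite addr_ge0// exprn_ge0.
have m2i : mu.-integrable setT (EFin \o m2).
  have i1 : mu.-integrable setT (EFin \o cst (1 : R)).
    exact: finite_measure_integrable_cst.
  by apply: (eq_integrable measurableT) (integrableD measurableT i1 Mi) => t _.
have bm2 xi y : enorm (b xi y) ^+ 2 <= m2 xi * (1 + enorm y) ^+ 2.
  have y0 : 0 <= 1 + enorm y by rewrite addr_ge0 ?enorm_ge0.
  apply: (@le_trans _ _ ((M xi * (1 + enorm y)) ^+ 2)).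
    by rewrite ler_pXn2r ?nnegrE ?enorm_ge0 ?mulr_ge0.
  rewrite exprMn ler_wpM2r ?sqr_ge0// /m2.
  have [M1|/ltW M1] := leP (M xi) 1.
    by rewrite (@le_trans _ _ 1)// ?exprn_ile1// lerDl exprn_ge0.
  apply: (@le_trans _ _ (M xi ^+ (2 * p))); last by rewrite lerDr.
  by rewrite ler_weXn2l// leq_pmulr.
have bB y : {ae mu, forall xi, B xi y (b xi y)} by have [] := bsel y.
have x_0 omega : x 0%N omega = x0 by [].
have xS n omega : x n.+1 omega =
  resolvent (gam n) (A (U n omega)) (x n omega - gam n *: b (U n omega) (x n omega)) by [].
have lyap y : ZZ y -> {ae P, forall omega, exists l : R,
    (fun n => enorm (x n omega - y) ^+ 2) @ \oo --> l}.
  move=> /sel[[phi psi] [/= sphi spsi phi_psi0]].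
  exact: (lyapunov_cvg rA maxB mb bB m20 m2i bm2 iidu gam0 gam2 x_0 xS sphi spsi phi_psi0).
(* A dense sequence of zeros leaves a single null set outside which all the required Lyapunov limits
   exist. *)
have [q Zq q_dense] : exists2 q : nat -> 'rV[R]_N, forall n, ZZ (q n) &
    forall y eps, ZZ y -> 0 < eps -> exists n, enorm (y - q n) < eps.
  by apply: countable_dense; exists w0.
have lyap_q := ae_foralln (fun n => lyap _ (Zq n)).
have [[phi0 psi0] [/= sphi0 spsi0 phi_psi0]] := sel _ Zw.
have fwd := forward_sums rA maxB mb bB m20 m2i bm2 iidu gam0 gam2 x_0 xS sphi0 spsi0 phi_psi0.
have dcv := dist_cvg0 rA maxB mb bB m20 m2i bm2 iidu gam0 gam2 x_0 xS sphi0 spsi0 phi_psi0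
  DD0 C0 hC.
have DDdom y : DD y -> dom AA y.
  move=> Dy; have [phi sphi] := Aint y Dy.
  by exists (vintegral mu phi); split => //; exists phi.
have grAA : gr AA !=set0 by have [] := maxAA.
have [test [size_test [CD CD0 [r0 testAA test_dense test_span]]]] := test_points grAA.
have /choice[phi phiP] i : exists phi, selections mu 1 (fun xi => A xi (test i).1) phi /\
    vintegral mu phi = (test i).2.
  by have [_ [phi sphi <-]] := testAA i; exists phi.
have tests := test_inequalities rA mb m20 m2i bm2 iidu gam0 gam2 x_0 xS
  (fun i => (phiP i).1) (fun i => (phiP i).2) e_le e_max.
have mx n : measurable_fun setT (x n : Omega -> borelRV R N).
  exact: (measurable_process (s := x : nat -> Omega -> borelRV R N) x_0 xS
    (measurable_iteration_map rA mb gam0)).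
have [F mF Flim] := measurable_vlimit mx.
pose V : {RV P >-> borelRV R N} :=
  HB.pack (F : Omega -> borelRV R N) (isMeasurableFun.Build _ _ Omega (borelRV R N) F mF).
(* The random variable is already built as a measurable version of the limit; it remains to show
   that almost every trajectory converges to a zero. *)
suff main : {ae P, forall omega, exists2 y, ZZ y & (x ^~ omega) @ \oo --> y}.
  exists V; split; apply: filterS main => omega [y Zy xy] /=.
    by rewrite (Flim _ _ xy).
  by rewrite (Flim _ _ xy).
have lw := lyap _ Zw.
(* From here on one trajectory is fixed and the argument is deterministic. *)
apply: filterS3 lyap_q (filterI fwd dcv) (filterI tests lw).
move=> omega lq [fs dc] [ti [l xw]].
have [S xbd] : exists S, forall n, enorm (x n omega) <= S.
  have [K [_ hK]] := cvg_seq_bounded (cvgP _ xw).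
  exists (1 + (K + 1) + enorm w) => n.
  rewrite -{1}(subrK w (x n omega)) (le_trans (enormD _ _))// lerD2r.
  apply: enorm_le_sqr; apply: le_trans (hK (K + 1) _ n I); first exact: ler_norm.
  by rewrite ltrDl.
have S0 : 0 <= S by apply: le_trans (xbd 0%N); exact: enorm_ge0.
pose beta n := vintegral mu (b ^~ (x n omega)).
have mb1 y : measurable_fun setT (b ^~ y : Xi -> borelRV R N).
  exact: (measurable_fun_pair1 (y : borelRV R N) mb).
pose T := \int[mu]_xi (1 + m2 xi * (1 + S) ^+ 2).
have betaT n : enorm (beta n) <= T.
  have i1 : mu.-integrable setT (EFin \o (fun xi => 1 + m2 xi * (1 + S) ^+ 2)).
    have i2 : mu.-integrable setT (EFin \o cst (1 : R)).
      exact: finite_measure_integrable_cst.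
    apply: (eq_integrable measurableT) (integrableD measurableT i2
      (integrableZl measurableT ((1 + S) ^+ 2) m2i)) => t _.
    by rewrite /= -EFinM mulrC.
  apply: (@enorm_vintegral_le _ _ _ _ mu _ _ (mb1 _) i1) => xi.
  apply: enorm_le_sqr; apply: (le_trans (bm2 _ _)); apply: ler_wpM2l => //.
  by rewrite ler_pXn2r ?nnegrE ?addr_ge0 ?enorm_ge0// lerD2l.
have [|||||x_ [a_ [b_ [cl Ax_ Hb dab]]]] := @cluster_point_critical _ _ AA maxAA
  (x ^~ omega) beta gam (Num.max S T) w gam0 gam_cvg0 gdiv _ _ _ _ test test_dense
  size_test CD CD0 r0 test_span.
- by move=> k; rewrite le_max xbd.
- by move=> k; rewrite le_max betaT orbT.
- move=> eps eps0; have [m hm] := dc _ eps0; exists m => n /hm /(dist_lt DD0)[y Dy xy].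
  by exists y; [exact: DDdom|exact: ltW].
- by apply/cvg_cauchyP; exists l.
- move=> eps J m0 eps0; have [m m0m hm] := ti fs (ex_intro _ S xbd) eps J m0 eps0.
  by exists m => // i s t iJ mst mt2; rewrite mulNr; exact: hm.
have Bx_ : BB x_ b_.
  apply: (aumann_closed maxB mb1 bB m20 m2i bm2) => eps eps0.
  have [m [n [H0 xk hb]]] := Hb eps eps0; set H := \sum_(m <= k < n) gam k in H0 hb.
  (* The normalized step sizes of the window are the convex weights, and the iterates on it are the
     points close to [x_]. *)
  exists m, n, (fun k => gam k / H), (x ^~ omega); split => //.
  - by move=> k; rewrite divr_ge0// ltW.
  - by rewrite -mulr_suml divff// gt_eqF.
  - rewrite (eq_bigr (fun k => H^-1 *: (gam k *: beta k))) -?scaler_sumr// => k _.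
    by rewrite scalerA mulrC.
have Zx_ : ZZ x_.
  apply: (demi (fun=> x_) (fun=> a_ + b_)).
  - by move=> n; exists a_ => //; exists b_.
  - exact: cvg_cst.
  - by exists (enorm (a_ + b_)).
  - by under eq_fun do rewrite dotC dab; exact: cvg_cst.
exists x_ => //; apply: (opial_cvg (w := q)) => //.
by move=> eps eps0; exact: q_dense.
Qed.
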